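(* There exists an automorphism $\mathbf{T}_1^{-1}$ of $\widetilde{\mathbf U}^\imath$ such that $$\mathbf{T}_1^{-1}(x)\cdot\widetilde\Upsilon_1=\widetilde\Upsilon_1\cdot\widetilde{T}_{\mathbf r_1}^{-1}(x),\qquad\text{for all }x\in\widetilde{\mathbf U}^\imath.$$ More explicitly, the action of $\mathbf{T}_1^{-1}$ is given by $$\mathbf{T}_1^{-1}(\mathbb{K}_1)= v^{-1}\mathbb{K}_2^{-1},\quad \mathbf{T}_1^{-1}(\mathbb{K}_2)= v^{-1}\mathbb{K}_1^{-1},\quad \mathbf{T}_1^{-1}(\mathbb{K}_0)= v^{2}\mathbb{K}_0\mathbb{K}_1^2\mathbb{K}_2^2,$$ $$\mathbf{T}_1^{-1}(B_1)=-vB_1\mathbb{K}_1^{-1},\qquad \mathbf{T}_1^{-1}(B_2)=-vB_2\mathbb{K}_2^{-1},$$ $$\mathbf{T}_1^{-1}(B_0)= v\Big[[B_1,B_2]_v,\big[B_2,[B_1,B_0]_v\big]\Big]-\big[[B_1,B_2]_{v^3},B_0\big]\mathbb{K}_2+vB_0\mathbb{K}_1\mathbb{K}_2.$$ (Here $\mathbf{T}_1^{-1}$ is treated just as a symbol.)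
   Context: Here $v$ is an indeterminate, $[n]=\frac{v^n-v^{-n}}{v-v^{-1}}$, $[m]!=\prod_{k=1}^m[k]$, $[A,B]_{v^a}=AB-v^aBA$, $[A,B]=AB-BA$. Let $\mathbb{I}=\{0,1,2\}$, let $(c_{ij})_{i,j\in\mathbb{I}}$ be the Cartan matrix of affine type $A_2^{(1)}$ ($c_{ii}=2$, $c_{ij}=-1$ for $i\ne j$), and let $\tau$ be the involution of $\mathbb{I}$ with $\tau(0)=0$, $\tau(1)=2$, $\tau(2)=1$. The Drinfeld double quantum group $\widetilde{\mathbf U}$ is the algebra generated by $E_i,F_i,K_i^{\pm1},K_i'^{\pm1}$ ($i\in\mathbb{I}$), where all the $K_i,K_j'$ commute with each other, $K_iE_j=v^{c_{ij}}E_jK_i$, $K_iF_j=v^{-c_{ij}}F_jK_i$, $K_i'E_j=v^{-c_{ij}}E_jK_i'$, $K_i'F_j=v^{c_{ij}}F_jK_i'$, $[E_i,F_j]=\delta_{ij}\frac{K_i-K_i'}{v-v^{-1}}$, and the standard quantum Serre relations $E_i^2E_j-[2]E_iE_jE_i+E_jE_i^2=0$, $F_i^2F_j-[2]F_iF_jF_i+F_jF_i^2=0$ ($i\neq j$) hold. It is considered over $\mathbb{Q}(v)$, and, for the formulation involving the rescaled braid operators, over a field extension of $\mathbb{Q}(v)$ containing the needed fractional powers. Infinite sums such as $\widetilde\Upsilon_1$ are taken in the usual completion of $\widetilde{\mathbf U}$ with respect to the left ideals generated by products of at least $N$ of the $E_i$'s, $N\to\infty$. The algebra $\widetilde{\mathbf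 U}^\imath$ is the $\mathbb{Q}(v)$-algebra generated by $B_i$ and invertible elements $\mathbb{K}_i$ ($i\in\mathbb{I}$), subject to: $\mathbb{K}_i\mathbb{K}_j=\mathbb{K}_j\mathbb{K}_i$ and $\mathbb{K}_iB_j=v^{c_{\tau i,j}-c_{ij}}B_j\mathbb{K}_i$ for $i,j\in\mathbb{I}$; $B_2B_1^2-[2]B_1B_2B_1+B_1^2B_2=-[2](v\mathbb{K}_1B_1+vB_1\mathbb{K}_2)$; $B_1B_2^2-[2]B_2B_1B_2+B_2^2B_1=-[2](v\mathbb{K}_2B_2+vB_2\mathbb{K}_1)$; $B_0B_i^2-[2]B_iB_0B_i+B_i^2B_0=0$ for $i=1,2$; $B_iB_0^2-[2]B_0B_iB_0+B_0^2B_i=-v^{-1}\mathbb{K}_0B_i$ for $i=1,2$. It is identified with a subalgebra of $\widetilde{\mathbf U}$ via the embedding $B_i\mapsto F_i+E_{\tau i}K_i'$ ($i\in\mathbb{I}$), $\mathbb{K}_0\mapsto-v^2K_0K_0'$, $\mathbb{K}_j\mapsto K_jK_{\tau j}'$ ($j=1,2$). Braid operators: for $i\in\mathbb{I}$, $T_i$ is the automorphism of $\widetilde{\mathbf U}$ with $T_i(K_i)=K_i^{-1}$, $T_i(K_i')=K_i'^{-1}$, $T_i(E_i)=-F_iK_i'^{-1}$, $T_i(F_i)=-K_i^{-1}E_i$, and, for $j\ne i$, $T_i(K_j)=K_iK_j$, $T_i(K_j')=K_i'K_j'$, $T_i(E_j)=[E_i,E_j]_{v^{-1}}$, $T_i(F_j)=[F_j,F_i]_v$.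 Let $\varsigma_\diamond=-v^{-1/2}$ and let $\Psi_\diamond$ be the automorphism of $\widetilde{\mathbf U}$ with $K_i\mapsto\varsigma_\diamond^{1/2}K_i$, $K_i'\mapsto\varsigma_\diamond^{1/2}K_i'$, $E_i\mapsto\varsigma_\diamond^{1/2}E_i$, $F_i\mapsto F_i$. Put $\widetilde{T}_j=\Psi_\diamond^{-1}\circ T_j\circ\Psi_\diamond$ for $j=1,2$ and $\widetilde{T}_{\mathbf r_1}^{-1}=\widetilde{T}_1^{-1}\widetilde{T}_2^{-1}\widetilde{T}_1^{-1}=\widetilde{T}_2^{-1}\widetilde{T}_1^{-1}\widetilde{T}_2^{-1}$. The quasi $K$-matrix of the rank one subdiagram $(\{1,2\},\tau)$ is $$\widetilde\Upsilon_1=\bigg(\sum_{m\ge0}\frac{v^{-m(m-1)/2}(-1)^m}{[m]!}[E_1,E_2]_{v^{-1}}^m\bigg)\bigg(\sum_{m\ge0}\frac{v^{-m(m-1)/2}(-1)^m}{[m]!}[E_2,E_1]_{v^{-1}}^m\bigg).$$ *)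

(* Defs.v *)
From HB Require Import structures.
From mathcomp Require Import all_boot all_order all_algebra.
From mathcomp Require Import boolp.

Set Implicit Arguments.
Unset Strict Implicit.
Unset Printing Implicit Defensive.

Import GRing.Theory.
Local Open Scope ring_scope.
Local Open Scope quotient_scope.

(* Noncommutative polynomial expressions in the generators [G]; the algebra
   presented by [rel] is the quotient of this type by the least congruence that
   contains [rel] and the axioms of unital associative algebras. *)
Inductive expr (R : fieldType) (G : Type) : Type :=
| Gen of G
| Cst of R
| Add of expr R G & expr R G
| Mul of expr R G & expr R G.

Arguments Gen {R G} _.
Arguments Cst {R G} _.

Declare Scope expr_scope.
Delimit Scope expr_scope with X.
Bind Scope expr_scope with expr.
Notation "s + t" := (Add s t) : expr_scope.
Notation "s * t" := (Mul s t) : expr_scope.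
Notation "c *: s" := (Mul (Cst c%R) s) : expr_scope.
Notation "- s" := (Mul (Cst (-1)%R) s) : expr_scope.
Notation "s - t" := (Add s (- t)) : expr_scope.
Notation "0" := (Cst 0%R) : expr_scope.
Notation "1" := (Cst 1%R) : expr_scope.

Inductive cong (R : fieldType) (G : Type) (rel : expr R G -> expr R G -> Prop) :
  expr R G -> expr R G -> Prop :=
| cong_rel s t of rel s t : cong rel s t
| cong_refl s : cong rel s s
| cong_sym s t of cong rel s t : cong rel t s
| cong_trans s t u of cong rel s t & cong rel t u : cong rel s u
| cong_add s s' t t' of cong rel s s' & cong rel t t' :
    cong rel (s + t) (s' + t')
| cong_mul s s' t t' of cong rel s s' & cong rel t t' :
    cong rel (s * t) (s' * t')
| cong_addA s t u : cong rel (s + (t + u)) ((s + t) + u)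
| cong_addC s t : cong rel (s + t) (t + s)
| cong_add0 s : cong rel (0 + s) s
| cong_addN s : cong rel (- s + s) 0
| cong_mulA s t u : cong rel (s * (t * u)) ((s * t) * u)
| cong_mul1l s : cong rel (1 * s) s
| cong_mul1r s : cong rel (s * 1) s
| cong_mulDl s t u : cong rel ((s + t) * u) (s * u + t * u)
| cong_mulDr s t u : cong rel (s * (t + u)) (s * t + s * u)
| cong_cstD c d : cong rel (Cst (c + d)) (Cst c + Cst d)
| cong_cstM c d : cong rel (Cst (c * d)) (Cst c * Cst d)
| cong_cstC c s : cong rel (Cst c * s) (s * Cst c).

HB.instance Definition _ (R : fieldType) (G : Type) := gen_eqMixin (expr R G).
HB.instance Definition _ (R : fieldType) (G : Type) :=
  gen_choiceMixin (expr R G).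

Section Presented.
Variables (R : fieldType) (G : Type) (rel : expr R G -> expr R G -> Prop).

Definition congb (s t : expr R G) : bool := `[< cong rel s t >].

Lemma congb_equiv : equiv_class_of congb.
Proof.
split=> [s|s t|t s u].
- exact/asboolP/cong_refl.
- by apply/asboolP/asboolP => ?; apply: cong_sym.
- by move=> /asboolP st /asboolP tu; apply/asboolP/(cong_trans st tu).
Qed.

Canonical congb_rel := EquivRelPack congb_equiv.

Definition presented : Type := {eq_quot congb_rel}.
HB.instance Definition _ := Choice.on presented.

Definition cls (s : expr R G) : presented := \pi_({eq_quot congb_rel}) s.
Definition rep (x : presented) : expr R G := repr (x : {eq_quot congb_rel}).

Lemma repK : cancel rep cls. Proof. exact: reprK. Qed.

Lemma clsP s t : cls s = cls t <-> cong rel s t.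
Proof.
by split=> [/eqquotP/asboolP//|st]; apply/eqquotP/asboolP.
Qed.

Lemma rep_cls s : cong rel (rep (cls s)) s.
Proof. by apply/clsP; rewrite repK. Qed.

Lemma clsE (P : presented -> Prop) : (forall s, P (cls s)) -> forall x, P x.
Proof. by move=> H x; rewrite -(repK x). Qed.

Definition pzero : presented := cls 0%X.
Definition pone : presented := cls 1%X.
Definition padd (x y : presented) := cls (rep x + rep y)%X.
Definition popp (x : presented) := cls (- rep x)%X.
Definition pmul (x y : presented) := cls (rep x * rep y)%X.
Definition pscale (c : R) (x : presented) := cls (c *: rep x)%X.

Lemma paddE s t : padd (cls s) (cls t) = cls (s + t)%X.
Proof. by apply/clsP/cong_add; apply: rep_cls. Qed.

Lemma pmulE s t : pmul (cls s) (cls t) = cls (s * t)%X.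
Proof. by apply/clsP/cong_mul; apply: rep_cls. Qed.

Lemma poppE s : popp (cls s) = cls (- s)%X.
Proof. by apply/clsP/cong_mul; [apply: cong_refl|apply: rep_cls]. Qed.

Lemma pscaleE c s : pscale c (cls s) = cls (c *: s)%X.
Proof. by apply/clsP/cong_mul; [apply: cong_refl|apply: rep_cls]. Qed.

Fact paddA : associative padd.
Proof.
by elim/clsE=> s; elim/clsE=> t; elim/clsE=> u; rewrite !paddE;
  apply/clsP/cong_addA.
Qed.
Fact paddC : commutative padd.
Proof. by elim/clsE=> s; elim/clsE=> t; rewrite !paddE; apply/clsP/cong_addC. Qed.
Fact padd0 : left_id pzero padd.
Proof. by elim/clsE=> s; rewrite paddE; apply/clsP/cong_add0. Qed.
Fact paddN : left_inverse pzero popp padd.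
Proof. by elim/clsE=> s; rewrite poppE paddE; apply/clsP/cong_addN. Qed.

HB.instance Definition _ :=
  GRing.isZmodule.Build presented paddA paddC padd0 paddN.

Fact pmulA : associative pmul.
Proof.
by elim/clsE=> s; elim/clsE=> t; elim/clsE=> u; rewrite !pmulE;
  apply/clsP/cong_mulA.
Qed.
Fact pmul1l : left_id pone pmul.
Proof. by elim/clsE=> s; rewrite pmulE; apply/clsP/cong_mul1l. Qed.
Fact pmul1r : right_id pone pmul.
Proof. by elim/clsE=> s; rewrite pmulE; apply/clsP/cong_mul1r. Qed.
Fact pmulDl : left_distributive pmul padd.
Proof.
by elim/clsE=> s; elim/clsE=> t; elim/clsE=> u; rewrite !(paddE, pmulE);
  apply/clsP/cong_mulDl.
Qed.
Fact pmulDr : right_distributive pmul padd.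
Proof.
by elim/clsE=> s; elim/clsE=> t; elim/clsE=> u; rewrite !(paddE, pmulE);
  apply/clsP/cong_mulDr.
Qed.

HB.instance Definition _ :=
  GRing.Zmodule_isPzRing.Build presented pmulA pmul1l pmul1r pmulDl pmulDr.

Fact pscaleA (a b : R) x : pscale a (pscale b x) = pscale (a * b) x.
Proof.
elim/clsE: x => s; rewrite !pscaleE -!pmulE (pmulA (cls _)) (pmulE (Cst a)).
by congr pmul; apply/clsP/cong_sym/cong_cstM.
Qed.
Fact pscale1 : left_id 1 pscale.
Proof. by elim/clsE=> s; rewrite pscaleE; apply/clsP/cong_mul1l. Qed.
Fact pscaleDr : right_distributive pscale +%R.
Proof.
by move=> c; elim/clsE=> s; elim/clsE=> t; rewrite /GRing.add /= !(paddE, pscaleE);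
  apply/clsP/cong_mulDr.
Qed.
Fact pscaleDl (x : presented) :
  {morph (fun c : R => pscale c x) : a b / a + b >-> a + b}.
Proof.
elim/clsE: x => s a b; rewrite [RHS]/GRing.add /= !pscaleE paddE -!pmulE.
rewrite -paddE -!pmulE -pmulDl paddE; congr pmul.
exact/clsP/cong_cstD.
Qed.

HB.instance Definition _ :=
  GRing.Zmodule_isLmodule.Build R presented pscaleA pscale1 pscaleDr pscaleDl.

Lemma clsD s t : cls (s + t)%X = cls s + cls t.
Proof. by rewrite -paddE. Qed.
Lemma clsM s t : cls (s * t)%X = cls s * cls t.
Proof. by rewrite -pmulE. Qed.
Lemma clsZ c s : cls (c *: s)%X = c *: cls s.
Proof. by rewrite -pscaleE. Qed.
Lemma cls1 : cls 1%X = 1. Proof. by []. Qed.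
Lemma cls0 : cls 0%X = 0. Proof. by []. Qed.
Lemma clsN s : cls (- s)%X = - cls s.
Proof. by rewrite -poppE. Qed.
Lemma clsC c : cls (Cst c) = c *: (1 : presented).
Proof. by rewrite -cls1 -clsZ; apply/clsP/cong_sym/cong_mul1r. Qed.
Lemma cls_rel s t : rel s t -> cls s = cls t.
Proof. by move=> st; apply/clsP/cong_rel. Qed.

Fact pscaleAl (c : R) (x y : presented) : c *: (x * y) = (c *: x) * y.
Proof.
elim/clsE: x => s; elim/clsE: y => t; rewrite -clsM -!clsZ -clsM.
exact/clsP/cong_mulA.
Qed.
Fact pscaleAr (c : R) (x y : presented) : c *: (x * y) = x * (c *: y).
Proof.
elim/clsE: x => s; elim/clsE: y => t; rewrite -clsM -!clsZ -clsM.
apply/clsP/(cong_trans (cong_mulA _ _ _ _)).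
apply: cong_trans (cong_sym (cong_mulA _ _ _ _)).
exact: cong_mul (cong_cstC _ _ _) (cong_refl _ _).
Qed.

Section Lift.
Variables (A : algType R) (g : G -> A).

Fixpoint eval (s : expr R G) : A :=
  match s with
  | Gen x => g x
  | Cst c => c%:A
  | Add s t => eval s + eval t
  | Mul s t => eval s * eval t
  end.

Hypothesis g_rel : forall s t, rel s t -> eval s = eval t.

Lemma eval_cong s t : cong rel s t -> eval s = eval t.
Proof.
elim=> {s t} //=.
- by move=> s t u _ -> _ ->.
- by move=> s s' t t' _ -> _ ->.
- by move=> s s' t t' _ -> _ ->.
- by move=> s t u; rewrite addrA.
- by move=> s t; rewrite addrC.
- by move=> s; rewrite scale0r add0r.
- by move=> s; rewrite scale0r scaleN1r mulN1r addNr.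
- by move=> s t u; rewrite mulrA.
- by move=> s; rewrite scale1r mul1r.
- by move=> s; rewrite scale1r mulr1.
- by move=> s t u; rewrite mulrDl.
- by move=> s t u; rewrite mulrDr.
- by move=> c d; rewrite scalerDl.
- by move=> c d; rewrite -scalerAl mul1r scalerA.
- by move=> c s; rewrite -scalerAl -scalerAr mul1r mulr1.
Qed.

Definition lift (x : presented) : A := eval (rep x).

Lemma lift_cls s : lift (cls s) = eval s.
Proof. exact/eval_cong/rep_cls. Qed.

End Lift.

End Presented.

Definition qint (k : fieldType) (v : k) (n : nat) : k :=
  (v ^+ n - v ^- n) / (v - v^-1).

Definition qfact (k : fieldType) (v : k) (m : nat) : k :=
  \prod_(1 <= j < m.+1) qint v j.

(* The paper's bracket [x, y]_a; plain commutators are the case a = 1. *)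
Definition qcomm (k : fieldType) (A : algType k) (a : k) (x y : A) : A :=
  x * y - a *: (y * x).

Definition cartan (i j : 'I_3) : int := if i == j then 2 else -1.

Definition tau (i : 'I_3) : 'I_3 :=
  if i == 1 then 2 else if i == 2 then 1 else 0.

Record alg_aut (k : fieldType) (A : algType k) := AlgAut {
  aut_fun :> {lrmorphism A -> A};
  aut_inv_fun : A -> A;
  aut_funK : cancel aut_fun aut_inv_fun;
  aut_inv_funK : cancel aut_inv_fun aut_fun }.

Section AutInverse.
Variables (k : fieldType) (A : algType k) (f : alg_aut A).

HB.instance Definition _ := GRing.isLinear.Build k A A *:%R (aut_inv_fun f)
  (can2_linear (aut_funK f) (aut_inv_funK f)).
HB.instance Definition _ := GRing.isMonoidMorphism.Build A A (aut_inv_fun f)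
  (can2_monoid_morphism (aut_funK f) (aut_inv_funK f)).

Definition aut_inv : alg_aut A :=
  @AlgAut k A (aut_inv_fun f) f (aut_inv_funK f) (aut_funK f).

End AutInverse.

Definition aut_comp (k : fieldType) (A : algType k) (f g : alg_aut A) :
  alg_aut A :=
  @AlgAut k A (f \o g) (aut_inv_fun g \o aut_inv_fun f)
    (can_comp (aut_funK f) (aut_funK g))
    (can_comp (aut_inv_funK g) (aut_inv_funK f)).

Variant Ugen : Type :=
| UE of 'I_3 | UF of 'I_3
| UK of 'I_3 | UKinv of 'I_3 | UK' of 'I_3 | UK'inv of 'I_3.

Section DrinfeldDouble.
Variables (k : fieldType) (v : k).

Local Notation E i := (Gen (UE i)).
Local Notation F i := (Gen (UF i)).
Local Notation K i := (Gen (UK i)).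
Local Notation Kinv i := (Gen (UKinv i)).
Local Notation K' i := (Gen (UK' i)).
Local Notation K'inv i := (Gen (UK'inv i)).
Local Notation "[ n ]" := (qint v n) (at level 0).

Inductive Urel : expr k Ugen -> expr k Ugen -> Prop :=
| U_KK i j : Urel (K i * K j) (K j * K i)
| U_KK' i j : Urel (K i * K' j) (K' j * K i)
| U_K'K' i j : Urel (K' i * K' j) (K' j * K' i)
| U_KKinv i : Urel (K i * Kinv i) 1
| U_KinvK i : Urel (Kinv i * K i) 1
| U_K'K'inv i : Urel (K' i * K'inv i) 1
| U_K'invK' i : Urel (K'inv i * K' i) 1
| U_KE i j : Urel (K i * E j) (v ^ cartan i j *: (E j * K i))
| U_KF i j : Urel (K i * F j) (v ^ (- cartan i j) *: (F j * K i))
| U_K'E i j : Urel (K' i * E j) (v ^ (- cartan i j) *: (E j * K' i))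
| U_K'F i j : Urel (K' i * F j) (v ^ cartan i j *: (F j * K' i))
| U_EF i j : Urel (E i * F j - F j * E i)
    (if i == j then (v - v^-1)^-1 *: (K i - K' i) else 0)%X
| U_serreE i j of i != j :
    Urel (E i * E i * E j - [2] *: (E i * E j * E i) + E j * E i * E i) 0
| U_serreF i j of i != j :
    Urel (F i * F i * F j - [2] *: (F i * F j * F i) + F j * F i * F i) 0.

Definition U : Type := presented Urel.
HB.instance Definition _ := GRing.PzRing.on U.
HB.instance Definition _ := GRing.Lmodule.on U.

(* The counit, used only to see that [U] is not the zero ring. *)
Let counit (x : Ugen) : k^o :=
  match x with UE _ | UF _ => 0 | _ => 1 end.

Fact U_neq0 : (1 : U) != 0.
Proof.
have rel0 s t : Urel s t -> eval counit s = eval counit t.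
  case=> * /=; rewrite ?(mulr0, mul0r, mulr1, addr0, scale0r, scale1r) //.
  by case: ifP => _ /=; rewrite ?(mulr1, scale0r, scaleN1r, subrr, mulr0).
apply/eqP=> /(congr1 (lift counit)); rewrite -cls1 -cls0 !(lift_cls rel0) /=.
by move/eqP; rewrite scale1r scale0r oner_eq0.
Qed.

HB.instance Definition _ := GRing.PzSemiRing_isNonZero.Build U U_neq0.
HB.instance Definition _ :=
  GRing.LSemiModule_isLSemiAlgebra.Build k U (@pscaleAl _ _ Urel).
HB.instance Definition _ :=
  GRing.LSemiAlgebra_isSemiAlgebra.Build k U (@pscaleAr _ _ Urel).

Definition ugen (x : Ugen) : U := cls Urel (Gen x).

End DrinfeldDouble.

Section QuantumGroupNotation.
Variables (k : fieldType) (v : k).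
Definition uE (i : 'I_3) : U v := ugen v (UE i).
Definition uF (i : 'I_3) : U v := ugen v (UF i).
Definition uK (i : 'I_3) : U v := ugen v (UK i).
Definition uKinv (i : 'I_3) : U v := ugen v (UKinv i).
Definition uK' (i : 'I_3) : U v := ugen v (UK' i).
Definition uK'inv (i : 'I_3) : U v := ugen v (UK'inv i).
End QuantumGroupNotation.

(* [fil_right] says that right multiplications are continuous, which is what
   makes the completion a ring. *)
Record left_filtration (A : pzRingType) := LeftFiltration {
  fil :> nat -> A -> Prop;
  fil0 : forall N, fil N 0;
  filD : forall N x y, fil N x -> fil N y -> fil N (x + y);
  filM : forall N a x, fil N x -> fil N (a * x);
  fil_anti : forall M N x, (M <= N)%N -> fil N x -> fil M x;
  fil_right : forall N y, exists M, forall x, fil M x -> fil N (x * y) }.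

Section Completion.
Variables (A : pzRingType) (J : left_filtration A).

Lemma filN N x : J N x -> J N (- x).
Proof. by rewrite -mulN1r; apply: filM. Qed.

Lemma filB N x y : J N x -> J N y -> J N (x - y).
Proof. by move=> Jx Jy; apply/filD/filN. Qed.

Definition null_seq (u : nat -> A) : Prop :=
  forall N, exists n0, forall n, (n0 <= n)%N -> J N (u n).

Definition cauchy_seq (u : nat -> A) : Prop :=
  forall N, exists n0, forall m n, (n0 <= m)%N -> (n0 <= n)%N ->
    J N (u m - u n).

Record cauchy := Cauchy { cauchy_fun :> nat -> A; _ : cauchy_seq cauchy_fun }.

Lemma cauchyP (u : cauchy) : cauchy_seq u. Proof. by case: u. Qed.

HB.instance Definition _ := gen_eqMixin cauchy.
HB.instance Definition _ := gen_choiceMixin cauchy.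

Lemma null_seqD u w :
  null_seq u -> null_seq w -> null_seq (fun n => u n + w n).
Proof.
move=> hu hw N; have [[m Hm] [n Hn]] := (hu N, hw N).
by exists (maxn m n) => p; rewrite geq_max => /andP[mp np]; apply: filD; auto.
Qed.

Lemma null_seqN u : null_seq u -> null_seq (fun n => - u n).
Proof. by move=> hu N; have [m Hm] := hu N; exists m => p ?; apply/filN/Hm. Qed.

Lemma null_seqMl (w u : nat -> A) :
  null_seq u -> null_seq (fun n => w n * u n).
Proof. by move=> hu N; have [m Hm] := hu N; exists m => p ?; apply/filM/Hm. Qed.

Lemma null_seqMr (u w : nat -> A) :
  null_seq u -> cauchy_seq w -> null_seq (fun n => u n * w n).
Proof.
move=> hu hw N; have [n Hn] := hw N; have [M HM] := fil_right J N (w n).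
have [m Hm] := hu M; exists (maxn m n) => p; rewrite geq_max => /andP[mp np].
rewrite -(subrK (w n) (w p)) mulrDr; apply: filD; first exact/filM/Hn.
exact/HM/Hm.
Qed.

Lemma eq_null u w : u =1 w -> null_seq u -> null_seq w.
Proof. by move=> uw hu N; have [m Hm] := hu N; exists m => p; rewrite -uw; auto. Qed.

(* The completion is built as Cauchy sequences modulo null sequences. *)
Definition eqc (u w : cauchy) : bool := `[< null_seq (fun n => u n - w n) >].

Lemma eqc_equiv : equiv_class_of eqc.
Proof.
split=> [u|u w|u w x].
- by apply/asboolP => N; exists 0%N => n _; rewrite subrr; apply: fil0.
- by apply/asboolP/asboolP => /null_seqN; apply: eq_null => n; rewrite opprB.
- move=> /asboolP uw /asboolP wx; apply/asboolP.
  apply: eq_null (null_seqD uw wx) => n.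
  by rewrite addrA subrK.
Qed.

Canonical eqc_rel := EquivRelPack eqc_equiv.

Definition completion : Type := {eq_quot eqc_rel}.
HB.instance Definition _ := Choice.on completion.

Definition clim (u : cauchy) : completion := \pi_({eq_quot eqc_rel}) u.
Definition crep (x : completion) : cauchy := repr (x : {eq_quot eqc_rel}).

Lemma crepK : cancel crep clim. Proof. exact: reprK. Qed.

Lemma climP (u w : cauchy) :
  clim u = clim w <-> null_seq (fun n => u n - w n).
Proof. by split=> [/eqquotP/asboolP//|uw]; apply/eqquotP/asboolP. Qed.

Lemma crep_clim (u : cauchy) : null_seq (fun n => crep (clim u) n - u n).
Proof. by apply/climP; rewrite crepK. Qed.

Lemma climE (P : completion -> Prop) :
  (forall u, P (clim u)) -> forall x, P x.
Proof. by move=> H x; rewrite -(crepK x). Qed.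

Fact cauchy_cst (a : A) : cauchy_seq (fun=> a).
Proof. by move=> N; exists 0%N => m n _ _; rewrite subrr; apply: fil0. Qed.

Fact cauchyD (u w : cauchy) : cauchy_seq (fun n => u n + w n).
Proof.
move=> N; have [[m Hm] [n Hn]] := (cauchyP u N, cauchyP w N).
exists (maxn m n) => p q; rewrite !geq_max => /andP[mp np] /andP[mq nq].
by rewrite opprD addrACA; apply: filD; auto.
Qed.

Fact cauchyN (u : cauchy) : cauchy_seq (fun n => - u n).
Proof.
move=> N; have [m Hm] := cauchyP u N.
by exists m => p q mp mq; rewrite -opprD; apply/filN/Hm.
Qed.

Fact cauchyM (u w : cauchy) : cauchy_seq (fun n => u n * w n).
Proof.
move=> N; have [n Hn] := cauchyP w N.
have [M HM] := fil_right J N (w n); have [m Hm] := cauchyP u M.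
exists (maxn m n) => p q; rewrite !geq_max => /andP[mp np] /andP[mq nq].
have -> : u p * w p - u q * w q =
    u p * (w p - w n) + (u p - u q) * w n - u q * (w q - w n).
  by rewrite !mulrBr mulrBl addrA subrK opprB addrA subrK.
apply: filB; last exact/filM/Hn.
by apply: filD; [apply/filM/Hn | apply/HM/Hm].
Qed.

Definition chat (a : A) : completion := clim (Cauchy (cauchy_cst a)).
Definition cadd (x y : completion) := clim (Cauchy (cauchyD (crep x) (crep y))).
Definition copp (x : completion) := clim (Cauchy (cauchyN (crep x))).
Definition cmul (x y : completion) := clim (Cauchy (cauchyM (crep x) (crep y))).

Lemma caddE u w : cadd (clim u) (clim w) = clim (Cauchy (cauchyD u w)).
Proof.
apply/climP; apply: eq_null (null_seqD (crep_clim u) (crep_clim w)) => n /=.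
by rewrite opprD addrACA.
Qed.

Lemma coppE u : copp (clim u) = clim (Cauchy (cauchyN u)).
Proof.
apply/climP; apply: eq_null (null_seqN (crep_clim u)) => n /=.
by rewrite opprD.
Qed.

Lemma cmulE u w : cmul (clim u) (clim w) = clim (Cauchy (cauchyM u w)).
Proof.
apply/climP; apply: eq_null (null_seqD
  (null_seqMl (crep (clim u)) (crep_clim w))
  (null_seqMr (crep_clim u) (cauchyP w))) => n /=.
by rewrite mulrBr mulrBl addrA subrK.
Qed.

Lemma eq_clim (u w : cauchy) : u =1 w -> clim u = clim w.
Proof.
move=> uw; apply/climP => N; exists 0%N => n _.
by rewrite uw subrr; apply: fil0.
Qed.

Fact caddA : associative cadd.
Proof.
by elim/climE=> u; elim/climE=> w; elim/climE=> x; rewrite !caddE;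
  apply: eq_clim => n /=; rewrite addrA.
Qed.
Fact caddC : commutative cadd.
Proof.
by elim/climE=> u; elim/climE=> w; rewrite !caddE; apply: eq_clim => n /=;
  rewrite addrC.
Qed.
Fact cadd0 : left_id (chat 0) cadd.
Proof. by elim/climE=> u; rewrite !caddE; apply: eq_clim => n /=; rewrite add0r. Qed.
Fact caddN : left_inverse (chat 0) copp cadd.
Proof.
by elim/climE=> u; rewrite coppE caddE; apply: eq_clim => n /=; rewrite addNr.
Qed.

HB.instance Definition _ :=
  GRing.isZmodule.Build completion caddA caddC cadd0 caddN.

Fact cmulA : associative cmul.
Proof.
by elim/climE=> u; elim/climE=> w; elim/climE=> x; rewrite !cmulE;
  apply: eq_clim => n /=; rewrite mulrA.
Qed.
Fact cmul1l : left_id (chat 1) cmul.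
Proof. by elim/climE=> u; rewrite !cmulE; apply: eq_clim => n /=; rewrite mul1r. Qed.
Fact cmul1r : right_id (chat 1) cmul.
Proof. by elim/climE=> u; rewrite !cmulE; apply: eq_clim => n /=; rewrite mulr1. Qed.
Fact cmulDl : left_distributive cmul cadd.
Proof.
by elim/climE=> u; elim/climE=> w; elim/climE=> x; rewrite !(caddE, cmulE);
  apply: eq_clim => n /=; rewrite mulrDl.
Qed.
Fact cmulDr : right_distributive cmul cadd.
Proof.
by elim/climE=> u; elim/climE=> w; elim/climE=> x; rewrite !(caddE, cmulE);
  apply: eq_clim => n /=; rewrite mulrDr.
Qed.

HB.instance Definition _ :=
  GRing.Zmodule_isPzRing.Build completion cmulA cmul1l cmul1r cmulDl cmulDr.

Fact cauchy_sum (x : nat -> A) :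
  null_seq x -> cauchy_seq (fun n => \sum_(m < n) x m).
Proof.
move=> hx N; have [n0 Hn0] := hx N; exists n0.
have tail d n : (n0 <= n)%N ->
    J N (\sum_(m < n + d) x m - \sum_(m < n) x m).
  move=> ln; elim: d => [|d IH]; first by rewrite addn0 subrr; apply: fil0.
  rewrite addnS big_ord_recr /= addrAC; apply: filD => //.
  exact/Hn0/(leq_trans ln)/leq_addr.
move=> m n lm ln; case: (leqP n m) => [/subnKC <-|/ltnW/subnKC <-].
  exact: tail.
by rewrite -opprB; apply/filN/tail.
Qed.

Definition csum (x : nat -> A) (hx : null_seq x) : completion :=
  clim (Cauchy (cauchy_sum hx)).

End Completion.

Section CompletedDrinfeldDouble.
Variables (k : fieldType) (v : k).

Local Notation E := (uE v).
Local Notation F := (uF v).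
Local Notation K := (uK v).
Local Notation Kinv := (uKinv v).
Local Notation K' := (uK' v).
Local Notation K'inv := (uK'inv v).

(* The left ideal generated by the products of at least [N] of the [E i]. *)
Inductive Eideal (N : nat) : U v -> Prop :=
| Eideal0 : Eideal N 0
| Eideal_gen a (w : seq 'I_3) of (N <= size w)%N :
    Eideal N (a * \prod_(i <- w) E i)
| EidealD x y of Eideal N x & Eideal N y : Eideal N (x + y).

Lemma EidealM N a x : Eideal N x -> Eideal N (a * x).
Proof.
elim=> [|b w Nw|y z _ Hy _ Hz]; rewrite ?mulr0 ?mulrDr ?mulrA.
- exact: Eideal0.
- exact: Eideal_gen.
- exact: EidealD.
Qed.

Lemma EidealZ N (c : k) x : Eideal N x -> Eideal N (c *: x).
Proof. by move=> Nx; rewrite -[x]mul1r scalerAl; apply: EidealM. Qed.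

Lemma Eideal_anti M N x : (M <= N)%N -> Eideal N x -> Eideal M x.
Proof.
move=> MN; elim=> [|b w Nw|y z _ Hy _ Hz].
- exact: Eideal0.
- exact/Eideal_gen/(leq_trans MN).
- exact: EidealD.
Qed.

Lemma Eideal_all x : Eideal 0 x.
Proof. by have := @Eideal_gen 0 x [::] isT; rewrite big_nil mulr1. Qed.

Lemma Eideal_mulE N x i : Eideal N x -> Eideal N.+1 (x * E i).
Proof.
elim=> [|b w Nw|y z _ Hy _ Hz]; rewrite ?mul0r ?mulrDl.
- exact: Eideal0.
- rewrite -mulrA (_ : _ * E i = \prod_(j <- rcons w i) E j).
    by apply: Eideal_gen; rewrite size_rcons.
  by rewrite -cats1 big_cat big_seq1.
- exact: EidealD.
Qed.

Definition preserves_Eideal (y : U v) := forall N x, Eideal N x -> Eideal N (x * y).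

(* An element commuting with every [E i] up to a scalar. *)
Lemma Eideal_cartan y :
  (forall i, exists c : k, E i * y = c *: (y * E i)) -> preserves_Eideal y.
Proof.
move=> Hy N x; elim=> [|b w Nw|y1 y2 _ H1 _ H2]; rewrite ?mul0r ?mulrDl.
- exact: Eideal0.
- have [c Hc] : exists c : k, (\prod_(i <- w) E i) * y = c *: (y * \prod_(i <- w) E i).
    elim: (w) => [|i w' [c Hc]]; first by exists 1; rewrite !big_nil scale1r mul1r mulr1.
    have [d Hd] := Hy i; exists (c * d).
    by rewrite !big_cons -mulrA Hc -scalerAr (mulrA (E i)) Hd -scalerAl scalerA mulrA.
  by rewrite -mulrA Hc -scalerAr mulrA; apply/EidealZ/Eideal_gen.
- exact: EidealD.
Qed.

Lemma Eideal_torus (y z : U v) (c : 'I_3 -> k) :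
  y * z = 1 -> z * y = 1 -> (forall i, y * E i = c i *: (E i * y)) ->
  preserves_Eideal y /\ preserves_Eideal z.
Proof.
move=> yz zy Hc; split; apply: Eideal_cartan => i.
  have [c0|c0] := eqVneq (c i) 0.
    have E0 : E i = 0 by rewrite -[E i]mul1r -zy -mulrA Hc c0 scale0r mulr0.
    by exists 0; rewrite E0 mul0r mulr0 scaler0.
  by exists (c i)^-1; rewrite Hc scalerA mulVf // scale1r.
exists (c i); rewrite -[LHS]mul1r -zy -!mulrA (mulrA y) Hc.
by rewrite -scalerAl -mulrA yz mulr1 -scalerAr.
Qed.

Lemma U_torus i :
  [/\ preserves_Eideal (K i), preserves_Eideal (Kinv i),
      preserves_Eideal (K' i) & preserves_Eideal (K'inv i)].
Proof.
have [] := @Eideal_torus (K i) (Kinv i) (fun j => v ^ cartan i j).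
- by rewrite -clsM; apply/cls_rel/U_KKinv.
- by rewrite -clsM; apply/cls_rel/U_KinvK.
- by move=> j; rewrite -!clsM -clsZ; apply/cls_rel/U_KE.
have [] := @Eideal_torus (K' i) (K'inv i) (fun j => v ^ (- cartan i j)).
- by rewrite -clsM; apply/cls_rel/U_K'K'inv.
- by rewrite -clsM; apply/cls_rel/U_K'invK'.
- by move=> j; rewrite -!clsM -clsZ; apply/cls_rel/U_K'E.
by [].
Qed.

Lemma U_EFE i j :
  E i * F j = F j * E i +
    (if i == j then (v - v^-1)^-1 *: (K i - K' i) else 0).
Proof.
have := cls_rel (@U_EF k v i j); rewrite clsD clsN !clsM => /eqP.
rewrite subr_eq addrC => /eqP ->; congr (_ + _).
by case: ifP => // _; rewrite clsZ clsD clsN.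
Qed.

Lemma Eideal_mulF N x j : Eideal N.+1 x -> Eideal N (x * F j).
Proof.
elim=> [|b w Nw|y1 y2 _ H1 _ H2]; rewrite ?mul0r ?mulrDl.
- exact: Eideal0.
- rewrite -mulrA; apply: EidealM.
  elim/last_ind: w N Nw => [//|w i IH] [|N]; first by move=> _; apply: Eideal_all.
  rewrite size_rcons ltnS => Nw.
  rewrite -cats1 big_cat big_seq1 -mulrA U_EFE mulrDr mulrA; apply: EidealD.
    exact/Eideal_mulE/IH.
  have Jw : Eideal N.+1 (\prod_(i <- w) E i).
    by rewrite -[X in Eideal _ X]mul1r; apply: Eideal_gen.
  case: ifP => _; last by rewrite mulr0; apply: Eideal0.
  have [HK _ HK' _] := U_torus i.
  rewrite -scalerAr mulrBr; apply/EidealZ/EidealD; first exact: HK.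
  by rewrite -mulN1r; apply/EidealM/HK'.
- exact: EidealD.
Qed.

Lemma Eideal_right N (y : U v) :
  exists M, forall x, Eideal M x -> Eideal N (x * y).
Proof.
elim/clsE: y => s; elim: s N => [g|c|s IHs t IHt|s IHs t IHt] N.
- case: g => i; have [HK HKV HK' HK'V] := U_torus i.
  + exists N => x Nx; exact/(Eideal_anti (leqnSn N))/Eideal_mulE.
  + by exists N.+1 => x; apply: Eideal_mulF.
  + by exists N => x; apply: HK.
  + by exists N => x; apply: HKV.
  + by exists N => x; apply: HK'.
  + by exists N => x; apply: HK'V.
- by exists N => x Nx; rewrite clsC -scalerAr mulr1; apply: EidealZ.
- have [[M1 H1] [M2 H2]] := (IHs N, IHt N); exists (maxn M1 M2) => x Mx.
  rewrite clsD mulrDr; apply: EidealD; [apply: H1|apply: H2].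
    exact: Eideal_anti (leq_maxl _ _) Mx.
  exact: Eideal_anti (leq_maxr _ _) Mx.
- have [M1 H1] := IHt N; have [M2 H2] := IHs M1; exists M2 => x Mx.
  by rewrite clsM mulrA; apply/H1/H2.
Qed.

Definition Efiltration : left_filtration (U v) :=
  LeftFiltration Eideal0 EidealD EidealM Eideal_anti Eideal_right.

Definition Uhat : Type := completion Efiltration.
HB.instance Definition _ := GRing.PzRing.on Uhat.

Definition to_Uhat : U v -> Uhat := chat Efiltration.

Definition upsilon_term (i j : 'I_3) (m : nat) : U v :=
  (v ^- (m * m.-1)./2 * (-1) ^+ m / qfact v m) *:
    qcomm v^-1 (E i) (E j) ^+ m.

Lemma Eideal_qcommX i j m : Eideal m (qcomm v^-1 (E i) (E j) ^+ m).
Proof.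
elim: m => [|m IH]; first exact: Eideal_all.
rewrite exprSr mulrBr; apply: EidealD; last rewrite -mulN1r -scalerAr.
  by rewrite mulrA; apply/(Eideal_anti (leqnSn _))/Eideal_mulE/Eideal_mulE.
by apply/EidealM/EidealZ; rewrite mulrA;
  apply/(Eideal_anti (leqnSn _))/Eideal_mulE/Eideal_mulE.
Qed.

Fact upsilon_term_null i j : null_seq Efiltration (upsilon_term i j).
Proof.
move=> N; exists N => m Nm; apply/EidealZ.
exact/(Eideal_anti Nm)/Eideal_qcommX.
Qed.

Definition Upsilon : Uhat :=
  csum (upsilon_term_null 1 2) * csum (upsilon_term_null 2 1).

Definition is_braid (i : 'I_3) (T : U v -> U v) : Prop :=
  [/\ T (K i) = Kinv i, T (K' i) = K'inv i,
      T (E i) = - (F i * K'inv i), T (F i) = - (Kinv i * E i) &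
      forall j, j != i ->
      [/\ T (K j) = K i * K j, T (K' j) = K' i * K' j,
          T (E j) = qcomm v^-1 (E i) (E j) & T (F j) = qcomm v (F j) (F i)]].

(* The automorphism Psi, [s] being the chosen square root of varsigma = -v^(-1/2). *)
Definition is_rescaling (s : k) (Psi : U v -> U v) : Prop :=
  forall i, [/\ Psi (K i) = s *: K i, Psi (K' i) = s *: K' i,
                Psi (E i) = s *: E i & Psi (F i) = F i].

Definition rescaled_braid (Psi : alg_aut (U v)) (T : 'I_3 -> alg_aut (U v))
  (j : 'I_3) : alg_aut (U v) := aut_comp (aut_inv Psi) (aut_comp (T j) Psi).

(* Of the two expressions of this operator that the braid relation identifies,
   the one starting with the inverse of the first operator is used. *)
Definition rescaled_braid_r1_inv (Psi : alg_aut (U v))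
    (T : 'I_3 -> alg_aut (U v)) : alg_aut (U v) :=
  let Tinv j := aut_inv (rescaled_braid Psi T j) in
  aut_comp (Tinv 1) (aut_comp (Tinv 2) (Tinv 1)).

End CompletedDrinfeldDouble.

Variant iUgen : Type := IB of 'I_3 | IK of 'I_3 | IKinv of 'I_3.

Section IQuantumGroup.
Variables (k : fieldType) (v : k).

Local Notation B i := (Gen (IB i)).
Local Notation K i := (Gen (IK i)).
Local Notation Kinv i := (Gen (IKinv i)).
Local Notation "[ n ]" := (qint v n) (at level 0).
Local Notation i0 := (0 : 'I_3).
Local Notation i1 := (1 : 'I_3).
Local Notation i2 := (2 : 'I_3).

Inductive iUrel : expr k iUgen -> expr k iUgen -> Prop :=
| iU_KK i j : iUrel (K i * K j) (K j * K i)
| iU_KKinv i : iUrel (K i * Kinv i) 1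
| iU_KinvK i : iUrel (Kinv i * K i) 1
| iU_KB i j :
    iUrel (K i * B j) (v ^ (cartan (tau i) j - cartan i j) *: (B j * K i))
| iU_serre12 :
    iUrel (B i2 * B i1 * B i1 - [2] *: (B i1 * B i2 * B i1) + B i1 * B i1 * B i2)
          (- [2] *: (v *: (K i1 * B i1) + v *: (B i1 * K i2)))
| iU_serre21 :
    iUrel (B i1 * B i2 * B i2 - [2] *: (B i2 * B i1 * B i2) + B i2 * B i2 * B i1)
          (- [2] *: (v *: (K i2 * B i2) + v *: (B i2 * K i1)))
| iU_serrei0 i of i != i0 :
    iUrel (B i0 * B i * B i - [2] *: (B i * B i0 * B i) + B i * B i * B i0) 0
| iU_serre0i i of i != i0 :
    iUrel (B i * B i0 * B i0 - [2] *: (B i0 * B i * B i0) + B i0 * B i0 * B i)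
          (- v^-1 *: (K i0 * B i)).

Definition iU : Type := presented iUrel.
HB.instance Definition _ := GRing.PzRing.on iU.
HB.instance Definition _ := GRing.Lmodule.on iU.

Let icounit (x : iUgen) : k^o := if x is IB _ then 0 else 1.

Fact iU_neq0 : (1 : iU) != 0.
Proof.
have rel0 s t : iUrel s t -> eval icounit s = eval icounit t.
  by case=> * /=; rewrite ?(mulr0, mul0r, mulr1, addr0, scale0r, scale1r).
apply/eqP=> /(congr1 (lift icounit)); rewrite -cls1 -cls0 !(lift_cls rel0) /=.
by move/eqP; rewrite scale1r scale0r oner_eq0.
Qed.

HB.instance Definition _ := GRing.PzSemiRing_isNonZero.Build iU iU_neq0.
HB.instance Definition _ :=
  GRing.LSemiModule_isLSemiAlgebra.Build k iU (@pscaleAl _ _ iUrel).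
HB.instance Definition _ :=
  GRing.LSemiAlgebra_isSemiAlgebra.Build k iU (@pscaleAr _ _ iUrel).

Definition iB (i : 'I_3) : iU := cls iUrel (B i).
Definition iK (i : 'I_3) : iU := cls iUrel (K i).
Definition iKinv (i : 'I_3) : iU := cls iUrel (Kinv i).

End IQuantumGroup.

Definition Qv : fieldType := {fraction {poly rat}}.
Definition qv : Qv := tofrac 'X.

(* The values of the embedding on the generators; the two algebras may live over
   different fields. *)
Definition is_iquantum_embedding (k : fieldType) (w : k) (R : fieldType) (v : R)
    (iota : iU v -> U w) : Prop :=
  [/\ forall i, iota (iB v i) = uF w i + uE w (tau i) * uK' w i,
      iota (iK v 0) = - w ^+ 2 *: (uK w 0 * uK' w 0) &
      forall j, j != 0 -> iota (iK v j) = uK w j * uK' w (tau j)].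

(* Main.v *)
Require Import Defs.
From HB Require Import structures.
From mathcomp Require Import all_boot all_algebra.
From mathcomp Require Import boolp ring.

Set Implicit Arguments.
Unset Strict Implicit.
Unset Printing Implicit Defensive.

Import GRing.Theory.
Local Open Scope ring_scope.

(** The operator sought is x |-> Y R(x) Y^-1, where Y is the quasi K-matrix and
    R the inverse of the rescaled braid operator of the longest word.  Two
    things have to be seen: that conjugation by Y turns R(iota x) into
    iota(T x) with T given by the displayed formulas, and that these formulas
    do define an automorphism of the iquantum group.

    Intertwining ([intertwined_all]).  It is enough to treat generators.  Write
    x = [E_1,E_2]_(1/v), y = [E_2,E_1]_(1/v), so that Y = exp(-x) exp(-y)
    with q-exponentials.  From F_1 x = x F_1 + E_2 K_1' and
    F_1 y = y F_1 - v^-1 E_2 K_1 a termwise telescoping gives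
    (F_1 + E_2 K_1') Y = Y (F_1 + v^-1 E_2 K_1), and likewise for F_2
    ([intertwines_B1], [intertwines_B2]); on the right stands R(B_1) up to a
    factor commuting with Y.  For B_0 = F_0 + E_0 K_0' the formula for
    T(B_0) is a polynomial P(B_1, B_2, B_0) which is linear in B_0.  As F_0
    commutes with Y, the summand P(B_1, B_2, F_0) is carried to
    P(F_1 + v^-1 E_2 K_1, F_2 + v^-1 E_1 K_2, F_0), and all terms with an E
    cancel in it: it is R(F_0), a root vector of weight -(a_0 + 2a_1 + 2a_2)
    ([braid_poly_F]).  In the summand P(B_1, B_2, E_0 K_0') all terms with
    an F cancel; it is R(E_0 K_0'), which commutes with E_1 and E_2, hence
    with Y ([braid_poly_E], [e_tor_comm]).

    Relations ([irels_braid]).  All relations of the images except the Serre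
    relations with two factors B_0 are at most linear in B_0.  The iterated
    brackets of B_0 with B_1 and B_2 behave like the eight weight vectors of the
    adjoint module of sl_3, with lower order corrections in K_1 and K_2; moving
    B_1, B_2 and the K's to the right of these eight vectors by rewriting
    rules ([iU_rules]) turns such relations into finite computations.  The
    relation r_1 between B_1 and two factors B_0 behaves like a lowest weight
    vector of a 10-dimensional module; comparing normal forms shows that its
    image is a combination, with coefficients in B_1 and K_1, of r_1 and six of
    its iterated brackets with B_1 and B_2 ([braid_rel]), so it vanishes.  The
    relation r_2 follows by the diagram symmetry 1 <-> 2, under which P is
    invariant.

    Invertibility ([braid_braid'], [braid'_braid]).  The relations are invariant
    under the anti-involution that fixes the B_i and exchanges K_1 and K_2.
    Conjugating T by it gives the inverse, so only one of the two composites
    has to be computed; the other one is the same statement in the opposite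
    algebra. *)

(** * Normal forms by rewriting *)

(** Generators are numbered.  A monomial is a word together with an exponent of
    v, and polynomials are sorted lists of monomials with integer coefficients,
    so that they evaluate in every algebra with a chosen nonzero scalar v. *)
Definition word : Type := seq nat.
Definition monom : Type := (word * int)%type.
Definition ncpoly : Type := seq (monom * int).

Fixpoint wcmp (u w : word) : comparison :=
  match u, w with
  | [::], [::] => Eq
  | [::], _ => Lt
  | _, [::] => Gt
  | x :: u', y :: w' =>
      if (x == y)%N then wcmp u' w' else if (x < y)%N then Lt else Gt
  end.

Definition mcmp (m n : monom) : comparison :=
  match wcmp m.1 n.1 with
  | Eq => if m.2 == n.2 then Eq else if (m.2 < n.2)%R then Lt else Gt
  | c => c
  end.

Fixpoint nadd (p : ncpoly) : ncpoly -> ncpoly :=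
  fix nadd_p (q : ncpoly) : ncpoly :=
  match p, q with
  | [::], _ => q
  | _, [::] => p
  | (m, c) :: p', (n, d) :: q' =>
      match mcmp m n with
      | Eq => if c + d == 0 then nadd p' q' else (m, c + d) :: nadd p' q'
      | Lt => (m, c) :: nadd p' q
      | Gt => (n, d) :: nadd_p q'
      end
  end.

Definition nscale (e c : int) (p : ncpoly) : ncpoly :=
  [seq (t.1.1, t.1.2 + e, t.2 * c) | t <- p].

Definition nsum (f : word -> ncpoly) (p : ncpoly) : ncpoly :=
  foldr (fun t q => nadd (nscale t.1.2 t.2 (f t.1.1)) q) [::] p.

Definition rule : Type := (word * ncpoly)%type.

Fixpoint strip (l w : word) : option word :=
  match l, w with
  | [::], _ => Some w
  | x :: l', y :: w' => if (x == y)%N then strip l' w' else None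
  | _, [::] => None
  end.

Fixpoint find_rule (rs : seq rule) (w : word) : option (ncpoly * word) :=
  match rs with
  | [::] => None
  | (l, p) :: rs' =>
      if strip l w is Some w' then Some (p, w') else find_rule rs' w
  end.

Section Reduce.
Variable rs : seq rule.

(** Left multiplication of an irreducible word by a letter: only a prefix of the
    result can be reducible.  The number [n] bounds the depth of the recursion;
    when it is exhausted the word is left as it is, so the result is correct
    for every rule system, terminating or not. *)
Fixpoint lmulw (n : nat) (x : nat) (w : word) : ncpoly :=
  if n is n'.+1 then
    if find_rule rs (x :: w) is Some (p, w') then
      nsum (fun u => foldr (fun y => nsum (lmulw n' y)) [:: (w', 0, 1)] u) p
    else [:: (x :: w, 0, 1)]
  else [:: (x :: w, 0, 1)].

Definition nmul (n : nat) (p q : ncpoly) : ncpoly :=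
  nsum (fun u => foldr (fun y => nsum (lmulw n y)) q u) p.

End Reduce.

(** Expressions over Laurent polynomials in v, the latter being given as lists
    of pairs (exponent, coefficient). *)
Inductive nexp : Type :=
| NGen of nat
| NCst of seq (int * int)
| NAdd of nexp & nexp
| NMul of nexp & nexp.

Fixpoint nf (rs : seq rule) (n : nat) (s : nexp) : ncpoly :=
  match s with
  | NGen x => lmulw rs n x [::]
  | NCst l => nsum (fun=> [:: ([::], 0, 1)]) [seq ([::], t.1, t.2) | t <- l]
  | NAdd s t => nadd (nf rs n s) (nf rs n t)
  | NMul s t => nmul rs n (nf rs n s) (nf rs n t)
  end.

Section Soundness.
Variables (k : fieldType) (v : k) (v0 : v != 0) (A : algType k) (g : nat -> A).

Definition laurent (l : seq (int * int)) : k := \sum_(t <- l) t.2%:~R * v ^ t.1.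
Definition evalw (w : word) : A := \prod_(x <- w) g x.
Definition evalt (t : monom * int) : A := (t.2%:~R * v ^ t.1.2) *: evalw t.1.1.
Definition evalp (p : ncpoly) : A := \sum_(t <- p) evalt t.

Fixpoint neval (s : nexp) : A :=
  match s with
  | NGen x => g x
  | NCst l => (laurent l)%:A
  | NAdd s t => neval s + neval t
  | NMul s t => neval s * neval t
  end.

Definition sound (r : rule) : Prop := evalw r.1 = evalp r.2.

Definition all_sound : seq rule -> Prop := foldr (fun r => and (sound r)) True.

Lemma all_sound_cat rs1 rs2 :
  all_sound rs1 -> all_sound rs2 -> all_sound (rs1 ++ rs2).
Proof. by elim: rs1 => //= r rs IH [? /IH]; auto. Qed.

Lemma wcmp_eq u w : wcmp u w = Eq -> u = w.
Proof.
elim: u w => [|x u IH] [|y w] //=.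
by case: eqP => [->|_]; [move/IH->|case: ifP].
Qed.

Lemma mcmp_eq m n : mcmp m n = Eq -> m = n.
Proof.
case: m n => u e [w f]; rewrite /mcmp /=.
case H: (wcmp u w) => //; rewrite (wcmp_eq H).
by case: eqP => [->|_] //; case: ifP.
Qed.

Lemma evalp_cons t p : evalp (t :: p) = evalt t + evalp p.
Proof. by rewrite /evalp big_cons. Qed.

Lemma evalp_nadd p q : evalp (nadd p q) = evalp p + evalp q.
Proof.
elim: p q => [|[m c] p IHp]; first by move=> [|t q]; rewrite /evalp /= big_nil add0r.
elim=> [|[n d] q IHq]; first by rewrite /= /evalp big_nil addr0.
rewrite /=; case H: (mcmp m n).
- rewrite (mcmp_eq H) !evalp_cons addrACA.
  have <- : evalt (n, c + d) = evalt (n, c) + evalt (n, d).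
    by rewrite /evalt /= intrD mulrDl scalerDl.
  case: eqP => [->|_]; last by rewrite evalp_cons IHp.
  by rewrite IHp /evalt /= mul0r scale0r add0r.
- by rewrite !evalp_cons IHp evalp_cons addrA.
- by rewrite evalp_cons [in LHS]/= IHq !evalp_cons addrCA.
Qed.

Lemma evalp_nscale e c p : evalp (nscale e c p) = (c%:~R * v ^ e) *: evalp p.
Proof.
rewrite /evalp big_map scaler_sumr; apply: eq_bigr => t _.
rewrite /evalt /= scalerA intrM expfzDr //; congr (_ *: _).
by rewrite mulrACA mulrC.
Qed.

Lemma evalp_nsum f (F : word -> A) p :
  (forall w, evalp (f w) = F w) ->
  evalp (nsum f p) = \sum_(t <- p) (t.2%:~R * v ^ t.1.2) *: F t.1.1.
Proof.
move=> fF; elim: p => [|t p IH]; first by rewrite /evalp !big_nil.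
by rewrite /= evalp_nadd evalp_nscale IH big_cons fF.
Qed.

Lemma evalp1 w : evalp [:: (w, 0, 1)] = evalw w.
Proof. by rewrite /evalp big_seq1 /evalt /= mul1r scale1r. Qed.

Lemma evalw_cons x w : evalw (x :: w) = g x * evalw w.
Proof. by rewrite /evalw big_cons. Qed.

Lemma evalw2 x y : evalw [:: x; y] = g x * g y.
Proof. by rewrite /evalw big_cons big_seq1. Qed.

Lemma strip_cat l w w' : strip l w = Some w' -> w = l ++ w'.
Proof.
by elim: l w => [w [->]//|x l IH] [|y w] //=; case: eqP => // -> /IH ->.
Qed.

Section Rules.
Variables (rs : seq rule) (rs_sound : all_sound rs).

Lemma find_rule_sound w p w' :
  find_rule rs w = Some (p, w') -> evalw w = evalp p * evalw w'.
Proof.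
elim: rs rs_sound => [//|[l q] rs' IH] /= [sd sds].
case H: (strip l w) => [w''|]; last exact: IH.
case=> <- <-; rewrite (strip_cat H) /evalw big_cat /= -/(evalw l) -/(evalw w'').
by rewrite sd.
Qed.

Lemma evalp_foldr (f : nat -> word -> ncpoly) u q :
  (forall x w, evalp (f x w) = g x * evalw w) ->
  evalp (foldr (fun y => nsum (f y)) q u) = evalw u * evalp q.
Proof.
move=> fE; elim: u => [|x u IH] /=; first by rewrite /evalw big_nil mul1r.
rewrite (evalp_nsum (F := fun w => g x * evalw w)) //.
rewrite evalw_cons -mulrA -IH /evalp mulr_sumr.
by apply: eq_bigr => t _; rewrite -scalerAr.
Qed.

Lemma evalp_lmulw n x w : evalp (lmulw rs n x w) = g x * evalw w.
Proof.
elim: n x w => [|n IH] x w /=; first by rewrite evalp1 evalw_cons.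
case H: (find_rule rs (x :: w)) => [[p w']|]; last by rewrite evalp1 evalw_cons.
rewrite -evalw_cons (find_rule_sound H).
rewrite (evalp_nsum (F := fun u => evalw u * evalw w')) => [|u].
  by rewrite /evalp mulr_suml; apply: eq_bigr => t _; rewrite -scalerAl.
by rewrite (evalp_foldr _ _ IH) evalp1.
Qed.

Lemma evalp_nf n s : evalp (nf rs n s) = neval s.
Proof.
elim: s => [x|l|s IHs t IHt|s IHs t IHt] /=.
- by rewrite evalp_lmulw /evalw big_nil mulr1.
- rewrite (evalp_nsum (F := fun=> 1)) => [|w]; last by rewrite evalp1 /evalw big_nil.
  by rewrite big_map /laurent scaler_suml.
- by rewrite evalp_nadd IHs IHt.
- rewrite /nmul (evalp_nsum (F := fun u => evalw u * neval t)) => [|u].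
    by rewrite -IHs /evalp mulr_suml; apply: eq_bigr => ? _; rewrite -scalerAl.
  by rewrite (evalp_foldr _ _ (evalp_lmulw n)) IHt.
Qed.

Lemma neval_eq n s t : nf rs n s = nf rs n t -> neval s = neval t.
Proof. by rewrite -!(evalp_nf n) => ->. Qed.

End Rules.
End Soundness.

Declare Scope nexp_scope.
Delimit Scope nexp_scope with N'.
Bind Scope nexp_scope with nexp.
Definition nopp (s : nexp) : nexp := NMul (NCst [:: (0, -1)]) s.
Definition nsub (s t : nexp) : nexp := NAdd s (nopp t).
Notation "s + t" := (NAdd s t) : nexp_scope.
Notation "s * t" := (NMul s t) : nexp_scope.
Notation "- s" := (nopp s) : nexp_scope.
Notation "s - t" := (nsub s t) : nexp_scope.
Notation "c *: s" := (NMul (NCst c) s) : nexp_scope.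

Definition vpow (e : int) : seq (int * int) := [:: (e, 1)].
Definition n1 : nexp := NCst (vpow 0).
Definition lq2 : seq (int * int) := [:: (1, 1); (-1, 1)].
Definition lq3 : seq (int * int) := [:: (2, 1); (0, 1); (-2, 1)].
Definition ldelta : seq (int * int) := [:: (1, 1); (-1, -1)].

Definition nqcomm (l : seq (int * int)) (s t : nexp) : nexp :=
  (s * t - l *: (t * s))%N'.

Definition nword (l : word) : nexp := foldr (fun x => NMul (NGen x)) n1 l.

Definition mkrule (l : word) (s : nexp) : rule := (l, nf [::] 0 s).

(** Association to the right matters for the normal form: the products are
    rewritten starting next to [z], while x y y with x, y first would be reduced
    to 0 by the rule that expresses the same Serre relation. *)
Definition nserre (x y z : nexp) : nexp :=
  (x * (y * (y * z)) - lq2 *: (y * (x * (y * z))) + y * (y * (x * z)))%N'.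

Section Neval.
Variables (k : fieldType) (v : k) (v0 : v != 0) (vn : forall n, v ^+ n.+1 != 1).
Variables (A : algType k) (g : nat -> A).

Local Notation neval := (neval v g).

Lemma neval_gen n : neval (NGen n) = g n.
Proof. by []. Qed.

Lemma neval_add s t : neval (NAdd s t) = neval s + neval t.
Proof. by []. Qed.

Lemma neval_mul s t : neval (NMul s t) = neval s * neval t.
Proof. by []. Qed.

Lemma neval_opp s : neval (nopp s) = - neval s.
Proof.
by rewrite /= /laurent big_seq1 /= expr0z mulr1 mulrN1z scaleN1r mulN1r.
Qed.

Lemma neval_sub s t : neval (nsub s t) = neval s - neval t.
Proof. by rewrite -neval_opp. Qed.

Lemma neval_scale l s : neval (NMul (NCst l) s) = laurent v l *: neval s.
Proof. by rewrite /= -scalerAl mul1r. Qed.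

Lemma neval_qcomm l s t :
  neval (nqcomm l s t) = qcomm (laurent v l) (neval s) (neval t).
Proof. by rewrite neval_sub neval_scale. Qed.

Lemma laurent_vpow e : laurent v (vpow e) = v ^ e.
Proof. by rewrite /laurent big_seq1 mulr1z mul1r. Qed.

Lemma neval_n1 : neval n1 = 1.
Proof. by rewrite /= laurent_vpow expr0z scale1r. Qed.

Lemma laurent_delta : laurent v ldelta = v - v^-1.
Proof.
by rewrite /laurent big_cons big_seq1 /= mulr1z mul1r mulrN1z mulN1r expr1z.
Qed.

Lemma vv_neq0 : v - v^-1 != 0.
Proof.
apply: contra_neq (vn 1) => e; apply/eqP; rewrite -subr_eq0; apply/eqP.
transitivity (v * (v - v^-1)); last by rewrite e mulr0.
by rewrite mulrBr divff // expr2.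
Qed.

Lemma laurent_lq2 : laurent v lq2 = qint v 2.
Proof.
rewrite /laurent big_cons big_seq1 /= !mulr1z !mul1r expr1z -[v ^ -1]/(v^-1) /qint.
apply: (mulIf vv_neq0); rewrite divfK ?vv_neq0 //.
by field.
Qed.

Lemma laurent_unit e c : c \in [:: 1; -1] -> laurent v [:: (e, c)] != 0.
Proof.
rewrite !inE /laurent big_seq1 /= => /orP[]/eqP->;
  by rewrite ?mulrN1z ?mulr1z ?mulN1r ?mul1r ?oppr_eq0 expfz_neq0.
Qed.

Lemma laurent_lq2_neq0 : laurent v lq2 != 0.
Proof.
have -> : laurent v lq2 = (v ^+ 2 + 1) / v.
  by rewrite /laurent big_cons big_seq1 /= !mul1r -[v ^ -1]/(v^-1) expr1z; field.
rewrite mulf_neq0 ?invr_eq0 //; apply: contra_neq (vn 3) => /eqP.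
by rewrite addr_eq0 => /eqP v2; rewrite (exprM v 2 2) v2 sqrrN expr1n.
Qed.

Lemma laurent_lq3_neq0 : laurent v lq3 != 0.
Proof.
have -> : laurent v lq3 = (v ^+ 4 + v ^+ 2 + 1) / v ^+ 2.
  rewrite /laurent 2!big_cons big_seq1 /= !mul1r -[v ^ -2]/(v ^- 2) expr0z.
  by rewrite -[v ^ 2]/(v ^+ 2); field.
rewrite mulf_neq0 ?invr_eq0 ?expf_neq0 //; apply: contra_neq (vn 5) => v3.
apply/eqP; rewrite -subr_eq0; apply/eqP.
transitivity ((v ^+ 4 + v ^+ 2 + 1) * (v ^+ 2 - 1)); first by ring.
by rewrite v3 mul0r.
Qed.

Lemma neval_nserre x y z : neval (nserre x y z) =
  neval x * (neval y * (neval y * neval z))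
  - qint v 2 *: (neval y * (neval x * (neval y * neval z)))
  + neval y * (neval y * (neval x * neval z)).
Proof. by rewrite neval_add neval_sub neval_scale laurent_lq2. Qed.

Lemma neval_scale_eq0 l x : neval x = 0 -> neval (NMul (NCst l) x) = 0.
Proof. by rewrite neval_scale => ->; rewrite scaler0. Qed.

Lemma neval_mul_eq0 x y : neval x = 0 -> neval (NMul x y) = 0.
Proof. by rewrite neval_mul => ->; rewrite mul0r. Qed.

Lemma neval_add_eq0 x y : neval x = 0 -> neval y = 0 -> neval (NAdd x y) = 0.
Proof. by rewrite neval_add => -> ->; rewrite addr0. Qed.

Lemma neval_sub_eq0 x y : neval x = 0 -> neval y = 0 -> neval (nsub x y) = 0.
Proof. by rewrite neval_sub => -> ->; rewrite subr0. Qed.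

Lemma neval_qcomm_eq0 l x y : neval y = 0 -> neval (nqcomm l x y) = 0.
Proof.
by rewrite neval_qcomm /qcomm => ->; rewrite mulr0 mul0r scaler0 subrr.
Qed.

Lemma sound_mkrule l s : sound v g (mkrule l s) <-> evalw g l = neval s.
Proof. by rewrite /sound /= (@evalp_nf _ _ v0 _ g [::] I). Qed.

Lemma neval_word l : neval (nword l) = evalw g l.
Proof.
elim: l => [|x l IH]; first by rewrite neval_n1 /evalw big_nil.
by rewrite evalw_cons -IH.
Qed.

(** A relation [e = 0] yields a new rule once the rules already known reduce [e]
    to a nonzero multiple of the difference of its two sides. *)
Lemma derive_rule rs (rs_sound : all_sound v g rs) n c l s e :
  laurent v c != 0 -> neval e = 0 ->
  nf rs n e = nf rs n (NMul (NCst c) (nsub (nword l) s)) ->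
  sound v g (mkrule l s).
Proof.
move=> c0 e0 /(neval_eq v0 rs_sound); rewrite e0 neval_scale neval_sub neval_word.
move=> /esym/eqP; rewrite scaler_eq0 (negPf c0) /= subr_eq0 => /eqP ?.
exact/sound_mkrule.
Qed.

End Neval.

Ltac neval_simp :=
  rewrite ?(neval_sub, neval_opp, neval_add, neval_qcomm, neval_scale, neval_mul,
            neval_gen, laurent_vpow).

(** Proves an equation between values of [s] and [t] by comparing their normal
    forms; [normal] is the soundness statement of the rule system in use. *)
Tactic Notation "by_normal" constr(normal) constr(s) constr(t) :=
  have := normal s t; neval_simp; rewrite ?expr0z ?expr1z;
  apply; vm_compute; reflexivity.

(** * The relations of the iquantum group in an arbitrary algebra *)

Lemma I3P (P : 'I_3 -> Prop) : P 0 -> P 1 -> P 2 -> forall i, P i.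
Proof.
move=> P0 P1 P2 [[|[|[|//]]] Hi]; [move: P0|move: P1|move: P2];
  by congr P; apply/val_inj.
Qed.

Lemma tauK : involutive tau. Proof. by elim/I3P; apply/val_inj. Qed.

Lemma tau_neq0 i : i != 0 -> tau i != 0. Proof. by elim/I3P: i. Qed.

(** The defining relations, so that a triple of families satisfying them is the
    same as a morphism from the iquantum group ([iU_lift]).  Having them in
    every algebra makes the diagram symmetry and the anti-involution available
    as statements about [irels]. *)
Record irels (k : fieldType) (A : algType k) (v : k) (b kk d : 'I_3 -> A) : Prop :=
  IRels {
  ir_KK : forall i j, kk i * kk j = kk j * kk i;
  ir_Kd : forall i, kk i * d i = 1;
  ir_dK : forall i, d i * kk i = 1;
  ir_KB : forall i j,
    kk i * b j = v ^ (cartan (tau i) j - cartan i j) *: (b j * kk i);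
  ir_serre12 : b 2 * b 1 * b 1 - qint v 2 *: (b 1 * b 2 * b 1) + b 1 * b 1 * b 2
    = - qint v 2 *: (v *: (kk 1 * b 1) + v *: (b 1 * kk 2));
  ir_serre21 : b 1 * b 2 * b 2 - qint v 2 *: (b 2 * b 1 * b 2) + b 2 * b 2 * b 1
    = - qint v 2 *: (v *: (kk 2 * b 2) + v *: (b 2 * kk 1));
  ir_serrei0 : forall i, i != 0 ->
    b 0 * b i * b i - qint v 2 *: (b i * b 0 * b i) + b i * b i * b 0 = 0;
  ir_serre0i : forall i, i != 0 ->
    b i * b 0 * b 0 - qint v 2 *: (b 0 * b i * b 0) + b 0 * b 0 * b i
      = - v^-1 *: (kk 0 * b i) }.

Section Values.
Variables (k : fieldType) (A : algType k) (v : k).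

Definition braid_poly (x1 x2 x0 y1 y2 : A) : A :=
  v *: qcomm 1 (qcomm v x1 x2) (qcomm 1 x2 (qcomm v x1 x0))
  - qcomm 1 (qcomm (v ^+ 3) x1 x2) x0 * y2 + v *: (x0 * y1 * y2).

Variables (b kk d : 'I_3 -> A).

Definition braidB (i : 'I_3) : A :=
  if i == 0 then braid_poly (b 1) (b 2) (b 0) (kk 1) (kk 2)
  else - (v *: (b i * d i)).

Definition braidK (i : 'I_3) : A :=
  if i == 0 then v ^+ 2 *: (kk 0 * kk 1 ^+ 2 * kk 2 ^+ 2) else v^-1 *: d (tau i).

Definition braidD (i : 'I_3) : A :=
  if i == 0 then v ^- 2 *: (d 2 ^+ 2 * d 1 ^+ 2 * d 0) else v *: kk (tau i).

Lemma irels_swap : irels v b kk d -> irels v (b \o tau) (kk \o tau) (d \o tau).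
Proof.
move=> H; split=> [i j|i|i|i j|||i i0|i i0] /=.
- exact: ir_KK H _ _.
- exact: ir_Kd H _.
- exact: ir_dK H _.
- by rewrite (ir_KB H); elim/I3P: i; elim/I3P: j.
- exact: ir_serre21 H.
- exact: ir_serre12 H.
- exact: ir_serrei0 H _ (tau_neq0 i0).
- exact: ir_serre0i H _ (tau_neq0 i0).
Qed.

End Values.

(** * The module generated by B_0 *)

Section QCommutes.
Variables (k : fieldType) (v : k) (v0 : v != 0) (A : algType k).

Definition qcommutes (z : A) (a : int) (x : A) : Prop := z * x = v ^ a *: (x * z).

Lemma qcommutesM z a c x y :
  qcommutes z a x -> qcommutes z c y -> qcommutes z (a + c) (x * y).
Proof.
move=> zx zy; rewrite /qcommutes mulrA zx -scalerAl -(mulrA x z) zy -scalerAr.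
by rewrite scalerA mulrA expfzDr.
Qed.

Lemma qcommutesD z a x y :
  qcommutes z a x -> qcommutes z a y -> qcommutes z a (x + y).
Proof. by rewrite /qcommutes => zx zy; rewrite mulrDr mulrDl scalerDr zx zy. Qed.

Lemma qcommutesZ z a l x : qcommutes z a x -> qcommutes z a (l *: x).
Proof. by rewrite /qcommutes => zx; rewrite -scalerAr zx -scalerAl !scalerA mulrC. Qed.

Lemma qcommutesN z a x : qcommutes z a x -> qcommutes z a (- x).
Proof. by rewrite -scaleN1r; apply: qcommutesZ. Qed.

Lemma qcommutes_qcomm z a c l x y :
  qcommutes z a x -> qcommutes z c y -> qcommutes z (a + c) (qcomm l x y).
Proof.
move=> zx zy; apply: qcommutesD (qcommutesM zx zy) _.
by rewrite addrC; apply/qcommutesN/qcommutesZ/qcommutesM.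
Qed.

Lemma qcommutes_inv z z' a x :
  z * z' = 1 -> z' * z = 1 -> qcommutes z a x -> qcommutes z' (- a) x.
Proof.
move=> zz z'z zx; rewrite /qcommutes -[LHS]mulr1 -zz.
have -> : z' * x * (z * z') = z' * (x * z) * z' by rewrite !mulrA.
have -> : x * z = v ^ (- a) *: (z * x).
  by rewrite zx scalerA -expfzDr // addNr expr0z scale1r.
by rewrite -scalerAr -scalerAl !mulrA z'z mul1r.
Qed.

Lemma qcommutes_eq z a c x : qcommutes z c x -> c = a -> qcommutes z a x.
Proof. by move=> zx <-. Qed.

End QCommutes.

(** The letters p, r, t, g stand for the brackets of B_0 listed in [ival]. *)
Notation nb0 := (NGen 0).
Notation nb1 := (NGen 1).
Notation nb2 := (NGen 2).
Notation np1 := (NGen 3).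
Notation np2 := (NGen 4).
Notation nr1 := (NGen 5).
Notation nr2 := (NGen 6).
Notation nt1 := (NGen 7).
Notation nt2 := (NGen 8).
Notation ng := (NGen 9).
Notation nk1 := (NGen 10).
Notation nd1 := (NGen 11).
Notation nk2 := (NGen 12).
Notation nd2 := (NGen 13).
Notation nk0 := (NGen 14).

Local Open Scope nexp_scope.

Definition nbraid (x1 x2 x0 y1 y2 : nexp) : nexp :=
  vpow 1 *: nqcomm (vpow 0) (nqcomm (vpow 1) x1 x2)
                   (nqcomm (vpow 0) x2 (nqcomm (vpow 1) x1 x0))
  - nqcomm (vpow 0) (nqcomm (vpow 3) x1 x2) x0 * y2 + vpow 1 *: (x0 * y1 * y2).

(** Each right-hand side is the result of solving one relation, reduced by the
    rules preceding it, for the word on the left; [base_sound] and [iU_sound]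
    say which relation it is. *)
Definition rule_b2_b1_b1 : rule :=
  mkrule [:: 2; 1; 1] (
    [:: (0, -1)] *: (nb1 * nb1 * nb2) + lq2 *: (nb1 * nb2 * nb1)
     - [:: (-1, 1); (-3, 1)] *: (nb1 * nk1)
     - [:: (2, 1); (0, 1)] *: (nb1 * nk2)).
Definition rule_b2_b2_b1 : rule :=
  mkrule [:: 2; 2; 1] (
    [:: (0, -1)] *: (nb1 * nb2 * nb2) + lq2 *: (nb2 * nb1 * nb2)
     - [:: (2, 1); (0, 1)] *: (nb2 * nk1)
     - [:: (-1, 1); (-3, 1)] *: (nb2 * nk2)).
Definition rule_b1_b0 : rule :=
  mkrule [:: 1; 0] (
    vpow 1 *: (nb0 * nb1) + np1).
Definition rule_b2_b0 : rule :=
  mkrule [:: 2; 0] (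
    vpow 1 *: (nb0 * nb2) + np2).
Definition rule_b1_p1 : rule :=
  mkrule [:: 1; 3] (
    vpow (-1) *: (np1 * nb1)).
Definition rule_b2_p2 : rule :=
  mkrule [:: 2; 4] (
    vpow (-1) *: (np2 * nb2)).
Definition rule_b1_p2 : rule :=
  mkrule [:: 1; 4] (
    vpow 2 *: (np2 * nb1) + nr1).
Definition rule_b2_p1 : rule :=
  mkrule [:: 2; 3] (
    vpow 2 *: (np1 * nb2) + nr2).
Definition rule_b1_r2 : rule :=
  mkrule [:: 1; 6] (
    nr2 * nb1 + nt1).
Definition rule_b2_r1 : rule :=
  mkrule [:: 2; 5] (
    nr1 * nb2 + nt2).
Definition rule_b1_r1 : rule :=
  mkrule [:: 1; 5] (
    [:: (2, 1); (-2, -1)] *: (nb0 * nb1 * nk1)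
     + [:: (5, 1); (1, -1)] *: (nb0 * nb1 * nk2)
     - [:: (-1, 1); (-3, 1)] *: (np1 * nk1)
     - [:: (2, 1); (0, 1)] *: (np1 * nk2) + nr1 * nb1 + lq2 *: nt1).
Definition rule_b2_r2 : rule :=
  mkrule [:: 2; 6] (
    [:: (5, 1); (1, -1)] *: (nb0 * nb2 * nk1)
     + [:: (2, 1); (-2, -1)] *: (nb0 * nb2 * nk2)
     - [:: (2, 1); (0, 1)] *: (np2 * nk1)
     - [:: (-1, 1); (-3, 1)] *: (np2 * nk2) + nr2 * nb2 + lq2 *: nt2).
Definition rule_b1_t1 : rule :=
  mkrule [:: 1; 7] (
    [:: (-1, 1); (-3, 1); (-5, -1); (-7, -1)] *: (np1 * nb1 * nk1)
     + [:: (4, -1); (0, 1)] *: (np1 * nb1 * nk2) + vpow (-2) *: (nt1 * nb1)).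
Definition rule_b2_t2 : rule :=
  mkrule [:: 2; 8] (
    [:: (4, -1); (0, 1)] *: (np2 * nb2 * nk1)
     + [:: (-1, 1); (-3, 1); (-5, -1); (-7, -1)] *: (np2 * nb2 * nk2)
     + vpow (-2) *: (nt2 * nb2)).
Definition rule_b2_t1 : rule :=
  mkrule [:: 2; 7] (
    [:: (5, 1); (1, -1)] *: (nb0 * nb1 * nb2 * nk1)
     + [:: (2, 1); (0, -1)] *: (nb0 * nb1 * nb2 * nk2)
     + [:: (2, -1); (-2, 1)] *: (nb0 * nb2 * nb1 * nk1)
     + [:: (5, -1); (3, 1)] *: (nb0 * nb2 * nb1 * nk2)
     + vpow (-1) *: (nb0 * nk1 * nk2)
     + [:: (3, 1); (-1, -1)] *: (np1 * nb2 * nk2)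
     + [:: (3, -1); (1, -1); (-1, 1); (-3, 1)] *: (np2 * nb1 * nk1)
     + [:: (2, 2); (0, -1); (-2, -1)] *: (np2 * nb1 * nk2)
     - lq2 *: (nr1 * nk1) - [:: (-2, 2); (-4, 1)] *: (nr1 * nk2)
     + vpow 1 *: (nr2 * nk2) + vpow 1 *: (nt1 * nb2) - lq2 *: (nt2 * nb1)
     - vpow (-2) *: ng + [:: (0, 1); (-2, 1)] *: (nb1 * nt2)).
Definition rule_b1_t2 : rule :=
  mkrule [:: 1; 8] (
    [:: (5, -1); (3, 1)] *: (nb0 * nb1 * nb2 * nk1)
     + [:: (2, 1); (0, -1)] *: (nb0 * nb2 * nb1 * nk1)
     - vpow 1 *: (nb0 * nk1 * nk2) + [:: (4, -1); (2, 1)] *: (np1 * nb2 * nk1)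
     + [:: (3, 1); (-1, -1)] *: (np2 * nb1 * nk1)
     + [:: (4, -1); (0, 1)] *: (np2 * nb1 * nk2) + vpow 1 *: (nr1 * nk1)
     + [:: (0, 1); (-2, 1)] *: (nr1 * nk2) + nr2 * nk1 + vpow 1 *: (nt2 * nb1)
     + ng).
Definition rule_b1_g : rule :=
  mkrule [:: 1; 9] (
    [:: (2, 1); (0, -1)] *: (nb0 * nb1 * nk1 * nk2)
     - [:: (-2, 1); (-4, 1)] *: (np1 * nk1 * nk1)
     - vpow (-1) *: (np1 * nk1 * nk2) + vpow (-2) *: (nt1 * nk1)
     + vpow (-1) *: (ng * nb1)).
Definition rule_b2_g : rule :=
  mkrule [:: 2; 9] (
    [:: (2, 1); (0, -1)] *: (nb0 * nb2 * nk1 * nk2)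
     - vpow (-1) *: (np2 * nk1 * nk2)
     - [:: (-2, 1); (-4, 1)] *: (np2 * nk2 * nk2) + vpow (-2) *: (nt2 * nk2)
     + vpow (-1) *: (ng * nb2)).

Definition torus_move (z : nat) (a : int) : seq rule :=
  [seq mkrule [:: z; t.1] (vpow (a * t.2) *: (NGen t.1 * NGen z))
  | t <- [:: (0%N, 0); (1%N, 1); (2%N, -1); (3%N, 1); (4%N, -1);
             (5%N, 0); (6%N, 0); (7%N, 1); (8%N, -1); (9%N, 0)]].

Definition torus_rules : seq rule :=
  torus_move 10 (-3) ++ torus_move 11 3 ++ torus_move 12 3 ++
  torus_move 13 (-3) ++ torus_move 14 0 ++
  [seq mkrule [:: t.1; t.2] (NGen t.2 * NGen t.1)
  | t <- [:: (12, 10); (12, 11); (13, 10); (13, 11); (14, 10); (14, 11);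
             (14, 12); (14, 13)]%N] ++
  [seq mkrule [:: t.1; t.2] n1
  | t <- [:: (10, 11); (11, 10); (12, 13); (13, 12)]%N].

Definition base_rules : seq rule :=
  [:: rule_b2_b1_b1; rule_b2_b2_b1; rule_b1_p1; rule_b2_p2; rule_b1_b0; rule_b2_b0;
      rule_b1_p2; rule_b2_p1; rule_b1_r2; rule_b2_r1] ++ torus_rules.

Definition iU_rules : seq rule :=
  [:: rule_b2_g; rule_b1_g; rule_b1_t2; rule_b2_t1; rule_b2_t2; rule_b1_t1;
      rule_b2_r2; rule_b1_r1] ++ base_rules.

Definition nserre12 (z : nexp) : nexp :=
  nserre nb2 nb1 z
  + lq2 *: (vpow 1 *: (nk1 * (nb1 * z)) + vpow 1 *: (nb1 * (nk2 * z))).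
Definition nserre21 (z : nexp) : nexp :=
  nserre nb1 nb2 z
  + lq2 *: (vpow 1 *: (nk2 * (nb2 * z)) + vpow 1 *: (nb2 * (nk1 * z))).

Local Close Scope nexp_scope.

Lemma neval_nbraid (k : fieldType) (v : k) (A : algType k) (g : nat -> A) x1 x2 x0 y1 y2 :
  neval v g (nbraid x1 x2 x0 y1 y2) =
  braid_poly v (neval v g x1) (neval v g x2) (neval v g x0) (neval v g y1) (neval v g y2).
Proof.
rewrite /nbraid neval_add neval_sub !neval_scale !neval_mul !neval_qcomm !laurent_vpow.
by rewrite expr0z expr1z.
Qed.

Section IModule.
Variables (k : fieldType) (v : k) (v0 : v != 0) (vn : forall n, v ^+ n.+1 != 1).
Variables (A : algType k) (b kk d : 'I_3 -> A) (H : irels v b kk d).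

Let P1 := qcomm v (b 1) (b 0).
Let P2 := qcomm v (b 2) (b 0).
Let R1 := qcomm (v ^ 2) (b 1) P2.
Let R2 := qcomm (v ^ 2) (b 2) P1.

(** Letters 0 and 3 to 9 are the eight weight vectors; the highest one is chosen
    to be the image of B_0 itself, which keeps its commutation rules short. *)
Definition ival : nat -> A :=
  nth 0 [:: b 0; b 1; b 2; P1; P2; R1; R2; qcomm 1 (b 1) R2; qcomm 1 (b 2) R1;
            braid_poly v (b 1) (b 2) (b 0) (kk 1) (kk 2);
            kk 1; d 1; kk 2; d 2; kk 0].

Local Notation neval := (neval v ival).
Local Notation sound := (sound v ival).
Local Notation all_sound := (all_sound v ival).
Local Notation qcommutes := (qcommutes v).

Lemma torus_move_sound n a :
  qcommutes (ival n) 0 (b 0) -> qcommutes (ival n) a (b 1) ->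
  qcommutes (ival n) (- a) (b 2) ->
  qcommutes (ival n) 0 (kk 1) -> qcommutes (ival n) 0 (kk 2) ->
  all_sound (torus_move n a).
Proof.
move=> z0 z1 z2 zk1 zk2.
have zP1 : qcommutes (ival n) a P1.
  by apply: qcommutes_eq (qcommutes_qcomm v0 _ z1 z0) (addr0 _).
have zP2 : qcommutes (ival n) (- a) P2.
  by apply: qcommutes_eq (qcommutes_qcomm v0 _ z2 z0) (addr0 _).
have zR1 : qcommutes (ival n) 0 R1.
  by apply: qcommutes_eq (qcommutes_qcomm v0 _ z1 zP2) (subrr _).
have zR2 : qcommutes (ival n) 0 R2.
  by apply: qcommutes_eq (qcommutes_qcomm v0 _ z2 zP1) (addNr _).
have z12 l : qcommutes (ival n) 0 (qcomm l (b 1) (b 2)).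
  by apply: qcommutes_eq (qcommutes_qcomm v0 _ z1 z2) (subrr _).
have zG : qcommutes (ival n) 0 (braid_poly v (b 1) (b 2) (b 0) (kk 1) (kk 2)).
  apply: qcommutesD; first apply: qcommutesD.
  - apply: qcommutesZ; apply: qcommutes_eq (qcommutes_qcomm v0 _ (z12 _) _) (addr0 _).
    by apply: qcommutes_eq (qcommutes_qcomm v0 _ z2 zP1) (addNr _).
  - apply: qcommutesN; apply: qcommutes_eq (qcommutesM v0 _ zk2) (addr0 _).
    by apply: qcommutes_eq (qcommutes_qcomm v0 _ (z12 _) z0) (addr0 _).
  - apply: qcommutesZ; apply: qcommutes_eq (qcommutesM v0 _ zk2) (addr0 _).
    by apply: qcommutes_eq (qcommutesM v0 z0 zk1) (addr0 _).
have rl x c : qcommutes (ival n) c (ival x) ->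
    sound (mkrule [:: n; x] (NMul (NCst (vpow c)) (NMul (NGen x) (NGen n)))).
  by move=> nx; apply/(sound_mkrule v0); rewrite evalw2 neval_scale laurent_vpow.
have ma0 : a * 0 = 0 by rewrite mulr0.
have ma1 : a * 1 = a by rewrite mulr1.
have maN : a * -1 = - a by rewrite mulrN1.
do 7!(apply: conj; first by [apply: rl; rewrite ?(ma0, ma1, maN)]).
apply: conj; first by [apply: rl; rewrite ma1 -[a]addr0; apply: qcommutes_qcomm].
apply: conj; first by [apply: rl; rewrite maN -[- a]addr0; apply: qcommutes_qcomm].
by apply: conj; first by [apply: rl; rewrite ma0].
Qed.

Lemma torus_sound : all_sound torus_rules.
Proof.
have qq i j c : cartan (tau i) j - cartan i j = c -> qcommutes (kk i) c (b j).
  by move=> <-; apply: ir_KB H i j.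
have cm x y : x * y = y * x -> qcommutes x 0 y.
  by rewrite /qcommutes expr0z scale1r.
have KK i j : qcommutes (kk i) 0 (kk j) by apply/cm/(ir_KK H).
have inv i x c : qcommutes (kk i) c x -> qcommutes (d i) (- c) x.
  exact: (qcommutes_inv v0 (ir_Kd H i) (ir_dK H i)).
have dK i j : d i * kk j = kk j * d i.
  by have := inv i _ _ (KK i j); rewrite oppr0 /qcommutes expr0z scale1r.
have dd i j : d i * d j = d j * d i.
  have /esym/cm := dK j i.
  by move/inv; rewrite oppr0 /qcommutes expr0z scale1r.
have dB i j c : cartan (tau i) j - cartan i j = - c -> qcommutes (d i) c (b j).
  by move=> e; have := inv i _ _ (qq i j _ e); rewrite opprK.
have dk i j : qcommutes (d i) 0 (kk j) by apply/cm/dK.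
rewrite /torus_rules; repeat apply: all_sound_cat.
- by apply: torus_move_sound; do ?[exact: qq | exact: KK].
- by apply: torus_move_sound; do ?[exact: dB | exact: dk].
- by apply: torus_move_sound; do ?[exact: qq | exact: KK].
- by apply: torus_move_sound; do ?[exact: dB | exact: dk].
- by apply: torus_move_sound; do ?[exact: qq | exact: KK].
- do 8!(apply: conj; first by [apply/(sound_mkrule v0);
    rewrite neval_mul evalw2; first [exact: (ir_KK H) | exact: dK
      | exact: esym (dK _ _) | exact: dd]]).
  exact: I.
- do 4!(apply: conj; first by [apply/(sound_mkrule v0); rewrite neval_n1 evalw2;
    first [exact: (ir_dK H) | exact: (ir_Kd H)]]).
  exact: I.
Qed.

Lemma nserre12_eq0 z : neval (nserre12 z) = 0.
Proof.
rewrite neval_add (neval_nserre v0 vn) neval_scale neval_add !neval_scale !laurent_vpow.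
rewrite (laurent_lq2 v0 vn); have := congr1 (fun t => t * neval z) (ir_serre12 H).
rewrite !(mulrDl, mulNr, scaleNr) -!scalerAl !mulrDl -!scalerAl -!mulrA => ->.
by rewrite expr1z addNr.
Qed.

Lemma nserre21_eq0 z : neval (nserre21 z) = 0.
Proof.
rewrite neval_add (neval_nserre v0 vn) neval_scale neval_add !neval_scale !laurent_vpow.
rewrite (laurent_lq2 v0 vn); have := congr1 (fun t => t * neval z) (ir_serre21 H).
rewrite !(mulrDl, mulNr, scaleNr) -!scalerAl !mulrDl -!scalerAl -!mulrA => ->.
by rewrite expr1z addNr.
Qed.

Lemma nserrei0_eq0 : neval (nserre nb0 nb1 n1) = 0 /\ neval (nserre nb0 nb2 n1) = 0.
Proof.
by split; rewrite (neval_nserre v0 vn) neval_n1 !mulr1 !mulrA (ir_serrei0 H).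
Qed.

Lemma base_sound : all_sound base_rules.
Proof.
have tor := torus_sound; have [s10 s20] := nserrei0_eq0.
have unit1 : laurent v (vpow 0) != 0 by apply: laurent_unit.
have def x y z c : ival z = qcomm (v ^ c) (ival x) (ival y) ->
    sound (mkrule [:: x; y] (NAdd (NMul (NCst (vpow c)) (NMul (NGen y) (NGen x))) (NGen z))).
  move=> e; apply/(sound_mkrule v0).
  by rewrite evalw2 neval_add neval_scale laurent_vpow !neval_gen e addrC subrK.
have d10 : sound rule_b1_b0 by apply: def; rewrite expr1z.
have d20 : sound rule_b2_b0 by apply: def; rewrite expr1z.
apply: conj; first by [apply: (derive_rule v0 (n := 100) tor unit1 (nserre12_eq0 n1)); vm_compute].
apply: conj; first by [apply: (derive_rule v0 (n := 100) tor unit1 (nserre21_eq0 n1)); vm_compute].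
apply: conj; first by [apply: (@derive_rule _ _ v0 _ _ [:: rule_b1_b0] (conj d10 I) 100
  _ _ _ _ unit1 s10); vm_compute].
apply: conj; first by [apply: (@derive_rule _ _ v0 _ _ [:: rule_b2_b0] (conj d20 I) 100
  _ _ _ _ unit1 s20); vm_compute].
do 2!apply: conj => //; do 2!(apply: conj; first exact: def).
by do 2!(apply: conj; first by [apply/(sound_mkrule v0);
  rewrite evalw2 neval_add neval_mul !neval_gen /ival /= addrC [qcomm 1 _ _]/qcomm scale1r subrK]).
Qed.

(** The remaining rules come from applying the two Serre relations between B_1
    and B_2 to weight vectors, and from the definition of the highest one. *)
Lemma iU_sound : all_sound iU_rules.
Proof.
have cons r rs : all_sound rs -> sound r -> all_sound (r :: rs) by [].
have unit e c : c \in [:: 1; -1] -> laurent v [:: (e, c)] != 0 by apply: laurent_unit.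
have gE : neval (nsub (nbraid nb1 nb2 nb0 nk1 nk2) ng) = 0.
  by rewrite neval_sub neval_nbraid !neval_gen subrr.
have a0 := base_sound.
have a1 : all_sound (rule_b1_r1 :: base_rules).
  apply: cons => //; apply: (@derive_rule _ _ v0 _ _ _ a0 100 (vpow 0) _ _ _
    (unit 0 1 isT) (nserre12_eq0 nb0)); by vm_compute.
have a2 : all_sound (rule_b2_r2 :: rule_b1_r1 :: base_rules).
  apply: cons => //; apply: (@derive_rule _ _ v0 _ _ _ a1 100 (vpow 0) _ _ _
    (unit 0 1 isT) (nserre21_eq0 nb0)); by vm_compute.
have a3 : all_sound [:: rule_b1_t1, rule_b2_r2, rule_b1_r1 & base_rules].
  apply: cons => //; apply: (@derive_rule _ _ v0 _ _ _ a2 100 (vpow 0) _ _ _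
    (unit 0 1 isT) (nserre12_eq0 np1)); by vm_compute.
have a4 : all_sound [:: rule_b2_t2, rule_b1_t1, rule_b2_r2, rule_b1_r1 & base_rules].
  apply: cons => //; apply: (@derive_rule _ _ v0 _ _ _ a3 100 (vpow 0) _ _ _
    (unit 0 1 isT) (nserre21_eq0 np2)); by vm_compute.
have a5 : all_sound
    [:: rule_b2_t1, rule_b2_t2, rule_b1_t1, rule_b2_r2, rule_b1_r1 & base_rules].
  apply: cons => //; apply: (@derive_rule _ _ v0 _ _ _ a4 100 [:: (2, -1)] _ _ _
    (unit 2 (-1) isT) gE); by vm_compute.
have a6 : all_sound
    [:: rule_b1_t2, rule_b2_t1, rule_b2_t2, rule_b1_t1, rule_b2_r2, rule_b1_r1 & base_rules].
  apply: cons => //; apply: (@derive_rule _ _ v0 _ _ _ a5 100 lq2 _ _ _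
    (laurent_lq2_neq0 v0 vn) (neval_scale_eq0 [:: (2, -1)] (nserre21_eq0 np1))).
  by vm_compute.
have a7 : all_sound [:: rule_b1_g, rule_b1_t2, rule_b2_t1, rule_b2_t2, rule_b1_t1,
    rule_b2_r2, rule_b1_r1 & base_rules].
  apply: cons => //; apply: (@derive_rule _ _ v0 _ _ _ a6 100 lq3 _ _ _
    (laurent_lq3_neq0 v0 vn) (neval_scale_eq0 [:: (0, -1)] (nserre12_eq0 nr1))).
  by vm_compute.
apply: cons => //; apply: (@derive_rule _ _ v0 _ _ _ a7 100 lq3 _ _ _
  (laurent_lq3_neq0 v0 vn) (neval_scale_eq0 [:: (0, -1)] (nserre21_eq0 nr2))).
by vm_compute.
Qed.

Lemma iU_normal s t : nf iU_rules 100 s = nf iU_rules 100 t -> neval s = neval t.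
Proof. exact: (neval_eq v0 iU_sound). Qed.

End IModule.

(** * The braid images satisfy the relations *)

Local Open Scope nexp_scope.

Definition nbraidB (i : 'I_3) : nexp :=
  if i == 0 then ng else if i == 1 then - (vpow 1 *: (nb1 * nd1))
  else - (vpow 1 *: (nb2 * nd2)).
Definition nbraidK (i : 'I_3) : nexp :=
  if i == 0 then vpow 2 *: (nk0 * (nk1 * nk1) * (nk2 * nk2))
  else if i == 1 then vpow (-1) *: nd2 else vpow (-1) *: nd1.

Definition nserre_rhs (x y z t : nexp) : nexp :=
  - (lq2 *: (vpow 1 *: (x * y) + vpow 1 *: (z * t))).

Definition nrel : nexp := nserre nb1 nb0 n1 + vpow (-1) *: (nk0 * nb1).
Definition nrel_2 : nexp := nqcomm (vpow 3) nb2 nrel.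
Definition nrel_22 : nexp := nqcomm (vpow 1) nb2 nrel_2.
Definition nrel_222 : nexp := nqcomm (vpow (-1)) nb2 nrel_22.
Definition nrel_21 : nexp := nqcomm (vpow 1) nb1 nrel_2.
Definition nrel_221 : nexp := nqcomm (vpow 2) nb1 nrel_22.
Definition nrel_2211 : nexp := nqcomm (vpow 0) nb1 nrel_221.
Definition nrel_222111 : nexp :=
  nqcomm (vpow (-1)) nb1 (nqcomm (vpow 1) nb1 (nqcomm (vpow 3) nb1 nrel_222)).

(** The image of [nrel], multiplied by -v^-1 K_1 to clear the inverse of K_1. *)
Definition nbraid_rel : nexp :=
  nserre nb1 ng n1 + vpow 1 *: (nk0 * (nk1 * (nk1 * (nk2 * (nk2 * nb1))))).

Definition nrel_comb : nexp :=
  lq3 *: (lq3 *: (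
    lq2 *: (lq2 *: (vpow (-4) *: (nrel * nk1) - vpow (-2) *: nrel_21
                    - [:: (-1, 1); (-5, -1)] *: (nrel_2 * nb1)))
    * (nk1 * nk1 * nk1)
    + (lq2 *: (ldelta *: (ldelta *: (nrel_22 * nb1) + vpow (-1) *: nrel_221) * nb1)
       + vpow (-1) *: nrel_2211) * (nk1 * nk1)))
  - vpow (-1) *: (nrel_222111 * nk1).

Local Close Scope nexp_scope.

Section BraidRelations.
Variables (k : fieldType) (v : k) (v0 : v != 0) (vn : forall n, v ^+ n.+1 != 1).
Variables (A : algType k) (b kk d : 'I_3 -> A) (H : irels v b kk d).
Local Notation ival := (ival v b kk d).
Local Notation neval := (neval v ival).
Local Notation TB := (braidB v b kk d).
Local Notation TK := (braidK v kk d).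
Let normal := iU_normal v0 vn H.

Lemma neval_braidB i : neval (nbraidB i) = TB i.
Proof. by elim/I3P: i => //; rewrite neval_opp neval_scale laurent_vpow. Qed.

Lemma neval_braidK i : neval (nbraidK i) = TK i.
Proof. by elim/I3P: i; rewrite neval_scale laurent_vpow. Qed.

Lemma neval_nserre_rhs x y z t : neval (nserre_rhs x y z t) =
  - qint v 2 *: (v *: (neval x * neval y) + v *: (neval z * neval t)).
Proof.
rewrite neval_opp neval_scale neval_add !neval_scale !neval_mul !laurent_vpow.
by rewrite (laurent_lq2 v0 vn) expr1z scaleNr.
Qed.

Lemma braid_KK i j : TK i * TK j = TK j * TK i.
Proof.
rewrite -!neval_braidK -!neval_mul; apply: normal.
by elim/I3P: i; elim/I3P: j; vm_compute.
Qed.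

Lemma braid_KB i j :
  TK i * TB j = v ^ (cartan (tau i) j - cartan i j) *: (TB j * TK i).
Proof.
rewrite -!neval_braidK -!neval_braidB -!neval_mul -laurent_vpow -neval_scale.
by apply: normal; elim/I3P: i; elim/I3P: j; vm_compute.
Qed.

Lemma braid_serre12 i : i != 0 ->
  neval (nserre (nbraidB (tau i)) (nbraidB i) n1) =
  neval (nserre_rhs (nbraidK i) (nbraidB i) (nbraidB i) (nbraidK (tau i))).
Proof. by elim/I3P: i => // _; apply: normal; vm_compute. Qed.

Lemma braid_serrei0 i : i != 0 ->
  neval (nserre (nbraidB 0) (nbraidB i) n1) = neval (NCst [::]).
Proof. by elim/I3P: i => // _; apply: normal; vm_compute. Qed.

Lemma braid_poly_sym :
  braid_poly v (b 2) (b 1) (b 0) (kk 2) (kk 1) = braid_poly v (b 1) (b 2) (b 0) (kk 1) (kk 2).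
Proof.
have := normal (s := nbraid nb2 nb1 nb0 nk2 nk1) (t := nbraid nb1 nb2 nb0 nk1 nk2).
by rewrite !neval_nbraid; apply; vm_compute.
Qed.

(** With deg B_i = a_i and deg K_1 = deg K_2 = a_1 + a_2 both sides are
    homogeneous of degree 2a_0 + 5a_1 + 4a_2, and [nrel] has degree 2a_0 + a_1.
    So the image must be a combination of iterated q-commutators of [nrel] with
    B_1 and B_2, multiplied by powers of B_1 and K_1 that make up for the missing
    degree; the coefficients solve the resulting linear system.  The factors
    [2]^2 [3]^2 on the left clear all denominators. *)
Lemma braid_rel :
  neval (NMul (NCst lq3) (NMul (NCst lq3) (NMul (NCst lq2) (NMul (NCst lq2) nbraid_rel))))
  = neval nrel_comb.
Proof. by apply: normal; vm_compute. Qed.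

Lemma nrel_eq0 : neval nrel = 0.
Proof.
rewrite neval_add (neval_nserre v0 vn) neval_scale neval_mul neval_n1.
by rewrite !mulr1 !mulrA (ir_serre0i H) // laurent_vpow scaleNr addNr.
Qed.

Lemma nbraid_rel_eq0 : neval nbraid_rel = 0.
Proof.
have comb0 : neval nrel_comb = 0.
  rewrite /nrel_comb; repeat first [exact: nrel_eq0
    | apply: neval_qcomm_eq0 | apply: neval_sub_eq0 | apply: neval_scale_eq0
    | apply: neval_mul_eq0 | apply: neval_add_eq0].
have := braid_rel; rewrite comb0 !neval_scale => /eqP.
rewrite !scaler_eq0 (negPf (laurent_lq3_neq0 v0 vn)) (negPf (laurent_lq2_neq0 v0 vn)) /=.
by move/eqP.
Qed.

Lemma braid_serre01 :
  TB 1 * TB 0 * TB 0 - qint v 2 *: (TB 0 * TB 1 * TB 0) + TB 0 * TB 0 * TB 1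
    = - v^-1 *: (TK 0 * TB 1).
Proof.
have : neval (nserre (nbraidB 1) (nbraidB 0) n1 + vpow (-1) *: (nbraidK 0 * nbraidB 1))%N'
     = neval (- (vpow 1 *: (nbraid_rel * nd1)))%N'.
  by apply: normal; vm_compute.
rewrite neval_opp neval_scale neval_mul nbraid_rel_eq0 mul0r scaler0 oppr0.
rewrite neval_add (neval_nserre v0 vn) neval_scale neval_mul laurent_vpow.
rewrite !neval_braidB !neval_braidK neval_n1.
by rewrite !mulr1 !mulrA scaleNr => /eqP; rewrite addr_eq0 => /eqP ->.
Qed.

Lemma braid_dK i : braidD v kk d i * TK i = 1.
Proof.
have cancel (x y z x' y' z' : A) : x' * x = 1 -> y' * y = 1 -> z' * z = 1 ->
    z' ^+ 2 * y' ^+ 2 * x' * (x * y ^+ 2 * z ^+ 2) = 1.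
  move=> xx yy zz; rewrite !expr2 !mulrA -(mulrA _ x' x) xx mulr1 -(mulrA _ y' y) yy.
  by rewrite mulr1 -(mulrA _ y' y) yy mulr1 -(mulrA _ z' z) zz mulr1.
rewrite /braidK /braidD; case: ifP => _.
- rewrite -scalerAl -scalerAr scalerA mulVf ?expf_neq0 // scale1r.
  by apply: cancel; apply: (ir_dK H).
- by rewrite -scalerAl -scalerAr scalerA divff // scale1r (ir_Kd H).
Qed.

Lemma braid_Kd i : TK i * braidD v kk d i = 1.
Proof.
have cancel (x y z x' y' z' : A) : x * x' = 1 -> y * y' = 1 -> z * z' = 1 ->
    x * y ^+ 2 * z ^+ 2 * (z' ^+ 2 * y' ^+ 2 * x') = 1.
  move=> xx yy zz; rewrite !expr2 !mulrA -(mulrA _ z z') zz mulr1 -(mulrA _ z z') zz.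
  by rewrite mulr1 -(mulrA _ y y') yy mulr1 -(mulrA _ y y') yy mulr1.
rewrite /braidK /braidD; case: ifP => _.
- rewrite -scalerAl -scalerAr scalerA divff ?expf_neq0 // scale1r.
  by apply: cancel; apply: (ir_Kd H).
- by rewrite -scalerAl -scalerAr scalerA mulVf // scale1r (ir_dK H).
Qed.

Lemma braidK_sym : braidK v (kk \o tau) (d \o tau) 0 = TK 0.
Proof.
have c : GRing.comm (kk 2) (kk 1) := ir_KK H 2 1.
have := commrX 2 (commr_sym (commrX 2 (commr_sym c))); rewrite /GRing.comm => e.
rewrite /braidK /= -[tau 0]/(0 : 'I_3) -[tau 1]/(2 : 'I_3) -[tau 2]/(1 : 'I_3).
by rewrite -mulrA e mulrA.
Qed.

End BraidRelations.

Theorem irels_braid (k : fieldType) (v : k) (v0 : v != 0)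
    (vn : forall n, v ^+ n.+1 != 1) (A : algType k) (b kk d : 'I_3 -> A) :
  irels v b kk d -> irels v (braidB v b kk d) (braidK v kk d) (braidD v kk d).
Proof.
move=> H; have BE := neval_braidB v b kk d; have KE := neval_braidK v b kk d.
split.
- exact: (braid_KK v0 vn H).
- exact: (braid_Kd v0 H).
- exact: (braid_dK v0 H).
- exact: (braid_KB v0 vn H).
- have := braid_serre12 v0 vn H (isT : is_true ((1 : 'I_3) != 0)).
  by rewrite (neval_nserre v0 vn) (neval_nserre_rhs v0 vn) !BE !KE neval_n1 !mulr1 !mulrA.
- have := braid_serre12 v0 vn H (isT : is_true ((2 : 'I_3) != 0)).
  by rewrite (neval_nserre v0 vn) (neval_nserre_rhs v0 vn) !BE !KE neval_n1 !mulr1 !mulrA.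
- move=> i /(braid_serrei0 v0 vn H); rewrite (neval_nserre v0 vn) !BE neval_n1 !mulr1.
  by rewrite !mulrA => ->; rewrite /= /laurent big_nil scale0r.
- elim/I3P=> // _; first exact: (braid_serre01 v0 vn H).
  (* the second relation is the first one for the family permuted by [tau] *)
  have := braid_serre01 v0 vn (irels_swap H); rewrite (braidK_sym H) /braidB /=.
  by rewrite (braid_poly_sym v0 vn H).
Qed.

(** * The opposite algebra and the inverse *)

Section Opposite.
Variables (k : fieldType) (A : algType k).

(** The ring A^c with the scaling of A, again an algebra over the same field. *)
Definition opp_alg : Type := A.
HB.instance Definition _ := GRing.Zmodule.copy opp_alg A.
HB.instance Definition _ := GRing.NzRing.copy opp_alg A^c.
HB.instance Definition _ := GRing.Lmodule.copy opp_alg A.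

Fact opp_scalerAl (a : k) (x y : opp_alg) :
  a *: (x * y) = @GRing.mul opp_alg (a *: x) y.
Proof. exact: (scalerAr a (y : A) (x : A)). Qed.

Fact opp_scalerAr (a : k) (x y : opp_alg) :
  a *: (x * y) = @GRing.mul opp_alg x (a *: y).
Proof. exact: (scalerAl a (y : A) (x : A)). Qed.

HB.instance Definition _ :=
  GRing.LSemiModule_isLSemiAlgebra.Build k opp_alg opp_scalerAl.
HB.instance Definition _ :=
  GRing.LSemiAlgebra_isSemiAlgebra.Build k opp_alg opp_scalerAr.

Lemma oppM (x y : A) : @GRing.mul opp_alg x y = y * x.
Proof. by []. Qed.

Definition to_opp (f : 'I_3 -> A) : 'I_3 -> opp_alg := f.

End Opposite.

(** The anti-involution of the iquantum group: it fixes the B_i and K_0 and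
    exchanges K_1 and K_2, because K_i and K_(tau i) move past B_j with inverse
    scalars. *)
Lemma irels_opp (k : fieldType) (v : k) (v0 : v != 0) (A : algType k)
    (b kk d : 'I_3 -> A) : irels v b kk d ->
  irels v (to_opp b) (to_opp (kk \o tau)) (to_opp (d \o tau)).
Proof.
move=> H; have sw (x y z : A) : x - y + z = z - y + x by rewrite addrC addrCA addrC.
split=> [i j|i|i|i j|||i i0|i i0].
- exact: (ir_KK H (tau j) (tau i)).
- exact: (ir_dK H (tau i)).
- exact: (ir_Kd H (tau i)).
- rewrite /to_opp /= !oppM (ir_KB H) tauK scalerA -expfzDr //.
  by rewrite addrA subrK subrr expr0z scale1r.
- by rewrite /to_opp !oppM !mulrA sw (ir_serre12 H) /= addrC.
- by rewrite /to_opp !oppM !mulrA sw (ir_serre21 H) /= addrC.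
- by rewrite /to_opp !oppM !mulrA sw (ir_serrei0 H).
- rewrite /to_opp !oppM !mulrA sw (ir_serre0i H) //.
  by have := ir_KB H 0 i; rewrite subrr expr0z scale1r => ->.
Qed.

Lemma irels_of_opp (k : fieldType) (v : k) (A : algType k) (b kk d : 'I_3 -> A) :
  v != 0 ->
  irels v (to_opp b) (to_opp kk) (to_opp d) -> irels v b (kk \o tau) (d \o tau).
Proof. by move=> v0 /(irels_opp v0) []. Qed.

Section InverseValues.
Variables (k : fieldType) (A : algType k) (v : k) (b kk d : 'I_3 -> A).

(** The values conjugated by the anti-involution. *)
Definition braidB' : 'I_3 -> A :=
  braidB v (to_opp b) (to_opp (kk \o tau)) (to_opp (d \o tau)).
Definition braidK' : 'I_3 -> A :=
  braidK v (to_opp (kk \o tau)) (to_opp (d \o tau)) \o tau.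
Definition braidD' : 'I_3 -> A :=
  braidD v (to_opp (kk \o tau)) (to_opp (d \o tau)) \o tau.

End InverseValues.

Local Open Scope nexp_scope.

Definition nB1' : nexp := - (vpow 1 *: (nd2 * nb1)).
Definition nB2' : nexp := - (vpow 1 *: (nd1 * nb2)).
Definition nB0' : nexp :=
  let qc l s t := nqcomm l t s in
  vpow 1 *: qc (vpow 0) (qc (vpow 1) nb1 nb2) (qc (vpow 0) nb2 (qc (vpow 1) nb1 nb0))
  - nk1 * qc (vpow 0) (qc (vpow 3) nb1 nb2) nb0 + vpow 1 *: (nk1 * (nk2 * nb0)).
Definition nK0' : nexp := vpow 2 *: (nk1 * nk1 * (nk2 * nk2 * nk0)).

Local Close Scope nexp_scope.

Section Inverse.
Variables (k : fieldType) (v : k) (v0 : v != 0) (vn : forall n, v ^+ n.+1 != 1).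
Variables (A : algType k) (b kk d : 'I_3 -> A) (H : irels v b kk d).

Lemma irels_braid' : irels v (braidB' v b kk d) (braidK' v kk d) (braidD' v kk d).
Proof. by apply/(irels_of_opp v0)/(irels_braid v0 vn)/(irels_opp v0). Qed.

Lemma braid_braid' :
  [/\ braidB v (braidB' v b kk d) (braidK' v kk d) (braidD' v kk d) =1 b,
      braidK v (braidK' v kk d) (braidD' v kk d) =1 kk &
      braidD v (braidK' v kk d) (braidD' v kk d) =1 d].
Proof.
have := irels_braid v0 vn irels_braid'.
set TB := braidB _ _ _ _; set TK := braidK _ _ _; set TD := braidD _ _ _ => T.
have normal := iU_normal v0 vn H.
have TKE : TK =1 kk.
  elim/I3P; rewrite /TK /braidK /=.
  - by by_normal normal
      (NMul (NCst (vpow 2)) (NMul (NMul nK0' (NMul (nbraidK 1) (nbraidK 1)))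
                                  (NMul (nbraidK 2) (nbraidK 2)))) nk0.
  - by rewrite /braidD' /= /braidD /= scalerA mulVf // scale1r.
  - by rewrite /braidD' /= /braidD /= scalerA mulVf // scale1r.
split=> //.
- elim/I3P.
  + by by_normal normal (nbraid nB1' nB2' nB0' (nbraidK 1) (nbraidK 2)) nb0.
  + by by_normal normal (nopp (NMul (NCst (vpow 1)) (NMul nB1' (NMul (NCst (vpow 1)) nk2)))) nb1.
  + by by_normal normal (nopp (NMul (NCst (vpow 1)) (NMul nB2' (NMul (NCst (vpow 1)) nk1)))) nb2.
- by move=> i; rewrite -[RHS]mulr1 -(ir_Kd T i) mulrA TKE (ir_dK H) mul1r.
Qed.

End Inverse.

Lemma opp_braid' (k : fieldType) (v : k) (A : algType k) (b kk d : 'I_3 -> A) :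
  [/\ braidB' v (to_opp b) (to_opp (kk \o tau)) (to_opp (d \o tau)) =1 braidB v b kk d,
      braidK' v (to_opp (kk \o tau)) (to_opp (d \o tau)) =1 braidK v kk d \o tau &
      braidD' v (to_opp (kk \o tau)) (to_opp (d \o tau)) =1 braidD v kk d \o tau].
Proof. by split; elim/I3P. Qed.

(** This is [braid_braid'] in the opposite algebra. *)
Lemma braid'_braid (k : fieldType) (v : k) (v0 : v != 0) (vn : forall n, v ^+ n.+1 != 1)
    (A : algType k) (b kk d : 'I_3 -> A) : irels v b kk d ->
  [/\ braidB' v (braidB v b kk d) (braidK v kk d) (braidD v kk d) =1 b,
      braidK' v (braidK v kk d) (braidD v kk d) =1 kk &
      braidD' v (braidK v kk d) (braidD v kk d) =1 d].
Proof.
move=> H; have [] := braid_braid' v0 vn (irels_opp v0 H).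
have [/funext-> /funext-> /funext->] := opp_braid' v b kk d.
move=> Bb Kk Dd; split=> i.
- exact: Bb.
- by rewrite /braidK' /= [LHS]Kk /to_opp /= tauK.
- by rewrite /braidD' /= [LHS]Dd /to_opp /= tauK.
Qed.

(** * The automorphism of the iquantum group *)

Section Universal.
Variables (k : fieldType) (v : k) (A : algType k) (b kk d : 'I_3 -> A).
Hypothesis H : irels v b kk d.

Definition iU_gen (x : iUgen) : A :=
  match x with IB i => b i | IK i => kk i | IKinv i => d i end.

Lemma iU_gen_rel s t : iUrel v s t -> eval iU_gen s = eval iU_gen t.
Proof.
case=> /= *; rewrite ?mulN1r ?scaleN1r ?mulN1r -?scalerAl ?mul1r ?scale0r ?scale1r.
- exact: (ir_KK H).
- exact: (ir_Kd H).
- exact: (ir_dK H).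
- exact: (ir_KB H).
- exact: (ir_serre12 H).
- exact: (ir_serre21 H).
- exact: (ir_serrei0 H).
- exact: (ir_serre0i H).
Qed.

Definition iU_lift of irels v b kk d : iU v -> A :=
  @Defs.lift _ _ (iUrel v) _ iU_gen.

Lemma iU_lift_cls s : iU_lift H (cls (iUrel v) s) = eval iU_gen s.
Proof. exact: (lift_cls iU_gen_rel). Qed.

Fact iU_lift_linear : linear (iU_lift H).
Proof.
move=> c; elim/clsE=> s; elim/clsE=> t.
rewrite -[c *: _ + _]/(c *: cls (iUrel v) s + cls (iUrel v) t) -clsZ -clsD.
by rewrite !iU_lift_cls /= -scalerAl mul1r.
Qed.

Fact iU_lift_monoid : monoid_morphism (iU_lift H).
Proof.
split; first by rewrite -[1]/(cls (iUrel v) 1%X) iU_lift_cls /= scale1r.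
elim/clsE=> s; elim/clsE=> t.
by rewrite -[_ * _]/(cls (iUrel v) s * cls (iUrel v) t) -clsM !iU_lift_cls.
Qed.

HB.instance Definition _ :=
  GRing.isLinear.Build k (iU v) A *:%R (iU_lift H) iU_lift_linear.
HB.instance Definition _ :=
  GRing.isMonoidMorphism.Build (iU v) A (iU_lift H) iU_lift_monoid.

Lemma iU_liftB i : iU_lift H (iB v i) = b i. Proof. exact: iU_lift_cls. Qed.
Lemma iU_liftK i : iU_lift H (iK v i) = kk i. Proof. exact: iU_lift_cls. Qed.
Lemma iU_liftKinv i : iU_lift H (iKinv v i) = d i. Proof. exact: iU_lift_cls. Qed.

End Universal.

Lemma iU_irels (k : fieldType) (v : k) : irels v (iB v) (iK v) (iKinv v).
Proof.
split=> [i j|i|i|i j|||i i0|i i0]; rewrite ?mulrA.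
- by rewrite -!clsM; apply/cls_rel/iU_KK.
- by rewrite -!clsM; apply/cls_rel/iU_KKinv.
- by rewrite -!clsM; apply/cls_rel/iU_KinvK.
- by rewrite -!clsM -clsZ; apply/cls_rel/iU_KB.
- have := cls_rel (iU_serre12 v).
  by rewrite !(clsD, clsZ, clsN, clsM, clsC) scaleN1r.
- have := cls_rel (iU_serre21 v).
  by rewrite !(clsD, clsZ, clsN, clsM, clsC).
- have := cls_rel (iU_serrei0 v i0).
  by rewrite !(clsD, clsZ, clsN, clsM, cls0).
- have := cls_rel (iU_serre0i v i0).
  by rewrite !(clsD, clsZ, clsN, clsM, cls0).
Qed.

Lemma iU_ext (k : fieldType) (v : k) (A : algType k) (f g : {lrmorphism iU v -> A}) :
  (forall i, f (iB v i) = g (iB v i)) -> (forall i, f (iK v i) = g (iK v i)) ->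
  (forall i, f (iKinv v i) = g (iKinv v i)) -> f =1 g.
Proof.
move=> fB fK fD; elim/clsE; elim=> [[]//|c|s IHs t IHt|s IHs t IHt].
- by rewrite clsC !linearZ /= !rmorph1.
- by rewrite clsD !raddfD /= IHs IHt.
- by rewrite clsM !rmorphM /= IHs IHt.
Qed.

(** [rmorphM] and its relatives also rewrite in products hidden in definitions
    such as [qcomm] or powers; these versions only see the displayed operation. *)
Section LRMorphism.
Variables (k : fieldType) (A B : algType k) (f : {lrmorphism A -> B}).

Lemma lrmorphM x y : f (x * y) = f x * f y. Proof. exact: rmorphM. Qed.
Lemma lrmorphD x y : f (x + y) = f x + f y. Proof. exact: rmorphD. Qed.
Lemma lrmorphZ c x : f (c *: x) = c *: f x. Proof. exact: linearZ. Qed.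
Lemma lrmorphN x : f (- x) = - f x. Proof. exact: rmorphN. Qed.

Lemma lrmorph_qcomm c x y : f (qcomm c x y) = qcomm c (f x) (f y).
Proof. by rewrite /qcomm rmorphB /= linearZ /= !rmorphM. Qed.

End LRMorphism.

Section Naturality.
Variables (k : fieldType) (v : k).

Section Values.
Variables (A B : algType k) (f : {lrmorphism A -> B}) (b kk d : 'I_3 -> A).

Lemma braid_poly_morph x1 x2 x0 y1 y2 :
  f (braid_poly v x1 x2 x0 y1 y2) = braid_poly v (f x1) (f x2) (f x0) (f y1) (f y2).
Proof. by rewrite rmorphD rmorphB /= !linearZ /= !rmorphM /= !lrmorph_qcomm. Qed.

Lemma braidB_morph i :
  f (braidB v b kk d i) = braidB v (f \o b) (f \o kk) (f \o d) i.
Proof.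
rewrite /braidB; case: ifP => _; first exact: braid_poly_morph.
by rewrite lrmorphN lrmorphZ lrmorphM.
Qed.

Lemma braidK_morph i : f (braidK v kk d i) = braidK v (f \o kk) (f \o d) i.
Proof. by rewrite /braidK; case: ifP => _; rewrite linearZ /= ?rmorphM ?rmorphXn. Qed.

Lemma braidD_morph i : f (braidD v kk d i) = braidD v (f \o kk) (f \o d) i.
Proof. by rewrite /braidD; case: ifP => _; rewrite linearZ /= ?rmorphM ?rmorphXn. Qed.

End Values.

Section OppMorphism.
Variables (A B : algType k) (f : {lrmorphism A -> B}).

Definition opp_mor : opp_alg A -> opp_alg B := f.
Fact opp_mor_linear : linear opp_mor. Proof. exact: (linearP f). Qed.
Fact opp_mor_monoid : monoid_morphism opp_mor.
Proof. by split=> [|x y]; [apply: (rmorph1 f)|apply: (rmorphM f y x)]. Qed.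
HB.instance Definition _ := GRing.isLinear.Build k (opp_alg A) (opp_alg B) *:%R
  opp_mor opp_mor_linear.
HB.instance Definition _ := GRing.isMonoidMorphism.Build (opp_alg A) (opp_alg B)
  opp_mor opp_mor_monoid.

Lemma braid'_morph (b kk d : 'I_3 -> A) :
  [/\ f \o braidB' v b kk d = braidB' v (f \o b) (f \o kk) (f \o d),
      f \o braidK' v kk d = braidK' v (f \o kk) (f \o d) &
      f \o braidD' v kk d = braidD' v (f \o kk) (f \o d)].
Proof.
split; apply/funext=> i; [apply: (braidB_morph opp_mor)
  | apply: (braidK_morph opp_mor) | apply: (braidD_morph opp_mor)].
Qed.

End OppMorphism.
End Naturality.

Section Automorphism.
Variables (k : fieldType) (v : k) (v0 : v != 0) (vn : forall n, v ^+ n.+1 != 1).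
Let H := iU_irels v.

Definition iT1inv : {lrmorphism iU v -> iU v} := iU_lift (irels_braid v0 vn H).
Definition iT1 : {lrmorphism iU v -> iU v} := iU_lift (irels_braid' v0 vn H).

Lemma iT1invE : [/\ iT1inv \o iB v = braidB v (iB v) (iK v) (iKinv v),
  iT1inv \o iK v = braidK v (iK v) (iKinv v) &
  iT1inv \o iKinv v = braidD v (iK v) (iKinv v)].
Proof.
by split; apply/funext => i; [apply: iU_liftB|apply: iU_liftK|apply: iU_liftKinv].
Qed.

Lemma iT1E : [/\ iT1 \o iB v = braidB' v (iB v) (iK v) (iKinv v),
  iT1 \o iK v = braidK' v (iK v) (iKinv v) &
  iT1 \o iKinv v = braidD' v (iK v) (iKinv v)].
Proof.
by split; apply/funext => i; [apply: iU_liftB|apply: iU_liftK|apply: iU_liftKinv].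
Qed.

Lemma iT1invK : cancel iT1inv iT1.
Proof.
have [eB eK eD] := iT1E; have [iB' iK' iD'] := iT1invE.
have [hB hK hD] := braid_braid' v0 vn H.
apply: (iU_ext (f := iT1 \o iT1inv) (g := idfun)) => i /=.
- by rewrite -[iT1inv _]/((iT1inv \o iB v) i) iB' braidB_morph eB eK eD hB.
- by rewrite -[iT1inv _]/((iT1inv \o iK v) i) iK' braidK_morph eK eD hK.
- by rewrite -[iT1inv _]/((iT1inv \o iKinv v) i) iD' braidD_morph eK eD hD.
Qed.

Lemma iT1K : cancel iT1 iT1inv.
Proof.
have [eB eK eD] := iT1E; have [iB' iK' iD'] := iT1invE.
have [hB hK hD] := braid'_braid v0 vn H.
have [mB mK mD] := braid'_morph v iT1inv (iB v) (iK v) (iKinv v).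
apply: (iU_ext (f := iT1inv \o iT1) (g := idfun)) => i /=.
- by rewrite -[iT1 _]/((iT1 \o iB v) i) eB -[LHS]/((iT1inv \o _) i) mB iB' iK' iD' hB.
- by rewrite -[iT1 _]/((iT1 \o iK v) i) eK -[LHS]/((iT1inv \o _) i) mK iK' iD' hK.
- by rewrite -[iT1 _]/((iT1 \o iKinv v) i) eD -[LHS]/((iT1inv \o _) i) mD iK' iD' hD.
Qed.

Definition iT1inv_aut : alg_aut (iU v) := AlgAut iT1invK iT1K.

End Automorphism.

(** * Sums in the completion and powers of q-commuting elements *)

Section CompletionTheory.
Variables (A : pzRingType) (J : left_filtration A).
Local Notation chat := (chat J).

Lemma chatD a b : chat (a + b) = chat a + chat b.
Proof. by rewrite [RHS]caddE; apply: eq_clim. Qed.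

Lemma chatM a b : chat (a * b) = chat a * chat b.
Proof. by rewrite [RHS]cmulE; apply: eq_clim. Qed.

Lemma chat1 : chat 1 = 1. Proof. by []. Qed.

Lemma chatN a : chat (- a) = - chat a.
Proof. by rewrite [RHS]coppE; apply: eq_clim. Qed.

(** Summing over m < n+1 leaves c x_m d with m < n on the right, one term short
    of the partial sum; the defect c x_n d tends to 0. *)
Lemma csum_intertwine (x : nat -> A) (hx : null_seq J x) a b c d :
  a * x 0%N = x 0%N * b -> (forall m, a * x m.+1 = x m.+1 * b + c * x m * d) ->
  chat a * csum hx = csum hx * chat b + chat c * csum hx * chat d.
Proof.
move=> x0 xS; rewrite /csum [LHS]cmulE [X in X + _]cmulE [chat c * _]cmulE.
rewrite [X in _ + X]cmulE [RHS]caddE; apply/climP => N /=.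
have [M HM] := fil_right J N d; have [m Hm] := hx M.
pose S n := \sum_(i < n) x i; have SS n : S n.+1 = S n + x n by rewrite /S big_ord_recr.
have aS n : a * S n.+1 = S n.+1 * b + c * S n * d.
  elim: n => [|n IH]; first by rewrite SS /S big_ord0 mulr0 mul0r addr0 add0r.
  by rewrite SS mulrDr IH xS mulrDl (SS n) mulrDr mulrDl addrACA.
exists m.+1 => -[//|n] mn; rewrite -/(S n.+1) aS (SS n) mulrDr mulrDl.
rewrite addrA opprD addrA subrr sub0r -mulrA; exact/filN/filM/HM/Hm.
Qed.

Lemma csum_termwise (x : nat -> A) (hx : null_seq J x) a b :
  (forall m, a * x m = x m * b) -> chat a * csum hx = csum hx * chat b.
Proof.
move=> ab; rewrite (@csum_intertwine x hx a b 0 0) // => [|m].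
  have -> : chat 0 = 0 by [].
  by rewrite mul0r mul0r addr0.
by rewrite ab !mul0r addr0.
Qed.

Lemma csum_comm (x y : nat -> A) (hx : null_seq J x) (hy : null_seq J y) :
  (forall m n, x m * y n = y n * x m) -> csum hx * csum hy = csum hy * csum hx.
Proof.
move=> xy; rewrite [LHS]cmulE [RHS]cmulE; apply: eq_clim => n /=.
rewrite mulr_suml mulr_sumr; apply: eq_bigr => i _.
by rewrite mulr_sumr mulr_suml; apply: eq_bigr => j _.
Qed.

End CompletionTheory.

Section QPowers.
Variables (k : fieldType) (v : k) (v0 : v != 0) (vn : forall n, v ^+ n.+1 != 1).
Variable A : algType k.

Let vv0 : v - v^-1 != 0 := vv_neq0 v0 vn.

Lemma qint_neq0 n : qint v n.+1 != 0.
Proof.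
rewrite mulf_neq0 ?invr_eq0 //.
apply: contra_neq (vn (n.*2.+1)) => e; apply/eqP; rewrite -subr_eq0; apply/eqP.
transitivity (v ^+ n.+1 * (v ^+ n.+1 - v ^- n.+1)); last by rewrite e mulr0.
by rewrite mulrBr divff ?expf_neq0 // -exprD -doubleS addnn.
Qed.

Lemma qintK n : qint v n * (v - v^-1) = v ^+ n - v ^- n.
Proof. by rewrite /qint divfK. Qed.

Lemma qint1 : qint v 1 = 1.
Proof. by rewrite /qint expr1 divff. Qed.

Lemma qintSl n : qint v n.+1 = v ^+ n + v^-1 * qint v n.
Proof.
apply: (mulIf vv0); rewrite mulrDl -[_^-1 * _ * _]mulrA !qintK !exprS.
have w0 : v ^+ n != 0 by rewrite expf_neq0.
by move: (v ^+ n) w0 => w w0; field; rewrite v0 w0.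
Qed.

Lemma qintSr n : qint v n.+1 = v ^- n + v * qint v n.
Proof.
apply: (mulIf vv0); rewrite mulrDl -[v * _ * _]mulrA !qintK !exprS.
have w0 : v ^+ n != 0 by rewrite expf_neq0.
by move: (v ^+ n) w0 => w w0; field; rewrite v0 w0.
Qed.

(** Each of the m+1 factors x contributes one g; collecting them on the left
    gives the powers 1, v^2, up to v^(2m), with sum v^m [m+1]. *)
Lemma mul_expr_left (F x g : A) m :
  F * x = x * F + g -> g * x = v ^- 2 *: (x * g) ->
  F * x ^+ m.+1 = x ^+ m.+1 * F + (v ^+ m * qint v m.+1) *: (g * x ^+ m).
Proof.
move=> Fx gx.
have xg n : x ^+ n * g = v ^+ n.*2 *: (g * x ^+ n).
  elim: n => [|n IH]; first by rewrite mul1r mulr1 scale1r.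
  have xg1 : x * g = v ^+ 2 *: (g * x) by rewrite gx scalerA divff ?expf_neq0 // scale1r.
  rewrite exprSr -(mulrA _ x g) xg1 -scalerAr (mulrA _ g x) IH -scalerAl scalerA.
  by rewrite -exprD -mulrA.
elim: m => [|m IH]; first by rewrite !expr1 expr0 mulr1 mul1r Fx qint1 scale1r.
have XS : x ^+ m * x = x ^+ m.+1 by rewrite exprSr.
have := xg m.+1; move: XS IH; rewrite (exprSr x m.+1); move: (x ^+ m.+1) => X XS IH Xg.
rewrite mulrA IH mulrDl -(mulrA X) Fx mulrDr mulrA -scalerAl -(mulrA g) XS Xg -addrA.
congr (_ + _); rewrite -scalerDl; congr (_ *: _).
rewrite [qint v m.+2]qintSl mulrDr -exprD addnn; congr (_ + _).
by rewrite (mulrA _ v^-1) [v ^+ m.+1]exprSr mulfK.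
Qed.

Lemma mul_expr_right (F y g : A) m :
  F * y = y * F + g -> g * y = v ^+ 2 *: (y * g) ->
  F * y ^+ m.+1 = y ^+ m.+1 * F + (v ^+ m * qint v m.+1) *: (y ^+ m * g).
Proof.
move=> Fy gy.
elim: m => [|m IH]; first by rewrite !expr1 expr0 mul1r mul1r Fy qint1 scale1r.
have YS : y ^+ m * y = y ^+ m.+1 by rewrite exprSr.
move: YS IH; rewrite (exprSr y m.+1); move: (y ^+ m.+1) => Y YS IH.
rewrite mulrA IH mulrDl -(mulrA Y) Fy mulrDr mulrA -scalerAl -(mulrA _ g) gy -scalerAr.
rewrite scalerA (mulrA _ y g) YS -addrA.
congr (_ + _); rewrite -[X in X + _]scale1r -scalerDl; congr (_ *: _).
rewrite [qint v m.+2]qintSr mulrDr divff ?expf_neq0 //; congr (_ + _).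
by rewrite [v ^+ m.+1]exprSr; move: (qint v m.+1) => q; ring.
Qed.

End QPowers.

(** * Normal forms in the Drinfeld double *)

Notation uf0 := (NGen 0).
Notation uf1 := (NGen 1).
Notation uf2 := (NGen 2).
Notation ue0 := (NGen 3).
Notation ue1 := (NGen 4).
Notation ue2 := (NGen 5).
Notation uh1 := (NGen 6).
Notation uh2 := (NGen 7).
Notation ul1 := (NGen 8).
Notation ul2 := (NGen 9).
Notation ul0 := (NGen 10).
Notation uk1 := (NGen 11).
Notation uk2 := (NGen 12).

(** The q-integer [a], for the four values of a that occur in the Cartan matrix
    up to sign. *)
Definition lqint (a : int) : seq (int * int) :=
  match a with
  | Posz 2 => lq2
  | Posz 1 => [:: (0, 1)]
  | Negz 0 => [:: (0, -1)]
  | Negz 1 => [:: (1, -1); (-1, -1)]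
  | _ => [::]
  end.

(** The letters F_i and E_i with the exponents by which K_0, K_1, K_2 commute
    past them. *)
Definition root_letters : seq (nat * (int * int * int)) :=
  [:: (0%N, (-2, 1, 1)); (1%N, (1, -2, 1)); (2%N, (1, 1, -2));
      (3%N, (2, -1, -1)); (4%N, (-1, 2, -1)); (5%N, (-1, -1, 2))].

(** The element h_i = [E_i, F_i] is a letter of its own, to which K_i is
    eliminated.  This keeps the denominator v - 1/v out of the rules:
    h_i x = v^a x h_i + [a] x K_i' for x of weight a. *)
Definition hrule (z l x : nat) (a : int) : rule :=
  mkrule [:: z; x] (NAdd (NMul (NCst (vpow a)) (NMul (NGen x) (NGen z)))
                         (NMul (NCst (lqint a)) (NMul (NGen x) (NGen l)))).
Definition lrule (l x : nat) (a : int) : rule :=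
  mkrule [:: l; x] (NMul (NCst (vpow (- a))) (NMul (NGen x) (NGen l))).

Definition U_torus_rules : seq rule :=
  [seq hrule 6 8 t.1 t.2.1.2 | t <- root_letters] ++
  [seq hrule 7 9 t.1 t.2.2 | t <- root_letters] ++
  [seq lrule 8 t.1 t.2.1.2 | t <- root_letters] ++
  [seq lrule 9 t.1 t.2.2 | t <- root_letters] ++
  [seq lrule 10 t.1 t.2.1.1 | t <- root_letters] ++
  [seq mkrule [:: t.1; t.2] (NMul (NGen t.2) (NGen t.1))
  | t <- [:: (7, 6); (8, 6); (9, 6); (10, 6); (8, 7); (9, 7); (10, 7);
             (9, 8); (10, 8); (10, 9)]%N].

Local Open Scope nexp_scope.

Definition rule_xyy (x y : nat) : rule :=
  let: (X, Y) := (NGen x, NGen y) in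
  mkrule [:: x; y; y] (lq2 *: (Y * X * Y) - Y * Y * X).
Definition rule_xxy (x y : nat) : rule :=
  let: (X, Y) := (NGen x, NGen y) in
  mkrule [:: x; x; y] (lq2 *: (X * Y * X) - Y * X * X).

Definition U_base_rules : seq rule :=
  [:: mkrule [:: 4; 1] (uf1 * ue1 + uh1); mkrule [:: 5; 2] (uf2 * ue2 + uh2);
      mkrule [:: 4; 2] (uf2 * ue1); mkrule [:: 5; 1] (uf1 * ue2);
      mkrule [:: 4; 0] (uf0 * ue1); mkrule [:: 5; 0] (uf0 * ue2);
      mkrule [:: 3; 1] (uf1 * ue0); mkrule [:: 3; 2] (uf2 * ue0);
      mkrule [:: 11] (ul1 + ldelta *: uh1); mkrule [:: 12] (ul2 + ldelta *: uh2);
      rule_xyy 5 4; rule_xxy 5 4; rule_xyy 2 1; rule_xxy 2 1;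
      rule_xxy 4 3; rule_xxy 5 3; rule_xxy 1 0; rule_xxy 2 0] ++ U_torus_rules.

(** Two consequences of the Serre relations, obtained by resolving overlaps of the
    words above, as in Knuth-Bendix completion. *)
Definition rule_112 (x y z : nat) : rule :=
  let: (X, Y, Z) := (NGen x, NGen y, NGen z) in
  mkrule [:: x; x; y; z]
    (lq2 *: (X * Y * X * Z) - lq2 *: (Y * X * Z * X) + Y * Z * X * X).
Definition rule_1212 (x y z : nat) : rule :=
  let: (X, Y, Z) := (NGen x, NGen y, NGen z) in
  mkrule [:: x; y; x; y; z]
    (Z * X * Y * X * Y - Z * Y * X * Y * X - lq2 *: (X * Z * Y * X * Y)
     + lq2 *: (X * Y * Z * Y * X) + lq2 *: (X * Y * X * Z * Y)
     + lq2 *: (Y * Z * X * Y * X) - lq2 *: (Y * X * Z * X * Y)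
     - lq2 *: (Y * X * Y * Z * X) + Y * X * Y * X * Z).

Definition U_rules : seq rule :=
  [:: rule_1212 4 5 3; rule_1212 1 2 0; rule_112 4 5 3; rule_112 1 2 0] ++ U_base_rules.

Local Close Scope nexp_scope.

Section DrinfeldDoubleRelations.
Variables (k : fieldType) (v : k).
Local Notation E := (uE v).
Local Notation F := (uF v).
Local Notation K := (uK v).
Local Notation K' := (uK' v).

Definition uH (i : 'I_3) : U v := (v - v^-1)^-1 *: (K i - K' i).

Lemma uKE i j : K i * E j = v ^ cartan i j *: (E j * K i).
Proof. by rewrite -!clsM -clsZ; apply/cls_rel/U_KE. Qed.

Lemma uKF i j : K i * F j = v ^ (- cartan i j) *: (F j * K i).
Proof. by rewrite -!clsM -clsZ; apply/cls_rel/U_KF. Qed.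

Lemma uK'E i j : K' i * E j = v ^ (- cartan i j) *: (E j * K' i).
Proof. by rewrite -!clsM -clsZ; apply/cls_rel/U_K'E. Qed.

Lemma uK'F i j : K' i * F j = v ^ cartan i j *: (F j * K' i).
Proof. by rewrite -!clsM -clsZ; apply/cls_rel/U_K'F. Qed.

Lemma uKK i j : K i * K j = K j * K i.
Proof. by rewrite -!clsM; apply/cls_rel/U_KK. Qed.

Lemma uKK' i j : K i * K' j = K' j * K i.
Proof. by rewrite -!clsM; apply/cls_rel/U_KK'. Qed.

Lemma uK'K' i j : K' i * K' j = K' j * K' i.
Proof. by rewrite -!clsM; apply/cls_rel/U_K'K'. Qed.

Lemma uKKinv i : K i * uKinv v i = 1.
Proof. by rewrite -!clsM; apply/cls_rel/U_KKinv. Qed.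

Lemma uKinvK i : uKinv v i * K i = 1.
Proof. by rewrite -!clsM; apply/cls_rel/U_KinvK. Qed.

Lemma uK'K'inv i : K' i * uK'inv v i = 1.
Proof. by rewrite -!clsM; apply/cls_rel/U_K'K'inv. Qed.

Lemma uK'invK' i : uK'inv v i * K' i = 1.
Proof. by rewrite -!clsM; apply/cls_rel/U_K'invK'. Qed.

Lemma uEF_neq i j : i != j -> E i * F j = F j * E i.
Proof. by move=> ij; rewrite U_EFE (negPf ij) addr0. Qed.

Lemma uEF_eq i : E i * F i = F i * E i + uH i.
Proof. by rewrite U_EFE eqxx. Qed.

Lemma u_serreE i j : i != j ->
  E i * E i * E j - qint v 2 *: (E i * E j * E i) + E j * E i * E i = 0.
Proof.
move=> ij; have := cls_rel (U_serreE v ij).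
by rewrite !(clsD, clsZ, clsN, clsM, cls0).
Qed.

Lemma u_serreF i j : i != j ->
  F i * F i * F j - qint v 2 *: (F i * F j * F i) + F j * F i * F i = 0.
Proof.
move=> ij; have := cls_rel (U_serreF v ij).
by rewrite !(clsD, clsZ, clsN, clsM, cls0).
Qed.

Lemma uHH i j : uH i * uH j = uH j * uH i.
Proof.
rewrite /uH -!scalerAl -!scalerAr !mulrBl !mulrBr; congr (_ *: (_ *: _)).
rewrite (uKK i j) (uKK' i j) -(uKK' j i) (uK'K' i j) !opprD !opprK !addrA.
by congr (_ + _); apply: addrAC.
Qed.

Lemma uK'H i j : K' i * uH j = uH j * K' i.
Proof. by rewrite /uH -scalerAl -scalerAr mulrBl mulrBr uKK' (uK'K' i). Qed.

End DrinfeldDoubleRelations.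

Section DrinfeldDoubleRules.
Variables (k : fieldType) (v : k) (v0 : v != 0) (vn : forall n, v ^+ n.+1 != 1).
Local Notation E := (uE v).
Local Notation F := (uF v).
Local Notation K := (uK v).
Local Notation K' := (uK' v).

Definition uval : nat -> U v :=
  nth 0 [:: F 0; F 1; F 2; E 0; E 1; E 2; uH v 1; uH v 2; K' 1; K' 2; K' 0; K 1; K 2].
Local Notation neval := (neval v uval).
Local Notation sound := (sound v uval).
Local Notation all_sound := (all_sound v uval).

Lemma laurent_lqint a : a \in [:: 2; 1; -1; -2] ->
  laurent v (lqint a) * (v - v^-1) = v ^ a - v ^ (- a).
Proof.
have vv : v * v^-1 = 1 by rewrite divff.
rewrite !inE /laurent => /or4P[] /eqP-> /=; rewrite ?big_cons ?big_nil /=.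
- rewrite !mul1r addr0 -[v ^ -1]/(v^-1) expr1z -[v ^ 2]/(v ^+ 2) -[v ^ -2]/(v ^- 2).
  by field.
- by rewrite !mul1r addr0 expr0z mul1r.
- by rewrite expr0z mulr1 addr0 mulN1r opprB.
- rewrite mulrN1z !mulN1r addr0 -[v ^ -1]/(v^-1) expr1z.
  by rewrite -[v ^ 2]/(v ^+ 2) -[v ^ -2]/(v ^- 2); field.
Qed.

Lemma sound_hrule z l (i : 'I_3) x a : a \in [:: 2; 1; -1; -2] ->
  uval z = uH v i -> uval l = K' i ->
  K i * uval x = v ^ a *: (uval x * K i) ->
  K' i * uval x = v ^ (- a) *: (uval x * K' i) ->
  sound (hrule z l x a).
Proof.
move=> aP hE lE Kx K'x; apply/(sound_mkrule v0).
rewrite evalw2 neval_add !neval_scale !neval_mul !neval_gen laurent_vpow hE lE /uH.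
rewrite -scalerAl mulrBl Kx K'x -[uval x * (_ *: _)]scalerAr.
rewrite [v ^ a *: (_ *: _)]scalerA [v ^ a * _^-1]mulrC -[(_ * v ^ a) *: _]scalerA.
rewrite mulrBr [v ^ a *: (_ - _)]scalerBr.
have -> : laurent v (lqint a) = (v - v^-1)^-1 * (v ^ a - v ^ (- a)).
  by rewrite -laurent_lqint // mulrC mulfK ?vv_neq0.
rewrite -[((v - v^-1)^-1 * (_ - _)) *: _]scalerA -scalerDr; congr (_ *: _).
by rewrite scalerBl addrA subrK.
Qed.

Lemma sound_lrule l x a : uval l * uval x = v ^ (- a) *: (uval x * uval l) ->
  sound (lrule l x a).
Proof.
by move=> lx; apply/(sound_mkrule v0); rewrite evalw2 neval_scale neval_mul laurent_vpow.
Qed.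

Lemma U_torus_sound : all_sound U_torus_rules.
Proof.
rewrite /U_torus_rules; repeat apply: all_sound_cat.
- do 3!(apply: conj; first by [apply: (@sound_hrule _ _ 1); rewrite ?uKF ?uK'F]).
  by do 3!(apply: conj; first by [apply: (@sound_hrule _ _ 1); rewrite ?uKE ?uK'E]).
- do 3!(apply: conj; first by [apply: (@sound_hrule _ _ 2); rewrite ?uKF ?uK'F]).
  by do 3!(apply: conj; first by [apply: (@sound_hrule _ _ 2); rewrite ?uKE ?uK'E]).
- by do 6!(apply: conj; first by [apply: sound_lrule; rewrite /= ?uK'F ?uK'E]).
- by do 6!(apply: conj; first by [apply: sound_lrule; rewrite /= ?uK'F ?uK'E]).
- by do 6!(apply: conj; first by [apply: sound_lrule; rewrite /= ?uK'F ?uK'E]).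
- by do 10!(apply: conj; first by [apply/(sound_mkrule v0);
    rewrite neval_mul evalw2 !neval_gen /=;
    first [exact: uHH | exact: uK'H | exact: uK'K']]).
Qed.

Lemma evalw3 x y z : evalw uval [:: x; y; z] = uval x * uval y * uval z.
Proof. by rewrite evalw_cons evalw2 mulrA. Qed.

Lemma sound_xxy x y :
  uval x * uval x * uval y - qint v 2 *: (uval x * uval y * uval x)
    + uval y * uval x * uval x = 0 -> sound (rule_xxy x y).
Proof.
move=> e; apply/(sound_mkrule v0); rewrite evalw3 neval_sub neval_scale !neval_mul.
rewrite !neval_gen (laurent_lq2 v0 vn); apply/eqP.
by rewrite -subr_eq0 opprB [uval y * _ * _ - _]addrC addrA e.
Qed.

Lemma sound_xyy x y :
  uval y * uval y * uval x - qint v 2 *: (uval y * uval x * uval y)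
    + uval x * uval y * uval y = 0 -> sound (rule_xyy x y).
Proof.
move=> e; apply/(sound_mkrule v0); rewrite evalw3 neval_sub neval_scale !neval_mul.
by rewrite !neval_gen (laurent_lq2 v0 vn); apply/eqP; rewrite -subr_eq0 opprB addrC e.
Qed.

Lemma sound_EF a c i j : i != j -> uval a = E i -> uval c = F j ->
  sound (mkrule [:: a; c] (NMul (NGen c) (NGen a))).
Proof.
move=> ij aE cE; apply/(sound_mkrule v0).
by rewrite evalw2 neval_mul !neval_gen aE cE uEF_neq.
Qed.

Lemma uK_H i : K i = K' i + (v - v^-1) *: uH v i.
Proof. by rewrite /uH scalerA divff ?vv_neq0 // scale1r addrC subrK. Qed.

Lemma U_base_sound : all_sound U_base_rules.
Proof.
apply: all_sound_cat U_torus_sound.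
do 2!(apply: conj; first by [apply/(sound_mkrule v0);
  rewrite evalw2 neval_add neval_mul !neval_gen; apply: uEF_eq]).
apply: conj; first exact: (@sound_EF _ _ 1 2).
apply: conj; first exact: (@sound_EF _ _ 2 1).
apply: conj; first exact: (@sound_EF _ _ 1 0).
apply: conj; first exact: (@sound_EF _ _ 2 0).
apply: conj; first exact: (@sound_EF _ _ 0 1).
apply: conj; first exact: (@sound_EF _ _ 0 2).
do 2!(apply: conj; first by [apply/(sound_mkrule v0);
  rewrite /evalw big_seq1 neval_add neval_scale !neval_gen laurent_delta; apply: uK_H]).
apply: conj; first by [apply/sound_xyy/u_serreE].
apply: conj; first by [apply/sound_xxy/u_serreE].
apply: conj; first by [apply/sound_xyy/u_serreF].
apply: conj; first by [apply/sound_xxy/u_serreF].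
do 2!(apply: conj; first by [apply/sound_xxy/u_serreE]).
by do 2!(apply: conj; first by [apply/sound_xxy/u_serreF]).
Qed.

Lemma uval_serre x y z :
  uval y * uval y * uval x - qint v 2 *: (uval y * uval x * uval y)
    + uval x * uval y * uval y = 0 -> neval (nserre (NGen x) (NGen y) z) = 0.
Proof.
rewrite (neval_nserre v0 vn) !neval_gen !mulrA => e.
have sw (a b c : U v) : a - b + c = c - b + a by rewrite addrC addrCA addrC.
by rewrite sw scalerAl -mulrBl -mulrDl e mul0r.
Qed.

Lemma U_sound : all_sound U_rules.
Proof.
have cons r rs : all_sound rs -> sound r -> all_sound (r :: rs) by [].
have sE z : neval (nserre ue2 ue1 z) = 0 by apply/uval_serre/u_serreE.
have sF z : neval (nserre uf2 uf1 z) = 0 by apply/uval_serre/u_serreF.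
have c1 : laurent v (vpow 0) != 0 by apply: laurent_unit.
have c2 := laurent_lq2_neq0 v0 vn.
have a0 := U_base_sound.
have a1 : all_sound (rule_112 1 2 0 :: U_base_rules).
  by apply: cons => //; apply: (derive_rule v0 (n := 100) a0 c1 (sF uf0)); vm_compute.
have a2 : all_sound [:: rule_112 4 5 3, rule_112 1 2 0 & U_base_rules].
  by apply: cons => //; apply: (derive_rule v0 (n := 100) a1 c1 (sE ue0)); vm_compute.
have a3 : all_sound
    [:: rule_1212 1 2 0, rule_112 4 5 3, rule_112 1 2 0 & U_base_rules].
  apply: cons => //; apply: (derive_rule v0 (n := 100) a2 c2
    (neval_scale_eq0 [:: (0, -1)] (sF (NMul uf2 uf0)))); by vm_compute.
apply: cons => //; apply: (derive_rule v0 (n := 100) a3 c2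
  (neval_scale_eq0 [:: (0, -1)] (sE (NMul ue2 ue0)))); by vm_compute.
Qed.

Lemma U_normal s t : nf U_rules 100 s = nf U_rules 100 t -> neval s = neval t.
Proof. exact: (neval_eq v0 U_sound). Qed.

End DrinfeldDoubleRules.

(** * Intertwining by the quasi K-matrix *)

Local Open Scope nexp_scope.

Definition nx : nexp := nqcomm (vpow (-1)) ue1 ue2.
Definition ny : nexp := nqcomm (vpow (-1)) ue2 ue1.
Definition nKK1 : nexp := uk1 * ul2.
Definition nKK2 : nexp := uk2 * ul1.
Definition nB1 : nexp := uf1 + ue2 * ul1.
Definition nB2 : nexp := uf2 + ue1 * ul2.
Definition nBbar1 : nexp := uf1 + vpow (-1) *: (ue2 * uk1).
Definition nBbar2 : nexp := uf2 + vpow (-1) *: (ue1 * uk2).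
Definition nf_theta : nexp :=
  nqcomm (vpow 1) uf2
    (nqcomm (vpow 1) (nqcomm (vpow 1) uf1 uf2) (nqcomm (vpow 1) uf1 uf0)).
Definition ne_theta : nexp :=
  nqcomm (vpow (-1))
    (nqcomm (vpow (-1)) (nqcomm (vpow (-1)) ue0 ue1) (nqcomm (vpow (-1)) ue2 ue1)) ue2.

Local Close Scope nexp_scope.

Section Intertwining.
Variables (k : fieldType) (v : k) (v0 : v != 0) (vn : forall n, v ^+ n.+1 != 1).
Local Notation E := (uE v).
Local Notation F := (uF v).
Local Notation K := (uK v).
Local Notation K' := (uK' v).
Local Notation hat := (@to_Uhat k v).
Let normal := U_normal v0 vn.

Definition intertwines (a b : U v) : Prop := hat a * Upsilon v = Upsilon v * hat b.

Lemma intertwinesD a b c d :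
  intertwines a b -> intertwines c d -> intertwines (a + c) (b + d).
Proof.
move=> ab cd; rewrite /intertwines /to_Uhat !chatD mulrDl mulrDr.
by rewrite [chat _ a * _]ab [chat _ c * _]cd.
Qed.

Lemma intertwinesM a b c d :
  intertwines a b -> intertwines c d -> intertwines (a * c) (b * d).
Proof.
move=> ab cd; rewrite /intertwines /to_Uhat !chatM -mulrA [chat _ c * _]cd.
by rewrite mulrA [chat _ a * _]ab mulrA.
Qed.

Lemma intertwinesN a b : intertwines a b -> intertwines (- a) (- b).
Proof.
by move=> ab; rewrite /intertwines /to_Uhat !chatN mulNr mulrN [chat _ a * _]ab.
Qed.

Lemma intertwines1 : intertwines 1 1.
Proof. by rewrite /intertwines /to_Uhat chat1 mul1r mulr1. Qed.

Lemma intertwinesV a b a' b' :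
  a' * a = 1 -> b * b' = 1 -> intertwines a b -> intertwines a' b'.
Proof.
have hM x y : hat (x * y) = hat x * hat y := chatM _ x y.
have h1 : hat 1 = 1 := chat1 _.
move=> aa bb ab; rewrite /intertwines -[LHS]mulr1 -h1 -bb hM mulrA -(mulrA (hat a')) -ab.
by rewrite (mulrA (hat a')) -hM aa h1 mul1r.
Qed.

(** For an [a] of weight c on E_1 and c^-1 on E_2, which therefore commutes with
    both root vectors. *)
Lemma intertwines_weight (c : k) (a : U v) : c != 0 ->
  a * E 1 = c *: (E 1 * a) -> a * E 2 = c^-1 *: (E 2 * a) -> intertwines a a.
Proof.
move=> c0 a1 a2.
have a12 : a * (E 1 * E 2) = E 1 * E 2 * a.
  rewrite mulrA a1 -scalerAl -(mulrA _ a) a2 -scalerAr scalerA divff // scale1r.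
  by rewrite mulrA.
have a21 : a * (E 2 * E 1) = E 2 * E 1 * a.
  rewrite mulrA a2 -scalerAl -(mulrA _ a) a1 -scalerAr scalerA mulVf // scale1r.
  by rewrite mulrA.
have term i j m : a * (E i * E j) = E i * E j * a -> a * (E j * E i) = E j * E i * a ->
    a * upsilon_term v i j m = upsilon_term v i j m * a.
  move=> aij aji; rewrite /upsilon_term -scalerAr -scalerAl; congr (_ *: _).
  by apply: commrX; rewrite /GRing.comm mulrBr mulrBl -scalerAr -scalerAl aij aji.
rewrite /intertwines /Upsilon mulrA.
rewrite (csum_termwise _ (fun m => term 1 2 m a12 a21)) -!mulrA; congr (_ * _).
exact: (csum_termwise _ (fun m => term 2 1 m a21 a12)).
Qed.

Lemma intertwines_comm a : a * E 1 = E 1 * a -> a * E 2 = E 2 * a -> intertwines a a.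
Proof.
by move=> a1 a2; apply: (@intertwines_weight 1); rewrite ?oner_eq0 // ?invr1 scale1r.
Qed.

Lemma intertwinesZ c a b : intertwines a b -> intertwines (c *: a) (c *: b).
Proof.
move=> ab; rewrite -[a]mul1r -[b]mul1r !scalerAl; apply: intertwinesM => //.
by apply: intertwines_comm; rewrite -scalerAl -scalerAr mul1r mulr1.
Qed.

Lemma intertwines_qcomm l a b c d :
  intertwines a b -> intertwines c d -> intertwines (qcomm l a c) (qcomm l b d).
Proof.
by move=> ab cd; apply: intertwinesD; [|apply/intertwinesN/intertwinesZ];
  apply: intertwinesM.
Qed.

Lemma intertwines_braid_poly x1 x2 x0 y1 y2 z1 z2 z0 w1 w2 :
  intertwines x1 z1 -> intertwines x2 z2 -> intertwines x0 z0 ->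
  intertwines y1 w1 -> intertwines y2 w2 ->
  intertwines (braid_poly v x1 x2 x0 y1 y2) (braid_poly v z1 z2 z0 w1 w2).
Proof.
move=> h1 h2 h0 k1 k2; apply: intertwinesD; first apply: intertwinesD.
- by apply: intertwinesZ; do !apply: intertwines_qcomm => //.
- by apply/intertwinesN/intertwinesM => //; do !apply: intertwines_qcomm => //.
- by apply/intertwinesZ/intertwinesM => //; apply: intertwinesM.
Qed.

Lemma qfactS m : qfact v m.+1 = qfact v m * qint v m.+1.
Proof. by rewrite /qfact big_nat_recr. Qed.

Lemma qfact_neq0 m : qfact v m != 0.
Proof.
elim: m => [|m IH]; first by rewrite /qfact big_nil oner_eq0.
by rewrite qfactS mulf_neq0 // qint_neq0.
Qed.

Definition upsilon_coef m : k := v ^- (m * m.-1)./2 * (-1) ^+ m / qfact v m.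

(** The q-difference equation of the q-exponential.  Moving F_i past the term of
    degree m+1 produces v^m [m+1] g x^m ([mul_expr_left]), so it produces minus
    g times the term of degree m. *)
Lemma upsilon_coefS m : upsilon_coef m.+1 * (v ^+ m * qint v m.+1) = - upsilon_coef m.
Proof.
rewrite /upsilon_coef qfactS exprS.
have -> : ((m.+1 * m)./2 = (m * m.-1)./2 + m)%N by rewrite -!bin2 binS bin1.
have q0 := qint_neq0 v0 vn m; have f0 := qfact_neq0 m.
have w0 : v ^+ m != 0 by rewrite expf_neq0.
have u0 : v ^+ (m * m.-1)./2 != 0 by rewrite expf_neq0.
rewrite exprD; move: (v ^+ (m * m.-1)./2) (v ^+ m) (qint v m.+1) (qfact v m) ((-1) ^+ m)
  w0 u0 q0 f0.
by move=> u w q f e *; field; apply/and4P.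
Qed.

Lemma upsilon_left i j g :
  F i * qcomm v^-1 (E i) (E j) = qcomm v^-1 (E i) (E j) * F i + g ->
  g * qcomm v^-1 (E i) (E j) = v ^- 2 *: (qcomm v^-1 (E i) (E j) * g) ->
  hat (F i + g) * csum (upsilon_term_null v i j) = csum (upsilon_term_null v i j) * hat (F i).
Proof.
move=> Fx gx; rewrite /to_Uhat chatD mulrDl (@csum_intertwine _ _ _ _ _ (F i) (- g) 1).
- by rewrite chat1 mulr1 chatN mulNr subrK.
- by rewrite /upsilon_term expr0 -scalerAr -scalerAl [F i * 1]mulr1 [1 * F i]mul1r.
move=> m; rewrite mulr1 /upsilon_term -/(upsilon_coef m) -/(upsilon_coef m.+1).
rewrite -scalerAr (mul_expr_left v0 vn m Fx gx) scalerDr -scalerAl scalerA upsilon_coefS.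
by rewrite scaleNr mulNr -scalerAr.
Qed.

Lemma upsilon_right i j g :
  F i * qcomm v^-1 (E j) (E i) = qcomm v^-1 (E j) (E i) * F i - g ->
  g * qcomm v^-1 (E j) (E i) = v ^+ 2 *: (qcomm v^-1 (E j) (E i) * g) ->
  hat (F i) * csum (upsilon_term_null v j i) = csum (upsilon_term_null v j i) * hat (F i + g).
Proof.
move=> Fy gy; rewrite /to_Uhat chatD mulrDr (@csum_intertwine _ _ _ _ _ (F i) 1 g).
- by rewrite chat1 mul1r.
- by rewrite /upsilon_term expr0 -scalerAr -scalerAl [F i * 1]mulr1 [1 * F i]mul1r.
have gy' : - g * qcomm v^-1 (E j) (E i) = v ^+ 2 *: (qcomm v^-1 (E j) (E i) * - g).
  by rewrite mulNr gy mulrN scalerN.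
move=> m; rewrite mul1r /upsilon_term -/(upsilon_coef m) -/(upsilon_coef m.+1).
rewrite -scalerAr (mul_expr_right v0 vn m Fy gy') scalerDr -scalerAl scalerA upsilon_coefS.
by rewrite scaleNr mulrN scalerN opprK -scalerAl.
Qed.

Lemma intertwines_B1 : intertwines (F 1 + E 2 * K' 1) (F 1 + v^-1 *: (E 2 * K 1)).
Proof.
rewrite /intertwines /Upsilon mulrA upsilon_left; first last.
- by by_normal normal (NMul (NMul ue2 ul1) nx)
    (NMul (NCst (vpow (-2))) (NMul nx (NMul ue2 ul1))).
- by by_normal normal (NMul uf1 nx) (NAdd (NMul nx uf1) (NMul ue2 ul1)).
rewrite -mulrA (upsilon_right (g := v^-1 *: (E 2 * K 1))) ?mulrA //.
- by by_normal normal (NMul uf1 ny)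
    (nsub (NMul ny uf1) (NMul (NCst (vpow (-1))) (NMul ue2 uk1))).
- by by_normal normal (NMul (NMul (NCst (vpow (-1))) (NMul ue2 uk1)) ny)
    (NMul (NCst (vpow 2)) (NMul ny (NMul (NCst (vpow (-1))) (NMul ue2 uk1)))).
Qed.

Lemma Upsilon_sym :
  Upsilon v = csum (upsilon_term_null v 2 1) * csum (upsilon_term_null v 1 2).
Proof.
have xy : GRing.comm (qcomm v^-1 (E 1) (E 2)) (qcomm v^-1 (E 2) (E 1)).
  by rewrite /GRing.comm; by_normal normal (NMul nx ny) (NMul ny nx).
apply: csum_comm => m n.
rewrite /upsilon_term -!scalerAl -!scalerAr !scalerA [X in X *: _]mulrC.
by congr (_ *: _); apply/commrX/commr_sym/commrX/commr_sym.
Qed.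

Lemma intertwines_B2 : intertwines (F 2 + E 1 * K' 2) (F 2 + v^-1 *: (E 1 * K 2)).
Proof.
rewrite /intertwines Upsilon_sym mulrA upsilon_left; first last.
- by by_normal normal (NMul (NMul ue1 ul2) ny)
    (NMul (NCst (vpow (-2))) (NMul ny (NMul ue1 ul2))).
- by by_normal normal (NMul uf2 ny) (NAdd (NMul ny uf2) (NMul ue1 ul2)).
rewrite -mulrA (upsilon_right (g := v^-1 *: (E 1 * K 2))) ?mulrA //.
- by by_normal normal (NMul uf2 nx)
    (nsub (NMul nx uf2) (NMul (NCst (vpow (-1))) (NMul ue1 uk2))).
- by by_normal normal (NMul (NMul (NCst (vpow (-1))) (NMul ue1 uk2)) nx)
    (NMul (NCst (vpow 2)) (NMul nx (NMul (NCst (vpow (-1))) (NMul ue1 uk2)))).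
Qed.

Lemma intertwines_torus j : j != 0 -> intertwines (K j * K' (tau j)) (K j * K' (tau j)).
Proof.
have KE i i' l : K i * K' i' * E l =
    v ^ (cartan i l - cartan i' l) *: (E l * (K i * K' i')).
  rewrite -mulrA uK'E -scalerAr (mulrA (K i)) uKE -scalerAl scalerA mulrA.
  by rewrite -expfzDr // addrC.
move=> j0; apply: (@intertwines_weight (v ^ (cartan j 1 - cartan (tau j) 1))).
- by rewrite expfz_neq0.
- exact: KE.
- by rewrite KE invr_expz; congr (_ ^ _ *: _); elim/I3P: j j0.
Qed.

Lemma intertwines_K0 : intertwines (K 0 * K' 0) (K 0 * K' 0).
Proof.
have KE l : K 0 * K' 0 * E l = E l * (K 0 * K' 0).
  rewrite -mulrA uK'E -scalerAr (mulrA (K 0)) uKE -scalerAl scalerA mulrA.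
  by rewrite -expfzDr // addNr expr0z scale1r.
exact: intertwines_comm.
Qed.

Definition Bbar (j : 'I_3) : U v := F j + v^-1 *: (E (tau j) * K j).

Lemma intertwines_B j : j != 0 -> intertwines (F j + E (tau j) * K' j) (Bbar j).
Proof. by elim/I3P: j => // _; [apply: intertwines_B1|apply: intertwines_B2]. Qed.

(** Root vectors of weight -a and a, where a = a_0 + 2a_1 + 2a_2; the inverse of
    T_1 T_2 T_1 sends F_0 and E_0 to them. *)
Definition f_theta : U v :=
  qcomm v (F 2) (qcomm v (qcomm v (F 1) (F 2)) (qcomm v (F 1) (F 0))).
Definition e_theta : U v :=
  qcomm v^-1 (qcomm v^-1 (qcomm v^-1 (E 0) (E 1)) (qcomm v^-1 (E 2) (E 1))) (E 2).

Lemma braid_poly_F :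
  braid_poly v (Bbar 1) (Bbar 2) (F 0) (K 1 * K' 2) (K 2 * K' 1) = f_theta.
Proof. by by_normal normal (nbraid nBbar1 nBbar2 uf0 nKK1 nKK2) nf_theta. Qed.

Lemma braid_poly_E :
  braid_poly v (F 1 + E 2 * K' 1) (F 2 + E 1 * K' 2) (E 0 * K' 0) (K 1 * K' 2) (K 2 * K' 1)
  = v ^+ 2 *: (e_theta * (K' 0 * K' 1 * K' 1 * K' 2 * K' 2)).
Proof.
by by_normal normal (nbraid nB1 nB2 (NMul ue0 ul0) nKK1 nKK2)
  (NMul (NCst (vpow 2))
    (NMul ne_theta (NMul (NMul (NMul (NMul ul0 ul1) ul1) ul2) ul2))).
Qed.

Lemma braid_polyD x1 x2 x x' y1 y2 : braid_poly v x1 x2 (x + x') y1 y2 =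
  braid_poly v x1 x2 x y1 y2 + braid_poly v x1 x2 x' y1 y2 :> U v.
Proof.
have qD l (a c c' : U v) : qcomm l a (c + c') = qcomm l a c + qcomm l a c'.
  by rewrite /qcomm mulrDr mulrDl scalerDr opprD addrACA.
rewrite /braid_poly (qD v x1) (qD 1 x2 (qcomm v x1 x)) (qD 1 _ (qcomm 1 x2 _)).
rewrite (qD 1 (qcomm _ x1 x2) x).
move: (qcomm 1 _ (qcomm 1 x2 (qcomm v x1 x))) (qcomm 1 _ (qcomm 1 x2 (qcomm v x1 x'))).
move: (qcomm 1 _ x) (qcomm 1 _ x') => c c' a a'.
have sum6 (s s' t t' u u' : U v) :
    s + s' - (t + t') + (u + u') = s - t + u + (s' - t' + u').
  by rewrite opprD (addrACA s s') (addrACA (s - t)).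
by rewrite !mulrDl !scalerDr sum6.
Qed.

End Intertwining.

(** * The braid operators *)

Lemma inv_uniq (R : pzRingType) (a b c : R) : b * a = 1 -> a * c = 1 -> b = c.
Proof. by move=> ba ac; rewrite -[b]mulr1 -ac mulrA ba mul1r. Qed.

Lemma mulr_cancel (R : pzRingType) (x y z : R) : y * z = 1 -> x * y * z = x.
Proof. by move=> yz; rewrite -mulrA yz mulr1. Qed.

Lemma rmorph_inv_uniq (R S : pzRingType) (f : {rmorphism R -> S}) x x' y y' :
  x * x' = 1 -> y' * y = 1 -> f x = y -> f x' = y'.
Proof.
move=> xx yy fx; apply: esym; apply: (inv_uniq yy).
by rewrite -fx -rmorphM xx rmorph1.
Qed.

Section BraidOperators.
Variables (k : fieldType) (v : k) (v0 : v != 0) (vn : forall n, v ^+ n.+1 != 1).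
Local Notation E := (uE v).
Local Notation F := (uF v).
Local Notation K := (uK v).
Local Notation K' := (uK' v).
Local Notation Kinv := (uKinv v).
Local Notation K'inv := (uK'inv v).
Local Notation neval := (neval v (uval v)).
Let normal := U_normal v0 vn.

Definition nF (i : 'I_3) : nexp := NGen i.
Definition nE (i : 'I_3) : nexp := NGen (3 + i).
Definition nK (i : 'I_3) : nexp := NGen (10 + i).
Definition nK' (i : 'I_3) : nexp := NGen (7 + i).

Lemma neval_F i : neval (nF i) = F i. Proof. by elim/I3P: i. Qed.
Lemma neval_E i : neval (nE i) = E i. Proof. by elim/I3P: i. Qed.
Lemma neval_K i : i != 0 -> neval (nK i) = K i. Proof. by elim/I3P: i. Qed.
Lemma neval_K' i : i != 0 -> neval (nK' i) = K' i. Proof. by elim/I3P: i. Qed.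

Lemma uE_bracketF i j : i != 0 -> j != i ->
  E i * qcomm v (F j) (F i) = qcomm v (F j) (F i) * E i - v *: (F j * K i).
Proof.
move=> i0 ji; have : neval (nE i * nqcomm (vpow 1) (nF j) (nF i))%N' =
    neval (nqcomm (vpow 1) (nF j) (nF i) * nE i - vpow 1 *: (nF j * nK i))%N'.
  by apply: normal; elim/I3P: i i0 ji; elim/I3P: j => // _ _; vm_compute.
rewrite neval_sub neval_scale !neval_mul neval_qcomm !laurent_vpow.
by rewrite !neval_F neval_E neval_K // expr1z.
Qed.

Lemma uK_bracketF i j : i != 0 -> j != i ->
  K i * qcomm v (F j) (F i) = v^-1 *: (qcomm v (F j) (F i) * K i).
Proof.
move=> i0 ji; have : neval (nK i * nqcomm (vpow 1) (nF j) (nF i))%N' =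
    neval (vpow (-1) *: (nqcomm (vpow 1) (nF j) (nF i) * nK i))%N'.
  by apply: normal; elim/I3P: i i0 ji; elim/I3P: j => // _ _; vm_compute.
by rewrite neval_scale !neval_mul neval_qcomm !laurent_vpow !neval_F neval_K // expr1z.
Qed.

Lemma bracketE_uF i j : i != 0 -> j != i ->
  qcomm v^-1 (E i) (E j) * F i = F i * qcomm v^-1 (E i) (E j) - E j * K' i.
Proof.
move=> i0 ji; have : neval (nqcomm (vpow (-1)) (nE i) (nE j) * nF i)%N' =
    neval (nF i * nqcomm (vpow (-1)) (nE i) (nE j) - nE j * nK' i)%N'.
  by apply: normal; elim/I3P: i i0 ji; elim/I3P: j => // _ _; vm_compute.
rewrite neval_sub !neval_mul neval_qcomm !laurent_vpow.
by rewrite !neval_F !neval_E neval_K'.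
Qed.

Lemma uK'_bracketE i j : i != 0 -> j != i ->
  K' i * qcomm v^-1 (E i) (E j) = v^-1 *: (qcomm v^-1 (E i) (E j) * K' i).
Proof.
move=> i0 ji; have : neval (nK' i * nqcomm (vpow (-1)) (nE i) (nE j))%N' =
    neval (vpow (-1) *: (nqcomm (vpow (-1)) (nE i) (nE j) * nK' i))%N'.
  by apply: normal; elim/I3P: i i0 ji; elim/I3P: j => // _ _; vm_compute.
by rewrite neval_scale !neval_mul neval_qcomm !laurent_vpow !neval_E neval_K'.
Qed.

Variables (T : 'I_3 -> alg_aut (U v)) (TE : forall i, is_braid i (T i)).

(** The brackets in the other order are the values of the inverse of T_i. *)
Lemma T_bracketF i j : i != 0 -> j != i -> T i (qcomm v (F i) (F j)) = F j.
Proof.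
move=> i0 ji; have [_ _ _ TF /(_ _ ji)[_ _ _ TFj]] := TE i.
rewrite lrmorph_qcomm TF TFj; set Y := qcomm v (F j) (F i).
have EY : E i * Y = Y * E i - v *: (F j * K i) by apply: uE_bracketF.
have YK : Y * Kinv i = v^-1 *: (Kinv i * Y).
  rewrite -[LHS]mul1r -(uKinvK v i) -!mulrA (mulrA (K i)) uK_bracketF //.
  by rewrite -scalerAl -scalerAr -mulrA uKKinv mulr1.
have KF : Kinv i * (F j * K i) = v^-1 *: F j.
  have -> : F j * K i = v^-1 *: (K i * F j).
    rewrite uKF /cartan eq_sym (negPf ji) opprK expr1z scalerA mulVf // scale1r //.
  by rewrite -scalerAr mulrA uKinvK mul1r.
rewrite /qcomm mulNr mulrN scalerN opprK -mulrA EY mulrBr -scalerAr KF scalerA divff //.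
rewrite scale1r (mulrA Y) YK -scalerAl scalerA divff // scale1r mulrA.
by rewrite opprB addrC addrCA subrr addr0.
Qed.

Lemma T_bracketE i j : i != 0 -> j != i -> T i (qcomm v^-1 (E j) (E i)) = E j.
Proof.
move=> i0 ji; have [_ _ TEi _ /(_ _ ji)[_ _ TEj _]] := TE i.
rewrite lrmorph_qcomm TEi TEj; set X := qcomm v^-1 (E i) (E j).
have XF : X * F i = F i * X - E j * K' i by apply: bracketE_uF.
have KX : K'inv i * X = v *: (X * K'inv i).
  have XK : X * K' i = v *: (K' i * X).
    by rewrite uK'_bracketE // scalerA divff // scale1r.
  rewrite -[LHS]mulr1 -(uK'K'inv v i) -!mulrA (mulrA X) XK -scalerAl -scalerAr.
  by rewrite !mulrA uK'invK' mul1r.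
rewrite /qcomm mulrN mulNr scalerN opprK mulrA XF mulrBl -(mulrA (E j)) uK'K'inv mulr1.
by rewrite -(mulrA (F i) _ X) KX -scalerAr scalerA mulVf // scale1r opprB mulrA subrK.
Qed.

Lemma T_invE i j : i != 0 -> j != i -> aut_inv (T i) (E j) = qcomm v^-1 (E j) (E i).
Proof.
move=> i0 ji; apply: (can_inj (aut_funK (T i))).
by rewrite [LHS]aut_inv_funK T_bracketE.
Qed.

Lemma T_invF i j : i != 0 -> j != i -> aut_inv (T i) (F j) = qcomm v (F i) (F j).
Proof.
move=> i0 ji; apply: (can_inj (aut_funK (T i))).
by rewrite [LHS]aut_inv_funK T_bracketF.
Qed.

Lemma TT i j : i != 0 -> j != 0 -> i != j ->
  [/\ T i (T j (E i)) = E j, T i (T j (F i)) = F j,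
      T i (T j (K i)) = K j & T i (T j (K' i)) = K' j].
Proof.
move=> i0 j0 ij; have ji : j != i by rewrite eq_sym.
have [_ _ _ _ /(_ _ ij)[TjK TjK' TjE TjF]] := TE j.
have [TiK TiK' _ _ /(_ _ ji)[TiKj TiKj' _ _]] := TE i.
rewrite TjK TjK' TjE TjF !rmorphM /= TiK TiK' TiKj TiKj' T_bracketE // T_bracketF //.
split=> //; first by rewrite (uKK v i j) -mulrA uKKinv mulr1.
by rewrite (uK'K' v i j) -mulrA uK'K'inv mulr1.
Qed.

Definition long_braid : {lrmorphism U v -> U v} := T 1 \o T 2 \o T 1.
Local Notation W := long_braid.

Lemma W_letters i : i != 0 ->
  [/\ W (E i) = - (F (tau i) * K'inv (tau i)), W (F i) = - (Kinv (tau i) * E (tau i)),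
      W (K i) = Kinv (tau i) & W (K' i) = K'inv (tau i)].
Proof.
have [E12 F12 K12 K'12] := @TT 1 2 isT isT isT.
have [E21 F21 K21 K'21] := @TT 2 1 isT isT isT.
have [T1K T1K' T1E T1F _] := TE 1.
have Ki12 : T 1 (T 2 (Kinv 1)) = Kinv 2.
  exact: (rmorph_inv_uniq (f := T 1 \o T 2) (uKKinv v 1) (uKinvK v 2) K12).
have K'i12 : T 1 (T 2 (K'inv 1)) = K'inv 2.
  exact: (rmorph_inv_uniq (f := T 1 \o T 2) (uK'K'inv v 1) (uK'invK' v 2) K'12).
elim/I3P: i => // _; rewrite /W /=; last by rewrite E21 F21 K21 K'21.
split.
- by rewrite T1E !rmorphN !rmorphM /= F12 K'i12.
- by rewrite T1F !rmorphN !rmorphM /= E12 Ki12.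
- by rewrite T1K.
- by rewrite T1K'.
Qed.

Lemma W_inv_letters i : i != 0 -> W (Kinv i) = K (tau i) /\ W (K'inv i) = K' (tau i).
Proof.
move=> /W_letters[_ _ WK WK'].
by split; [apply: (rmorph_inv_uniq (uKKinv v i) _ WK)
          |apply: (rmorph_inv_uniq (uK'K'inv v i) _ WK')]; rewrite ?uKKinv ?uK'K'inv.
Qed.

Lemma W_K0 : W (K 0) = K 0 * (K 1 * K 2) ^+ 2 /\ W (K' 0) = K' 0 * (K' 1 * K' 2) ^+ 2.
Proof.
have sq (a b c : U v) : a * b = b * a -> c * a = a * c -> c * b = b * c ->
    b * (a * b * (a * c)) = c * (a * b) ^+ 2.
  move=> ab ca cb; have cab : GRing.comm c (a * b) by apply: commrM.
  by rewrite (commrX 2 cab) expr2 [in RHS]ab !mulrA.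
have [_ _ K12 K'12] := @TT 1 2 isT isT isT.
have [_ _ _ _ T1j] := TE 1.
have [T10 T10' _ _] := T1j 0 isT; have [T12 T12' _ _] := T1j 2 isT.
have [_ _ _ _ /(_ 0 isT)[T20 T20' _ _]] := TE 2.
split; rewrite /W /=.
- by rewrite T10 !rmorphM /= K12 T20 rmorphM /= T12 T10; apply: sq; exact: uKK.
- by rewrite T10' !rmorphM /= K'12 T20' rmorphM /= T12' T10'; apply: sq; exact: uK'K'.
Qed.

Lemma T1_inv_bracket : aut_inv (T 1) (qcomm v (F 2) (F 1)) = F 2 /\
  aut_inv (T 1) (qcomm v^-1 (E 1) (E 2)) = E 2.
Proof.
have [E21 F21 _ _] := @TT 2 1 isT isT isT.
by rewrite -[qcomm v _ _]T_invF // -[qcomm v^-1 _ _]T_invE // -{1}F21 -{1}E21 /= !aut_funK.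
Qed.

Lemma W_f_theta : W (f_theta v) = F 0.
Proof.
have [F21 _] := T1_inv_bracket.
have e : aut_inv (T 1) (aut_inv (T 2) (aut_inv (T 1) (F 0))) = f_theta v.
  rewrite (@T_invF 1 0) // lrmorph_qcomm (@T_invF 2 0) // (@T_invF 2 1) //.
  by rewrite lrmorph_qcomm F21 lrmorph_qcomm (@T_invF 1 2) // (@T_invF 1 0).
by rewrite -e /W /= !aut_inv_funK.
Qed.

Lemma W_e_theta : W (e_theta v) = E 0.
Proof.
have [_ E21] := T1_inv_bracket.
have e : aut_inv (T 1) (aut_inv (T 2) (aut_inv (T 1) (E 0))) = e_theta v.
  rewrite (@T_invE 1 0) // lrmorph_qcomm (@T_invE 2 0) // (@T_invE 2 1) //.
  by rewrite lrmorph_qcomm E21 lrmorph_qcomm (@T_invE 1 2) // (@T_invE 1 0).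
by rewrite -e /W /= !aut_inv_funK.
Qed.

Variables (s : k) (s4 : s ^+ 4 = v^-1).
Variables (Psi : alg_aut (U v)) (PsiE : is_rescaling s Psi).
Local Notation R := (rescaled_braid_r1_inv Psi T).

Lemma s_neq0 : s != 0.
Proof. by apply: contra_neq v0 => s0; apply/invr_inj; rewrite -s4 s0 expr0n invr0. Qed.

Lemma s2E : v^-1 / s / s = s ^+ 2.
Proof.
by rewrite -mulrA -s4 (exprM s 2 2) !expr2 -invfM mulfK // mulf_neq0 ?s_neq0.
Qed.

(** R is Psi^-1 W^-1 Psi, so a claimed value of R can be checked with values of W
    and Psi on generators, without those of the inverses. *)
Lemma R_eq x y : Psi x = W (Psi y) -> R x = y.
Proof.
move=> e; rewrite -[x](aut_funK Psi) e /W /=.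
by rewrite !(aut_funK, aut_inv_funK).
Qed.

Lemma Psi_E i : Psi (E i) = s *: E i. Proof. by case: (PsiE i). Qed.
Lemma Psi_F i : Psi (F i) = F i. Proof. by case: (PsiE i). Qed.
Lemma Psi_K i : Psi (K i) = s *: K i. Proof. by case: (PsiE i). Qed.
Lemma Psi_K' i : Psi (K' i) = s *: K' i. Proof. by case: (PsiE i). Qed.

Lemma Psi_Kinv i : Psi (Kinv i) = s^-1 *: Kinv i.
Proof.
apply: (rmorph_inv_uniq (uKKinv v i) _ (Psi_K i)).
by rewrite -scalerAl -scalerAr scalerA mulVf ?s_neq0 // scale1r uKinvK.
Qed.

Lemma Psi_K'inv i : Psi (K'inv i) = s^-1 *: K'inv i.
Proof.
apply: (rmorph_inv_uniq (uK'K'inv v i) _ (Psi_K' i)).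
by rewrite -scalerAl -scalerAr scalerA mulVf ?s_neq0 // scale1r uK'invK'.
Qed.

Lemma R_F i : i != 0 -> R (F i) = - (E (tau i) * K'inv (tau i)).
Proof.
move=> i0; have [WE _ _ _] := W_letters (tau_neq0 i0).
have [_ WKi'] := W_inv_letters (tau_neq0 i0).
apply: R_eq; rewrite Psi_F.
have -> : Psi (- (E (tau i) * K'inv (tau i))) = - (E (tau i) * K'inv (tau i)).
  rewrite lrmorphN lrmorphM Psi_E Psi_K'inv -scalerAl -scalerAr scalerA.
  by rewrite divff ?s_neq0 // scale1r.
by rewrite lrmorphN lrmorphM WE WKi' tauK mulNr opprK -mulrA uK'invK' mulr1.
Qed.

Lemma R_EK i : i != 0 ->
  R (E i * K' (tau i)) = - (v^-1 *: (Kinv (tau i) * F (tau i) * K'inv i)).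
Proof.
move=> i0; have [_ WF _ _] := W_letters (tau_neq0 i0).
have [WKi _] := W_inv_letters (tau_neq0 i0); have [_ WKi'] := W_inv_letters i0.
apply: R_eq; set x := Kinv (tau i) * _ * _.
have -> : Psi (- (v^-1 *: x)) = - (s ^+ 2 *: x).
  rewrite lrmorphN lrmorphZ !lrmorphM Psi_Kinv Psi_F Psi_K'inv.
  by rewrite -!scalerAl -!scalerAr !scalerA s2E.
have -> : Psi (E i * K' (tau i)) = s ^+ 2 *: (E i * K' (tau i)).
  by rewrite lrmorphM Psi_E Psi_K' -scalerAl -scalerAr scalerA expr2.
rewrite lrmorphN lrmorphZ !lrmorphM WF WKi WKi' tauK -scalerN mulrN mulNr opprK mulrA.
by rewrite uKKinv mul1r.
Qed.

Lemma R_KK i : i != 0 -> R (K i * K' (tau i)) = v^-1 *: (Kinv (tau i) * K'inv i).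
Proof.
move=> i0; have [WKi _] := W_inv_letters (tau_neq0 i0); have [_ WKi'] := W_inv_letters i0.
apply: R_eq.
have -> : Psi (v^-1 *: (Kinv (tau i) * K'inv i)) = s ^+ 2 *: (Kinv (tau i) * K'inv i).
  by rewrite lrmorphZ !lrmorphM Psi_Kinv Psi_K'inv -!scalerAl -!scalerAr !scalerA s2E.
have -> : Psi (K i * K' (tau i)) = s ^+ 2 *: (K i * K' (tau i)).
  by rewrite lrmorphM Psi_K Psi_K' -scalerAl -scalerAr scalerA expr2.
by rewrite lrmorphZ lrmorphM WKi WKi' tauK.
Qed.

Lemma R_KK0 : R (K 0 * K' 0) =
  v ^+ 2 *: (K 0 * K' 0 * (K 1 * K' 2) ^+ 2 * (K 2 * K' 1) ^+ 2).
Proof.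
have [W0 W0'] := W_K0.
have [_ _ WK1 WK1'] := @W_letters 1 isT; have [_ _ WK2 WK2'] := @W_letters 2 isT.
have PsiKK i j : Psi (K i * K' j) = s ^+ 2 *: (K i * K' j).
  by rewrite lrmorphM Psi_K Psi_K' -scalerAl -scalerAr scalerA expr2.
pose x := K 0 * K' 0 * (K 1 * K' 2 * (K 1 * K' 2)) * (K 2 * K' 1 * (K 2 * K' 1)).
rewrite !expr2 -/x; apply: R_eq; rewrite PsiKK.
have -> : Psi (v ^+ 2 *: x) = s ^+ 2 *: x.
  rewrite lrmorphZ (lrmorphM _ (_ * _)) (lrmorphM _ (K 0 * K' 0)).
  rewrite (lrmorphM _ (K 1 * K' 2)) (lrmorphM _ (K 2 * K' 1)) !PsiKK.
  rewrite -!(scalerAl, scalerAr) !scalerA; congr (_ *: _).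
  transitivity (s ^+ 2 * (v * s ^+ 4) ^+ 2); first by ring.
  by rewrite s4 divff // expr1n mulr1.
rewrite lrmorphZ; congr (_ *: _).
rewrite !(lrmorphM W) W0 W0' WK1 WK1' WK2 WK2'.
rewrite -[tau 1]/(2 : 'I_3) -[tau 2]/(1 : 'I_3).
have kk : (K 1 * K 2) ^+ 2 * (K' 0 * (K' 1 * K' 2) ^+ 2) =
    K' 0 * (K 1 * K' 2 * (K 1 * K' 2)) * (K 2 * K' 1 * (K 2 * K' 1)).
  by by_normal normal
    (NMul (NMul (NMul uk1 uk2) (NMul uk1 uk2))
          (NMul ul0 (NMul (NMul ul1 ul2) (NMul ul1 ul2))))
    (NMul (NMul ul0 (NMul (NMul uk1 ul2) (NMul uk1 ul2)))
          (NMul (NMul uk2 ul1) (NMul uk2 ul1))).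
have inv i j : K i * K' j * (Kinv i * K'inv j) = 1.
  by rewrite uKK' -mulrA (mulrA (K i)) uKKinv mul1r uK'K'inv.
rewrite -(mulrA (K 0)) kk; move: (inv 1 2) (inv 2 1).
move: (K 1 * K' 2) (K 2 * K' 1) (Kinv 1 * K'inv 2) (Kinv 2 * K'inv 1) => p q p' q' pp qq.
by rewrite !mulrA !(mulr_cancel _ qq) !(mulr_cancel _ pp).
Qed.

Lemma R_F0 : R (F 0) = f_theta v.
Proof.
apply: R_eq; rewrite Psi_F.
have -> : Psi (f_theta v) = f_theta v by rewrite /f_theta !lrmorph_qcomm !Psi_F.
by rewrite W_f_theta.
Qed.

Definition e_tor : U v := v ^+ 2 *: (e_theta v * (K' 0 * K' 1 * K' 1 * K' 2 * K' 2)).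

Lemma R_EK0 : R (E 0 * K' 0) = e_tor.
Proof.
have [_ W0'] := W_K0.
have [_ _ _ WK1'] := @W_letters 1 isT; have [_ _ _ WK2'] := @W_letters 2 isT.
have qZ2 c c' l (x y : U v) : qcomm l (c *: x) (c' *: y) = (c * c') *: qcomm l x y.
  rewrite /qcomm -!scalerAl -!scalerAr !scalerA scalerBr !scalerA.
  by congr (_ *: _ - _ *: _); ring.
have Psie : Psi (e_theta v) = s ^+ 5 *: e_theta v.
  by rewrite /e_theta !lrmorph_qcomm !Psi_E !qZ2; congr (_ *: _); ring.
apply: R_eq; rewrite lrmorphM Psi_E Psi_K' -scalerAl -scalerAr scalerA.
have -> : Psi e_tor = (s * s) *: (e_theta v * (K' 0 * K' 1 * K' 1 * K' 2 * K' 2)).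
  rewrite /e_tor lrmorphZ lrmorphM Psie !lrmorphM !Psi_K' -!(scalerAl, scalerAr) !scalerA.
  congr (_ *: _); transitivity (s * s * (v * s ^+ 4) ^+ 2); first by ring.
  by rewrite s4 divff // expr1n mulr1.
rewrite lrmorphZ; congr (_ *: _).
rewrite lrmorphM W_e_theta !(lrmorphM W) W0' WK1' WK2'; congr (_ * _).
rewrite -[tau 1]/(2 : 'I_3) -[tau 2]/(1 : 'I_3) (exprMn_comm 2 (uK'K' v 1 2)) !expr2 !mulrA.
by rewrite !(mulr_cancel _ (uK'K'inv v 2)) !(mulr_cancel _ (uK'K'inv v 1)).
Qed.

(** Apply R^-1: [e_tor] comes from E_0 K_0', and [E i] from a multiple of
    F_(tau i) K'_(tau i)^-1, and these two commute. *)
Lemma e_tor_comm i : i != 0 -> e_tor * E i = E i * e_tor.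
Proof.
move=> i0.
have RE : R (- (s ^+ 2 *: (F (tau i) * K'inv (tau i)))) = E i.
  apply: R_eq; have [WE _ _ _] := W_letters i0.
  rewrite lrmorphN lrmorphZ lrmorphM Psi_F Psi_K'inv Psi_E (lrmorphZ W) WE.
  by rewrite -scalerAr scalerA expr2 mulfK ?s_neq0 // scalerN.
rewrite -RE -R_EK0 -!lrmorphM; congr (R _); rewrite mulrN mulNr; congr (- _).
rewrite -scalerAr -scalerAl; congr (_ *: _).
have := tau_neq0 i0; move: (tau i) => j j0.
have [c0j cj0 n0j] : [/\ cartan 0 j = -1, cartan j 0 = -1 & 0 != j].
  by elim/I3P: j j0.
have KF : K' 0 * F j = v^-1 *: (F j * K' 0) by rewrite uK'F c0j.
have KE : K'inv j * E 0 = v^-1 *: (E 0 * K'inv j).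
  have EK : E 0 * K' j = v^-1 *: (K' j * E 0).
    by rewrite uK'E cj0 opprK expr1z scalerA mulVf // scale1r.
  rewrite -[LHS]mulr1 -(uK'K'inv v j) -!mulrA (mulrA (E 0)) EK -!scalerAl -scalerAr.
  by rewrite !mulrA uK'invK' mul1r.
have KK : K' 0 * K'inv j = K'inv j * K' 0.
  rewrite -[LHS]mul1r -(uK'invK' v j) -!mulrA (mulrA (K' j)) uK'K'.
  by rewrite -!mulrA uK'K'inv mulr1.
have FE : E 0 * F j = F j * E 0 by apply: uEF_neq.
rewrite -!mulrA (mulrA (K' 0)) KF (mulrA (K'inv j)) KE -!scalerAl -!scalerAr.
by rewrite -!mulrA KK !mulrA FE.
Qed.

End BraidOperators.

(** * The theorem *)

Lemma qv_nontorsion n : qv ^+ n.+1 != 1.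
Proof.
rewrite -[1]/(tofrac 1) -rmorphXn /= tofrac_eq; apply/eqP=> e.
by have := congr1 (fun p : {poly rat} => size p) e; rewrite /= size_polyXn size_poly1.
Qed.

Lemma qv_neq0 : qv != 0.
Proof. by rewrite tofrac_eq0 polyX_eq0. Qed.

Section Main.
Variables (k : fieldType) (emb : {rmorphism Qv -> k}).
Local Notation v := (emb qv).
Local Notation E := (uE v).
Local Notation F := (uF v).
Local Notation K := (uK v).
Local Notation K' := (uK' v).
Local Notation Kinv := (uKinv v).
Local Notation K'inv := (uK'inv v).
Variables (vhalf s : k) (vhalfE : vhalf ^+ 2 = v) (sE : s ^+ 2 = - vhalf^-1).
Variables (iota : {lrmorphism iU qv -> U v | emb \; *:%R}).
Hypothesis iotaE : is_iquantum_embedding iota.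
Variables (T : 'I_3 -> alg_aut (U v)) (TE : forall i, is_braid i (T i)).
Variables (Psi : alg_aut (U v)) (PsiE : is_rescaling s Psi).
Local Notation R := (rescaled_braid_r1_inv Psi T).
Let Ti := iT1inv qv_neq0 qv_nontorsion.

Let v0 : v != 0. Proof. by rewrite fmorph_eq0 qv_neq0. Qed.
Let vn n : v ^+ n.+1 != 1. Proof. by rewrite -rmorphXn fmorph_eq1 qv_nontorsion. Qed.
Let s4 : s ^+ 4 = v^-1.
Proof. by rewrite (exprM s 2 2) sE sqrrN exprVn vhalfE. Qed.

Lemma KK'_inv i j : K i * K' j * (Kinv i * K'inv j) = 1.
Proof. by rewrite uKK' -mulrA (mulrA (K i)) uKKinv mul1r uK'K'inv. Qed.

Lemma KK'_invl i j : Kinv i * K'inv j * (K i * K' j) = 1.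
Proof. by rewrite uKK' mulrA -(mulrA (Kinv i)) uK'invK' mulr1 uKinvK. Qed.

Lemma iotaZ c x : iota (c *: x) = emb c *: iota x.
Proof. exact: linearZ. Qed.

Lemma iotaM x y : iota (x * y) = iota x * iota y.
Proof. exact: rmorphM. Qed.

Lemma iotaN x : iota (- x) = - iota x.
Proof. exact: rmorphN. Qed.

Lemma iota_qcomm c x y : iota (qcomm c x y) = qcomm (emb c) (iota x) (iota y).
Proof. by rewrite /qcomm rmorphB /= iotaZ !rmorphM. Qed.

Lemma iota_braid_poly x1 x2 x0 y1 y2 : iota (braid_poly qv x1 x2 x0 y1 y2) =
  braid_poly v (iota x1) (iota x2) (iota x0) (iota y1) (iota y2).
Proof.
rewrite /braid_poly rmorphD rmorphB /= !iotaZ !rmorphM /= !iota_qcomm.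
by rewrite rmorph1 rmorphXn.
Qed.

Lemma iotaB j : iota (iB qv j) = F j + E (tau j) * K' j.
Proof. by case: iotaE => ->. Qed.

Lemma iotaK j : j != 0 -> iota (iK qv j) = K j * K' (tau j).
Proof. by case: iotaE => _ _; apply. Qed.

Lemma iotaKinv j : j != 0 -> iota (iKinv qv j) = Kinv j * K'inv (tau j).
Proof.
move=> j0; apply: (@inv_uniq _ (K j * K' (tau j))); last exact: KK'_inv.
by rewrite -iotaK // -rmorphM (ir_dK (iU_irels qv)) rmorph1.
Qed.

Lemma TiB j : Ti (iB qv j) = braidB qv (iB qv) (iK qv) (iKinv qv) j.
Proof. exact: iU_liftB. Qed.

Lemma TiK j : Ti (iK qv j) = braidK qv (iK qv) (iKinv qv) j.
Proof. exact: iU_liftK. Qed.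

Definition intertwined (x : iU qv) : Prop := intertwines (iota (Ti x)) (R (iota x)).

Lemma intertwinedM x y : intertwined x -> intertwined y -> intertwined (x * y).
Proof. by rewrite /intertwined !rmorphM; apply: intertwinesM. Qed.

Lemma intertwinedD x y : intertwined x -> intertwined y -> intertwined (x + y).
Proof. by rewrite /intertwined !rmorphD; apply: intertwinesD. Qed.

Lemma intertwinedC c : intertwined (c *: 1).
Proof.
rewrite /intertwined (lrmorphZ Ti) !iotaZ (lrmorphZ R).
rewrite (rmorph1 Ti) (rmorph1 iota) (rmorph1 R).
exact/intertwinesZ/intertwines1.
Qed.

Lemma intertwines_torusV i : i != 0 ->
  intertwines (Kinv i * K'inv (tau i)) (Kinv i * K'inv (tau i)).
Proof.
move=> i0; apply: intertwinesV (intertwines_torus v0 i0); first exact: KK'_invl.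
exact: KK'_inv.
Qed.

Lemma intertwined_K j : intertwined (iK qv j).
Proof.
rewrite /intertwined TiK; have [j0|j0] := eqVneq j 0; last first.
  rewrite /braidK (negPf j0) iotaZ iotaKinv ?tau_neq0 // tauK iotaK //.
  rewrite (R_KK v0 vn TE s4 PsiE) // fmorphV.
  by have := intertwines_torusV (tau_neq0 j0); rewrite tauK; apply: intertwinesZ.
have iK0 : iota (iK qv 0) = - v ^+ 2 *: (K 0 * K' 0) by case: iotaE.
pose X := K 0 * K' 0 * (K 1 * K' 2) ^+ 2 * (K 2 * K' 1) ^+ 2.
have -> : iota (braidK qv (iK qv) (iKinv qv) j) = v ^+ 2 *: (- v ^+ 2 *: X).
  rewrite j0 /braidK [0 == 0]/= iotaZ (rmorphXn emb) (iotaM (_ * _)) (iotaM (iK qv 0)) iK0.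
  by rewrite !expr2 !iotaM !iotaK // -!scalerAl.
have -> : R (iota (iK qv j)) = v ^+ 2 *: (- v ^+ 2 *: X).
  by rewrite j0 iK0 lrmorphZ (R_KK0 v0 vn TE s4 PsiE) !scalerA mulrC.
have i1 := intertwines_torus v0 (isT : is_true ((1 : 'I_3) != 0)).
have i2 := intertwines_torus v0 (isT : is_true ((2 : 'I_3) != 0)).
do 2!apply: intertwinesZ; rewrite /X !expr2.
apply: intertwinesM (intertwinesM i2 i2); apply: intertwinesM (intertwinesM i1 i1).
exact: intertwines_K0.
Qed.

Lemma intertwined_Kinv j : intertwined (iKinv qv j).
Proof.
apply: (intertwinesV (a := iota (Ti (iK qv j))) (b := R (iota (iK qv j)))).
- by rewrite -!rmorphM (ir_dK (iU_irels qv)) !rmorph1.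
- by rewrite -!rmorphM (ir_Kd (iU_irels qv)) !rmorph1.
- exact: intertwined_K.
Qed.

Lemma intertwined_B0 : intertwined (iB qv 0).
Proof.
have j1 : (1 : 'I_3) != 0 by []. have j2 : (2 : 'I_3) != 0 by [].
rewrite /intertwined TiB.
rewrite -[braidB _ _ _ _ 0]/(braid_poly qv (iB qv 1) (iB qv 2) (iB qv 0) (iK qv 1) (iK qv 2)).
rewrite iota_braid_poly !iotaB.
rewrite (iotaK j1) (iotaK j2) [braid_poly _ _ _ _ _ _]braid_polyD lrmorphD.
apply: intertwinesD.
- rewrite (R_F0 v0 vn TE PsiE) -(braid_poly_F v0 vn).
  apply: intertwines_braid_poly (intertwines_torus v0 j1) (intertwines_torus v0 j2);
    [exact: (intertwines_B v0 vn j1)|exact: (intertwines_B v0 vn j2)|].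
  by apply: intertwines_comm; rewrite uEF_neq.
- rewrite (R_EK0 v0 vn TE s4 PsiE) [braid_poly _ _ _ _ _ _](braid_poly_E v0 vn) -/(e_tor v).
  by apply: intertwines_comm; apply: (e_tor_comm v0 vn TE s4 PsiE).
Qed.

Lemma intertwined_B j : intertwined (iB qv j).
Proof.
have [->|j0] := eqVneq j 0; first exact: intertwined_B0.
rewrite /intertwined TiB /braidB (negPf j0) iotaN iotaZ iotaM.
rewrite iotaKinv // iotaB lrmorphD (R_F v0 vn TE s4 PsiE) //.
have -> : R (E (tau j) * K' j) = - (v^-1 *: (Kinv j * F j * K'inv (tau j))).
  by have := R_EK v0 vn TE s4 PsiE (tau_neq0 j0); rewrite tauK.
have -> : - (E (tau j) * K'inv (tau j)) - v^-1 *: (Kinv j * F j * K'inv (tau j))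
    = - (v *: (Bbar v j * (Kinv j * K'inv (tau j)))).
  have KF : Kinv j * F j = v ^+ 2 *: (F j * Kinv j).
    have FK : F j * K j = v ^+ 2 *: (K j * F j).
      by rewrite uKF /cartan eqxx scalerA divff ?scale1r // expf_neq0.
    rewrite -[LHS]mulr1 -(uKKinv v j) -!mulrA (mulrA (F j)) FK -!scalerAl -scalerAr.
    by rewrite !mulrA uKinvK mul1r.
  rewrite /Bbar KF mulrDl -!scalerAl scalerDr !scalerA divff // scale1r -opprD addrC.
  have -> : v^-1 * v ^+ 2 = v by rewrite expr2 mulrA mulVf // mul1r.
  by rewrite !mulrA -(mulrA _ (K j)) uKKinv mulr1.
apply/intertwinesN/intertwinesZ/intertwinesM; first exact: intertwines_B.
exact: intertwines_torusV.
Qed.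

Lemma intertwined_all x : intertwined x.
Proof.
elim/clsE: x; elim=> [[j|j|j]|c|x IHx y IHy|x IHx y IHy].
- exact: intertwined_B.
- exact: intertwined_K.
- exact: intertwined_Kinv.
- by rewrite clsC; apply: intertwinedC.
- by rewrite clsD; apply: intertwinedD.
- by rewrite clsM; apply: intertwinedM.
Qed.

End Main.

Theorem theorem2p7 (k : fieldType) (emb : {rmorphism Qv -> k})
    (vhalf s : k) (vhalfE : vhalf ^+ 2 = emb qv) (sE : s ^+ 2 = - vhalf^-1)
    (iota : {lrmorphism iU qv -> U (emb qv) | emb \; *:%R})
    (iotaE : is_iquantum_embedding iota) (iota_inj : injective iota)
    (T : 'I_3 -> alg_aut (U (emb qv))) (TE : forall i, is_braid i (T i))
    (Psi : alg_aut (U (emb qv))) (PsiE : is_rescaling s Psi) :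
  let B := iB qv in let KK := iK qv in let KKinv := iKinv qv in
  exists T1inv : alg_aut (iU qv),
    (forall x : iU qv,
       to_Uhat (iota (T1inv x)) * Upsilon (emb qv) =
       Upsilon (emb qv) * to_Uhat (rescaled_braid_r1_inv Psi T (iota x))) /\
    [/\ T1inv (KK 1) = qv^-1 *: KKinv 2,
        T1inv (KK 2) = qv^-1 *: KKinv 1 &
        T1inv (KK 0) = qv ^+ 2 *: (KK 0 * KK 1 ^+ 2 * KK 2 ^+ 2)] /\
    [/\ T1inv (B 1) = - (qv *: (B 1 * KKinv 1)),
        T1inv (B 2) = - (qv *: (B 2 * KKinv 2)) &
        T1inv (B 0) =
          qv *: qcomm 1 (qcomm qv (B 1) (B 2))
                        (qcomm 1 (B 2) (qcomm qv (B 1) (B 0)))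
          - qcomm 1 (qcomm (qv ^+ 3) (B 1) (B 2)) (B 0) * KK 2
          + qv *: (B 0 * KK 1 * KK 2)].
Proof.
exists (iT1inv_aut qv_neq0 qv_nontorsion); split.
  exact: (intertwined_all vhalfE sE iotaE TE PsiE).
by split; split; rewrite /= ?iU_liftB ?iU_liftK.
Qed.
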